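(* Let $\Omega\subseteq\mathbb{R}^n$ be a bounded open set with Lipschitz boundary. Then there exists a constant $\Theta>0$, depending only on $n$, $s$, and $g$, such that, given any measurable function $\varphi:\mathbb{R}^n\setminus\Omega\to\mathbb{R}$ with $$\mathrm{Tail}_s(\varphi,\Omega_{\Theta\,\mathrm{diam}(\Omega)}\setminus\Omega;\,\cdot\,)\in L^1(\Omega),$$ there exists a unique minimizer $u$ of $\mathcal{F}$ within $\mathcal{W}^s_\varphi(\Omega)$. Moreover, $u$ satisfies $$\|u\|_{W^{s,1}(\Omega)}\le C\left(\left\|\mathrm{Tail}_s(\varphi,\Omega_{\Theta\,\mathrm{diam}(\Omega)}\setminus\Omega;\,\cdot\,)\right\|_{L^1(\Omega)}+1\right),$$ for some constant $C>0$ depending only on $n$, $s$, $g$, and $\Omega$.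
   Context: $n\ge1$ is an integer, $s\in(0,1)$, and $g:\mathbb{R}\to(0,1]$ is an even continuous function with $\int_{\mathbb{R}}g(t)|t|\,dt<\infty$. Set $G(t):=\int_0^t g(\tau)\,d\tau$ and $\mathcal{G}(t):=\int_0^t G(\tau)\,d\tau$. For an open set $\Omega\subseteq\mathbb{R}^n$, $Q(\Omega):=\mathbb{R}^{2n}\setminus(\mathbb{R}^n\setminus\Omega)^2$. Put $[u]_{W^{s,1}(\Omega)}:=\int_\Omega\int_\Omega\frac{|u(x)-u(y)|}{|x-y|^{n+s}}\,dx\,dy$, $\|u\|_{W^{s,1}(\Omega)}:=\|u\|_{L^1(\Omega)}+[u]_{W^{s,1}(\Omega)}$, and let $W^{s,1}(\Omega)$ be the corresponding space. Let $\mathcal{W}^s(\Omega):=\{u:\mathbb{R}^n\to\mathbb{R}\text{ measurable}: u|_\Omega\in W^{s,1}(\Omega)\}$ and, for measurable $\varphi:\mathbb{R}^n\setminus\Omega\to\mathbb{R}$, $\mathcal{W}^s_\varphi(\Omega):=\{v\in\mathcal{W}^s(\Omega): v=\varphi\text{ a.e. in }\mathbb{R}^n\setminus\Omega\}$. Functions are identified when equal a.e. $u$ is a minimizer of $\mathcal{F}$ in $\Omega$ (bounded, Lipschitz) if $u\in\mathcal{W}^s(\Omega)$ and $$\iint_{Q(\Omega)}\left\{\mathcal{G}\left(\frac{u(x)-u(y)}{|x-y|}\right)-\mathcal{G}\left(\frac{v(x)-v(y)}{|x-y|}\right)\right\}\frac{dx\,dy}{|x-y|^{n-1+s}}\le0$$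 for every $v\in\mathcal{W}^s(\Omega)$ with $v=u$ a.e. in $\mathbb{R}^n\setminus\Omega$ (the integral converges absolutely for all such $u,v$). A minimizer of $\mathcal{F}$ within $\mathcal{W}^s_\varphi(\Omega)$ is a minimizer of $\mathcal{F}$ in $\Omega$ that belongs to $\mathcal{W}^s_\varphi(\Omega)$. For $\varrho>0$, $\Omega_\varrho:=\{x\in\mathbb{R}^n:\mathrm{dist}(x,\Omega)<\varrho\}$. For measurable $O\subseteq\mathbb{R}^n\setminus\Omega$ and $x\in\Omega$, $\mathrm{Tail}_s(\varphi,O;x):=\int_O\frac{|\varphi(y)|}{|x-y|^{n+s}}\,dy$. *)

(* Defs.v *)
From HB Require Import structures.
From mathcomp Require Import all_boot all_order all_algebra.
From mathcomp Require Import all_classical all_reals all_analysis.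

Set Implicit Arguments.
Unset Strict Implicit.
Unset Printing Implicit Defensive.
Import Order.TTheory GRing.Theory Num.Theory.
Import numFieldNormedType.Exports.

Local Open Scope classical_set_scope.
Local Open Scope ring_scope.

(** Lebesgue measure on row vectors.  ['rV[R]_n] carries the product of the
    Borel sigma-algebras of its coordinates, which is the Borel sigma-algebra
    of its topology. *)

Definition rV_display : measure_display -> measure_display.
Proof. exact. Qed.

Section measurable_rV.
Context {R : realType}.
Variable n : nat.

Definition rV_coord (i : 'I_n) (x : 'rV[R]_n) : measurableTypeR R := x ord0 i.

Let rV_set0 : g_sigma_preimage rV_coord set0.
Proof. exact: sigma_algebra0. Qed.

Let rV_setC A : g_sigma_preimage rV_coord A -> g_sigma_preimage rV_coord (~` A).
Proof. exact: sigma_algebraC. Qed.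

Let rV_bigcup (F : (set 'rV[R]_n)^nat) :
  (forall i, g_sigma_preimage rV_coord (F i)) ->
  g_sigma_preimage rV_coord (\bigcup_i (F i)).
Proof. exact: sigma_algebra_bigcup. Qed.

HB.instance Definition _ := @isMeasurable.Build
  (rV_display (measure_tuple_display default_measure_display))
  'rV[R]_n (g_sigma_preimage rV_coord) rV_set0 rV_setC rV_bigcup.

End measurable_rV.

Section measurable_rV_lemmas.
Context {R : realType}.

Lemma measurable_rV_coord n (i : 'I_n) :
  measurable_fun [set: 'rV[R]_n] (@rV_coord R n i).
Proof.
move=> _ Y mY; rewrite setTI; apply: sub_sigma_algebra => /=.
rewrite -bigcup_seq/=; exists i => /=; first by rewrite mem_index_enum.
by exists Y => //; rewrite setTI.
Qed.

Lemma measurable_fun_rVP d (T : measurableType d) n (f : T -> 'rV[R]_n) :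
  (forall i, measurable_fun setT (@rV_coord R n i \o f)) ->
  measurable_fun setT f.
Proof.
move=> mf.
suff sub : g_sigma_preimage (fun i => @rV_coord R n i \o f) `<=` measurable.
  rewrite g_sigma_preimage_comp in sub.
  by move=> _ A mA; apply: sub; exists A.
apply: smallest_sub; first exact: sigma_algebra_measurable.
case: n => [|n] in f mf *; first by rewrite big_ord0.
rewrite -bigcup_mkord_ord; apply: bigcup_sub => i Ii.
by move=> A [B mB <-]; exact: mf.
Qed.

Definition rV_cons n (p : (measurableTypeR R * 'rV[R]_n)%type) : 'rV[R]_n.+1 :=
  row_mx (p.1 : R)%:M p.2.

Definition rV_uncons n (x : 'rV[R]_n.+1) : (measurableTypeR R * 'rV[R]_n)%type :=
  (x ord0 ord0, rsubmx (x : 'M[R]_(1, 1 + n))).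

Lemma rV_consE0 n p (i : 'I_1) : @rV_cons n p ord0 (lshift n i) = p.1.
Proof. by apply: etrans (row_mxEl _ _ _ _) _; rewrite mxE !ord1. Qed.

Lemma rV_consES n p (i : 'I_n) : @rV_cons n p ord0 (rshift 1 i) = p.2 ord0 i.
Proof. exact: row_mxEr. Qed.

Lemma rV_consK n : cancel (@rV_cons n) (@rV_uncons n).
Proof.
case=> a x; congr pair; last exact: row_mxKr.
by rewrite -[RHS](rV_consE0 (a, x) ord0); congr (rV_cons _ _ _); exact: val_inj.
Qed.

Lemma measurable_rV_cons n : measurable_fun setT (@rV_cons n).
Proof.
apply: measurable_fun_rVP => i; case: (@split_ordP 1 n i) => j ->.
  rewrite (_ : _ \o _ = fst)//; apply/funext => p; exact: rV_consE0.
rewrite (_ : _ \o _ = @rV_coord R n j \o snd).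
  by apply: measurableT_comp => //; exact: measurable_rV_coord.
by apply/funext => p; exact: rV_consES.
Qed.

Lemma measurable_rV_uncons n : measurable_fun setT (@rV_uncons n).
Proof.
apply/measurable_fun_pairP; split; first exact: (measurable_rV_coord ord0).
apply: measurable_fun_rVP => i.
rewrite (_ : _ \o _ = @rV_coord R n.+1 (rshift 1 i)).
  exact: measurable_rV_coord.
by apply/funext => x; rewrite /rV_coord/= mxE.
Qed.

End measurable_rV_lemmas.

Section volume_cons.
Local Open Scope ereal_scope.
Context {R : realType} (n : nat).
Variable m : {sigma_finite_measure set 'rV[R]_n -> \bar R}.

Definition volume_cons : set 'rV[R]_n.+1 -> \bar R :=
  pushforward (lebesgue_measure \x m) (@rV_cons R n).

Let pushforward_cons : {measure set 'rV[R]_n.+1 -> \bar R} :=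
  measure_function_pushforward__canonical__measure_function_Measure
    (lebesgue_measure \x m) (@measurable_rV_cons R n).

HB.instance Definition _ := isMeasure.Build _ _ _ volume_cons
  (measure0 pushforward_cons) (measure_ge0 pushforward_cons)
  (@measure_semi_sigma_additive _ _ _ pushforward_cons).

Let volume_cons_sigma_finite : sigma_finite setT volume_cons.
Proof.
have /sigma_finiteP[F [FT ndF Foo]] := sigma_finiteT (@lebesgue_measure R).
have /sigma_finiteP[G [GT ndG Goo]] := sigma_finiteT m.
exists (fun k => @rV_uncons R n @^-1` (F k `*` G k)).
  apply/esym; rewrite -subTset => x _.
  have [i _ Fi] : (\bigcup_i F i) (rV_uncons x).1 by rewrite -FT.
  have [j _ Gj] : (\bigcup_i G i) (rV_uncons x).2 by rewrite -GT.
  exists (maxn i j) => //; split.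
  - by move: Fi; exact/subsetPset/ndF/leq_maxl.
  - by move: Gj; exact/subsetPset/ndG/leq_maxr.
move=> k; have [mF Fk] := Foo k; have [mG Gk] := Goo k; split.
  by rewrite -[X in measurable X]setTI; apply: measurable_rV_uncons => //;
    exact: measurableX.
rewrite /volume_cons /pushforward -comp_preimage.
rewrite (_ : _ \o _ = id) ?preimage_id; last first.
  by apply/funext => p; exact: rV_consK.
by rewrite product_measure1E// lte_mul_pinfty// ge0_fin_numE.
Qed.

HB.instance Definition _ := Measure_isSigmaFinite.Build _ _ _ volume_cons
  volume_cons_sigma_finite.

End volume_cons.

(* The [n]-dimensional Lebesgue measure. *)
Fixpoint volume {R : realType} n :
    {sigma_finite_measure set 'rV[R]_n -> \bar R} :=
  match n return {sigma_finite_measure set 'rV[R]_n -> \bar R} with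
  | 0 => dirac (0 : 'rV[R]_0)
  | k.+1 => volume_cons (volume k)
  end.

(** Euclidean geometry (the library norm on ['rV[R]_n] is the sup norm). *)

Section euclidean.
Context {R : realType} {n : nat}.
Implicit Types (x y : 'rV[R]_n) (A Omega : set 'rV[R]_n).

Definition dotp x y : R := \sum_(i < n) x ord0 i * y ord0 i.

Definition enorm x : R := Num.sqrt (dotp x x).

Definition ediam A : R := sup [set enorm (p.1 - p.2) | p in A `*` A].

(* [+oo] when [A] is empty. *)
Definition edist x A : \bar R := ereal_inf [set (enorm (x - y))%:E | y in A].

Definition enlarge A (rho : R) : set 'rV[R]_n :=
  [set x | (edist x A < rho%:E)%E].

(* Near each boundary point [x0], [Omega] is the strict epigraph, in the
   direction of some unit vector [e], of a Lipschitz function [gamma] on the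
   hyperplane orthogonal to [e]. *)
Definition lipschitz_boundary Omega : Prop :=
  forall x0, (closure Omega `\` interior Omega) x0 ->
  exists (r L : R) (e : 'rV[R]_n) (gamma : 'rV[R]_n -> R),
    [/\ 0 < r, enorm e = 1,
        (forall y z, dotp y e = 0 -> dotp z e = 0 ->
           `|gamma y - gamma z| <= L * enorm (y - z)) &
        forall x, enorm (x - x0) < r ->
          (Omega x <-> gamma (x - dotp x e *: e) < dotp x e)].

End euclidean.

Section functional.
Context {R : realType}.

(* The oriented integral of [f] from [0] to [t]. *)
Definition integral0 (f : R -> R) (t : R) : R :=
  if 0 <= t then \int[lebesgue_measure]_(x in `[0, t]) f x
  else - \int[lebesgue_measure]_(x in `[t, 0]) f x.

Definition calG (g : R -> R) : R -> R := integral0 (integral0 g).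

Variable n : nat.
Implicit Types (s : R) (g : R -> R) (Omega O : set 'rV[R]_n).
Implicit Types u v phi : 'rV[R]_n -> R.

Definition L1norm (A : set 'rV[R]_n) (f : 'rV[R]_n -> \bar R) : \bar R :=
  (\int[volume n]_(x in A) `|f x|)%E.

Definition gagliardo s Omega u : \bar R :=
  (\int[volume n]_(x in Omega) \int[volume n]_(y in Omega)
     (`|u x - u y| / enorm (x - y) `^ (n%:R + s))%:E)%E.

Definition W1norm s Omega u : \bar R :=
  (L1norm Omega (EFin \o u) + gagliardo s Omega u)%E.

Definition calW s Omega : set ('rV[R]_n -> R) :=
  [set u | measurable_fun setT u /\ (W1norm s Omega u < +oo)%E].

(* [phi] is a total function of which only the values outside [Omega] matter. *)
Definition calW_ext s Omega phi : set ('rV[R]_n -> R) :=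
  [set v | calW s Omega v /\ v = phi %[ae volume n in ~` Omega]].

Definition Qset Omega : set ('rV[R]_n * 'rV[R]_n) :=
  ~` ((~` Omega) `*` (~` Omega)).

(* On the diagonal, which is null, the convention [x / 0 = 0] applies; the same
   holds in [gagliardo]. *)
Definition energy_diff s g u v (p : 'rV[R]_n * 'rV[R]_n) : R :=
  let d := enorm (p.1 - p.2) in
  (calG g ((u p.1 - u p.2) / d) - calG g ((v p.1 - v p.2) / d))
    / d `^ (n%:R - 1 + s).

(* Absolute convergence is required explicitly, since [\int] also assigns a
   value to functions that are not integrable. *)
Definition minimizer s g Omega u : Prop :=
  calW s Omega u /\
  forall v, calW s Omega v -> v = u %[ae volume n in ~` Omega] ->
    (volume n \x volume n)%E.-integrable (Qset Omega)
      (EFin \o energy_diff s g u v) /\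
    (\int[(volume n \x volume n)%E]_(p in Qset Omega)
       (energy_diff s g u v p)%:E <= 0)%E.

Definition minimizer_within s g Omega phi u : Prop :=
  minimizer s g Omega u /\ calW_ext s Omega phi u.

Definition Tail s phi O (x : 'rV[R]_n) : \bar R :=
  (\int[volume n]_(y in O)
     (`|phi y| / enorm (x - y) `^ (n%:R + s))%:E)%E.

End functional.

(* Main.v *)
(** Writing [c = calG g], the energy density is even, Lipschitz, strictly convex
    and differs from a cone [cs * |t|] by at most [lam].  Subtracting the value at
    [t = 0] from the interaction with the exterior datum makes the energy of [v] a
    convergent integral; adding to it the integral over [Omega] of
    [2 cs Tail + lam \int_O |x - y|^(1 - n - s) dy] makes its integrand nonnegative
    and coercive, because for [Theta] large the part of the kernel in the collar
    [O = Omega_{Theta diam} \ Omega] dominates the part outside it.  A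
    fractional Hardy inequality [\int_Omega |v| \int_{~Omega} |x - y|^(-n-s) dy dx
    < +oo] on Lipschitz domains shows that differences of this functional are the
    differences of energies in the definition of a minimizer.  It is proved by
    comparing the mass of [|v|] in geometrically thinner layers along the
    boundary: translating a layer inwards costs a piece of the Gagliardo seminorm.

    Minimizers come from the direct method without compactness: a quantitative
    strict convexity inequality, tested against a set far from [Omega] where [phi] is
    bounded, forces a fast minimizing sequence to converge almost everywhere;
    Fatou's lemma gives lower semicontinuity.  The same inequality gives
    uniqueness, and comparison with the extension of [phi] by zero gives the
    bound. *)

Require Import Defs.
From mathcomp Require Import all_boot all_order all_algebra.
From mathcomp Require Import all_classical all_reals all_analysis.
From mathcomp Require Import measurable_realfun lra ring.

Set Implicit Arguments.
Unset Strict Implicit.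
Unset Printing Implicit Defensive.
Import Order.TTheory GRing.Theory Num.Theory.
Import numFieldNormedType.Exports.

Local Open Scope classical_set_scope.
Local Open Scope ring_scope.

(** * The energy density *)

(** [Theta] does not depend on [Omega] because of scaling: beyond distance r from a point the kernel
    of exponent n + s has integral of order r^(-s), so the annulus at distance d = [ediam Omega] and
    the far field beyond a multiple of d both carry the factor d^(-s), and only a numerical ratio
    remains to be adjusted.

    In the Hardy inequality, a boundary layer N times thinner fills only a fraction of order 1/N of
    each ball, while its weight grows by N^s; as s < 1, a large N makes the masses contract.

    Strict convexity is not uniform: g has no positive lower bound, so the convexity gap holds with
    a constant that depends on the size of the values. The gap is therefore tested at level 2^i on
    the set where two consecutive functions are at most 2^i, and the i-th energy excess is chosen
    below 4^(-i) times the constant of that level. The L^1 bound given by coercivity controls the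
    points where the level is exceeded.

    The slope [cs] is the supremum of G and [lam] is the integral of g(t)|t|; the moment hypothesis
    on g makes both finite. *)

Section one_variable.
Context {R : realType}.
Implicit Types (f df g : R -> R) (a b t : R).
Notation mu := (@lebesgue_measure R).

Lemma MVT_total f df a b : (forall x : R, is_derive x 1 f (df x)) -> a <= b ->
  exists2 c, a <= c <= b & f b - f a = df c * (b - a).
Proof.
move=> fdf ab; have [//|c cab ->] := @MVT_segment R f df a b ab (fun x _ => fdf x).
  apply: continuous_subspaceT => x; apply: differentiable_continuous.
  by apply/derivable1_diffP; have [] := fdf x.
by exists c => //; move: cab; rewrite in_itv.
Qed.

Lemma is_derive_ge0_le f df a b : (forall x : R, is_derive x 1 f (df x)) ->
  a <= b -> (forall x, a <= x <= b -> 0 <= df x) -> f a <= f b.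
Proof.
move=> fdf ab df0; have [c /df0 c0 e] := MVT_total fdf ab.
by rewrite -subr_ge0 e mulr_ge0// subr_ge0.
Qed.

Lemma continuous_integrable f a b : continuous f ->
  mu.-integrable `[a, b] (EFin \o f).
Proof.
move=> cf; apply: continuous_compact_integrable; first exact: segment_compact.
exact: continuous_subspaceT.
Qed.

(** A base point [a] to the left of both 0 and [t] turns the definition by sign of [t] into one
    formula, to which the fundamental theorem of calculus applies. *)
Lemma integral0E f a t : continuous f -> a < 0 -> a < t ->
  Defs.integral0 f t = \int[mu]_(x in `[a, t]) f x - \int[mu]_(x in `[a, 0]) f x.
Proof.
move=> cf a0 at0; rewrite /Defs.integral0; case: ifPn => [t0|].
  rewrite Rintegral_itvB//; last by rewrite bnd_simp ltW.
    rewrite Rintegral_itv_obnd_cbnd//.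
    apply: integrableS (continuous_integrable 0 t cf) => //.
    exact: subset_itv_oc_cc.
  exact: continuous_integrable.
rewrite -ltNge => t0; rewrite -[LHS]opprK opprK -[RHS]opprB; congr (- _).
rewrite Rintegral_itvB//; last by rewrite bnd_simp ltW.
  rewrite Rintegral_itv_obnd_cbnd//.
  apply: integrableS (continuous_integrable t 0 cf) => //.
  exact: subset_itv_oc_cc.
- exact: continuous_integrable.
- by rewrite bnd_simp ltW.
Qed.

Lemma integral0_is_derive f t : continuous f -> is_derive t 1 (Defs.integral0 f) (f t).
Proof.
move=> cf; pose a := - (`|t| + 1).
have a0 : a < 0 by rewrite /a oppr_lt0; have := normr_ge0 t; lra.
have at0 : a < t by rewrite /a; have := ler_norm (- t); rewrite normrN; lra.
have tt1 : t < t + 1 by lra.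
have [dF dFE] := @continuous_FTC1_closed R f a t (t + 1) tt1
  (continuous_integrable _ _ cf) at0 (cf t).
have dF' := derivableP dF; rewrite -derive1E dFE in dF'.
pose c := \int[mu]_(x in `[a, 0]) f x.
have dFc : is_derive t 1 (fun y => \int[mu]_(x in `[a, y]) f x - c) (f t).
  by rewrite -[f t]subr0; apply: is_deriveB.
apply: near_eq_is_derive dFc => //; near=> y.
rewrite (@integral0E f a)//.
near: y; exact: lt_nbhsr.
Unshelve. all: by end_near. Qed.

Lemma is_derive_continuous f df : (forall x : R, is_derive x 1 f (df x)) ->
  continuous f.
Proof.
move=> fdf x; apply: differentiable_continuous.
by apply/derivable1_diffP; have [] := fdf x.
Qed.

Lemma is_derive_inj f df (h : R -> R) : (forall x : R, is_derive x 1 f (df x)) ->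
  (forall x : R, is_derive x 1 h (df x)) -> f 0 = h 0 -> f =1 h.
Proof.
move=> fdf hdf fh0 t.
have fh (x : R) : is_derive x 1 (fun y => f y - h y) 0.
  by rewrite -(subrr (df x)); apply: is_deriveB.
suff : f t - h t = f 0 - h 0 by rewrite fh0 subrr => /subr0_eq.
have [t0|/ltW t0] := leP 0 t.
  by have [c _ /eqP] := MVT_total fh t0; rewrite mul0r subr_eq0 => /eqP.
by have [c _ /eqP] := MVT_total fh t0; rewrite mul0r subr_eq0 => /eqP.
Qed.

Lemma is_derive_mulf f h (x df dh : R) : is_derive x 1 f df ->
  is_derive x 1 h dh -> is_derive x 1 (fun y => f y * h y) (f x * dh + h x * df).
Proof. by move=> fdf hdh; exact: (is_deriveM fdf hdh). Qed.

Lemma is_derive_subf f h (x df dh : R) : is_derive x 1 f df ->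
  is_derive x 1 h dh -> is_derive x 1 (fun y => f y - h y) (df - dh).
Proof. by move=> fdf hdh; exact: (is_deriveB fdf hdh). Qed.

End one_variable.

(** The interface through which all later sections see [calG g]. The constant [k] of [ed_gap]
    depends on [M] because the second derivative [g] of [calG g] tends to be small where its
    argument is large. *)
Record energy_density (R : realType) (c : R -> R) (cs lam : R) : Prop := {
  ed_slope_gt0 : 0 < cs ;
  ed_lam_ge0 : 0 <= lam ;
  ed_even : forall t, c (- t) = c t ;
  ed_eq0 : c 0 = 0 ;
  ed_lip : forall a b, `|c a - c b| <= cs * `|a - b| ;
  ed_lb : forall t, cs * `|t| - lam <= c t ;
  ed_gap : forall M, exists2 k, 0 < k & forall a b, `|a| <= M -> `|b| <= M ->
    c ((a + b) / 2) + k * (a - b) ^+ 2 <= (c a + c b) / 2 }.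

Section calG_density.
Context {R : realType} (g : R -> R).
Hypotheses (g_gt0 : forall t, 0 < g t) (g_even : forall t, g (- t) = g t)
  (g_cont : continuous g)
  (g_int : (\int[lebesgue_measure]_t (g t * `|t|)%:E < +oo)%E).
Notation mu := (@lebesgue_measure R).
Let G := Defs.integral0 g.
(** By parts, [I t] is the integral of tau * g(tau) from 0 to [t], which the moment of [g]
    bounds. *)
Let I t := t * G t - calG g t.

Let dG (t : R) : is_derive t 1 G (g t). Proof. exact: integral0_is_derive. Qed.

Let cG : continuous G. Proof. exact: is_derive_continuous dG. Qed.

Let dcalG (t : R) : is_derive t 1 (calG g) (G t).
Proof. exact: integral0_is_derive. Qed.

Lemma integral00 (f : R -> R) : Defs.integral0 f 0 = 0.
Proof. by rewrite /Defs.integral0 lexx set_itv1 Rintegral_set1. Qed.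

Let G0 : G 0 = 0. Proof. exact: integral00. Qed.

Let calG0 : calG g 0 = 0. Proof. exact: integral00. Qed.

Let Godd t : G (- t) = - G t.
Proof.
rewrite -[LHS]opprK; congr (- _).
apply: (@is_derive_inj R (fun t => - G (- t)) g) => //; last first.
  by rewrite oppr0 G0 oppr0.
move=> x; have := is_deriveN (is_derive1_comp (dG (- x)) (is_deriveN (is_derive_id x 1))).
by rewrite g_even mulrN1 opprK.
Qed.

Let calG_even t : calG g (- t) = calG g t.
Proof.
apply: (@is_derive_inj R (fun t => calG g (- t)) G) => //; last by rewrite oppr0.
move=> x; have := is_derive1_comp (dcalG (- x)) (is_deriveN (is_derive_id x 1)).
by rewrite Godd mulrN1 opprK.
Qed.

Let Gnd x y : x <= y -> G x <= G y.
Proof. by move=> xy; apply: (is_derive_ge0_le dG) => // z _; apply: ltW. Qed.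

Let dI (t : R) : is_derive t 1 I (t * g t).
Proof.
rewrite -[t * g t](addrK (G t)) -{1}[G t]mulr1.
by apply: is_derive_subf => //; have := is_derive_mulf (is_derive_id t 1) (dG t); exact.
Qed.

Let lam := fine (\int[mu]_t (g t * `|t|)%:E)%E.

Let lam_ge0 : 0 <= lam.
Proof. by apply: fine_ge0; apply: integral_ge0 => x _; rewrite lee_fin mulr_ge0// ltW. Qed.

Let c_tg : continuous (fun t : R => t * g t).
Proof. by move=> t; apply: cvgM => //; exact: g_cont. Qed.

Let I_le t : 0 <= t -> I t <= lam.
Proof.
move=> t0.
have -> : I t = Defs.integral0 (fun t => t * g t) t.
  apply: (@is_derive_inj R _ (fun t => t * g t)) => //.
    by move=> x; exact: integral0_is_derive.
  by rewrite /I integral00 mul0r calG0 subr0.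
rewrite /Defs.integral0 t0 /Rintegral; apply: fine_le.
- by apply: integrable_fin_num => //; exact: continuous_integrable.
- rewrite ge0_fin_numE//; apply: integral_ge0 => x _.
  by rewrite lee_fin mulr_ge0// ltW.
apply: (@le_trans _ _ (\int[mu]_(x in `[0%R, t]) (g x * `|x|)%:E)%E).
  rewrite le_eqVlt; apply/orP; left; apply/eqP; apply: eq_integral => x.
  by rewrite inE/= in_itv/= => /andP[x0 _]; rewrite mulrC ger0_norm.
apply: ge0_subset_integral => //=; last by move=> x _; rewrite lee_fin mulr_ge0// ltW.
apply/measurable_EFinP; apply: measurable_funM => //.
exact: continuous_measurable_fun.
Qed.

(** Beyond 1 the derivative [t * g t] of [I] dominates the derivative [g t] of [G], so from there on
    [G] grows by no more than the bounded function [I]. *)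
Let G_le t : G t <= G 1 + lam.
Proof.
have [t1|/ltW t1] := leP t 1; first by rewrite (le_trans (Gnd t1))// lerDl.
have : I 1 - G 1 <= I t - G t.
  apply: (@is_derive_ge0_le _ (fun t => I t - G t) (fun t => t * g t - g t)) => //.
    by move=> x; exact: is_derive_subf.
  move=> x /andP[x1 _]; rewrite -[X in _ - X]mul1r -mulrBl mulr_ge0//.
    by rewrite subr_ge0.
  exact: ltW.
have := I_le (le_trans ler01 t1).
have : 0 <= I 1.
  have <- : I 0 = 0 by rewrite /I mul0r calG0 subr0.
  apply: (is_derive_ge0_le dI) => // x /andP[x0 _]; rewrite mulr_ge0//.
  exact: ltW.
lra.
Qed.

(** As [G] is nondecreasing, this is its limit at infinity, the slope of the cone asymptotic to
    [calG g]. *)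
Let cs := sup (range G).

Let has_sup_G : has_sup (range G).
Proof. by split; [exists (G 0), 0|exists (G 1 + lam) => _ [t _ <-]]. Qed.

Let G_le_cs t : G t <= cs.
Proof. by apply: sup_upper_bound => //; exists t. Qed.

Let normG_le_cs t : `|G t| <= cs.
Proof. by rewrite ler_norml G_le_cs lerNl -Godd G_le_cs. Qed.

(** It suffices that [G x * t <= calG g t + lam] for each [x]. Up to [t] this is monotonicity of
    [G]; beyond [t] the function [I - t * G] is nondecreasing, its derivative being
    [(y - t) * g y]. *)
Let calG_lb_ge0 t : 0 <= t -> cs * t - lam <= calG g t.
Proof.
rewrite le_eqVlt => /predU1P[<-|t0].
  by rewrite mulr0 sub0r calG0 oppr_le0.
rewrite lerBlDr -ler_pdivlMr//; apply: ge_sup.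
  by exists (G 0), 0.
move=> _ [x _ <-]; rewrite ler_pdivlMr//.
have It : I t <= lam by apply: I_le; exact: ltW.
have ItE : I t = t * G t - calG g t by [].
have [xt|/ltW tx] := leP x t.
  have : G x * t <= G t * t by rewrite ler_wpM2r ?Gnd// ltW.
  by lra.
have : I t - t * G t <= I x - t * G x.
  apply: (@is_derive_ge0_le _ (fun x => I x - t * G x)
    (fun x => x * g x - t * g x)) => // [y|y /andP[ty _]].
    by apply: is_derive_subf => //; exact: (is_deriveZ t (dG y)).
  by rewrite -mulrBl mulr_ge0 ?subr_ge0// ltW.
have := I_le (le_trans (ltW t0) tx).
by lra.
Qed.

(** With [g c] the minimum of [g] on [-M, M], [psi] is [calG g] minus a parabola of curvature [g c],
    hence still convex there. The midpoint defect of that parabola is [g c / 8 * (a - b) ^+ 2]. *)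
Let gap_le M : exists2 k, 0 < k & forall a b, `|a| <= M -> `|b| <= M ->
    calG g ((a + b) / 2) + k * (a - b) ^+ 2 <= (calG g a + calG g b) / 2.
Proof.
have [M0|M0] := ltP M 0.
  exists 1 => // a b aM; have := normr_ge0 a; lra.
have [c cM cmin] := @EVT_min R g (- M) M ltac:(lra) ltac:(exact: continuous_subspaceT).
exists (g c / 8); first by rewrite divr_gt0.
suff H a b : `|a| <= M -> `|b| <= M -> a <= b ->
    calG g ((a + b) / 2) + g c / 8 * (a - b) ^+ 2 <= (calG g a + calG g b) / 2.
  move=> a b aM bM; have [ab|/ltW ab] := leP a b; first exact: H.
  have := H b a bM aM ab.
  by rewrite (addrC b a) -(opprB a b) sqrrN (addrC (calG g b)).
rewrite !ler_norml => /andP[Ma aM] /andP[Mb bM] ab.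
pose m := (a + b) / 2.
pose psi t := calG g t - g c / 2 * (t ^+ 2).
have dpsi : forall t : R, is_derive t 1 psi (G t - g c * t).
  move=> t; rewrite /psi (_ : g c * t = g c / 2 * (t * 1 + t * 1)); last by field.
  apply: is_derive_subf => //.
have am : a <= m by rewrite /m; lra.
have mb : m <= b by rewrite /m; lra.
have [x /andP[ax xm] ex] := MVT_total dpsi am.
have [y /andP[my yb] ey] := MVT_total dpsi mb.
have mono : G x - g c * x <= G y - g c * y.
  apply: (@is_derive_ge0_le _ (fun t => G t - g c * t) (fun t => g t - g c * 1)).
  - move=> t; apply: is_derive_subf => //.
  - exact: le_trans xm my.
  - move=> t /andP[xt ty]; rewrite subr_ge0 mulr1; apply: cmin.
    by rewrite in_itv/=; apply/andP; split; lra.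
have bmma : b - m = m - a by rewrite /m; field.
have : (G x - g c * x) * (m - a) <= (G y - g c * y) * (m - a).
  by rewrite ler_wpM2r// subr_ge0.
rewrite -[in leRHS]bmma -ex -ey /psi => {mono ex ey}.
rewrite -/m (_ : (a - b) ^+ 2 = 2 * (a ^+ 2 + b ^+ 2) - 4 * m ^+ 2); last first.
  by rewrite /m; field.
lra.
Qed.

Lemma calG_energy_density : exists cs lam, energy_density (calG g) cs lam.
Proof.
exists cs, lam; split => //.
- have : 0 < G 1.
    have [||c /andP[c0 c1] e] := @MVT_total R G g 0 1 => //.
    by have := g_gt0 c; rewrite G0 !subr0 mulr1 in e; rewrite e.
  by move/lt_le_trans; apply.
- move=> a b; wlog ab : a b / a <= b.
    have [ab|/ltW ba] := leP a b; first exact.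
    by move=> /(_ _ _ ba); rewrite distrC (distrC a).
  have [c _ e] := MVT_total dcalG ab.
  by rewrite distrC e normrM (distrC a) ler_wpM2r.
- move=> t; have [t0|/ltW t0] := leP 0 t; first by rewrite ger0_norm// calG_lb_ge0.
  by rewrite ler0_norm// -calG_even calG_lb_ge0// oppr_ge0.
Qed.

End calG_density.

(** * Volume of row vectors *)

Section volume_basics.
Context {R : realType}.

Lemma measurable_preimage d d' (T : measurableType d) (T' : measurableType d')
    (f : T -> T') : measurable_fun setT f ->
  forall A, measurable A -> measurable (f @^-1` A).
Proof. by move=> mf A mA; rewrite -[X in measurable X]setTI; exact: mf. Qed.

Lemma ball_rVE n (x y : 'rV[R]_n) r :
  ball x r y <-> (0 < r /\ forall i, `|x ord0 i - y ord0 i| < r).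
Proof.
split=> [|[r0 xy]]; last by split=> // i j; rewrite (ord1 i); exact: xy.
by case=> r0 xy; split=> // i; exact: xy.
Qed.

Lemma rV_ballE n (x : 'rV[R]_n) r : ball x r = [set y | `|x - y| < r].
Proof. by rewrite mx_norm_ball. Qed.

Lemma measurable_rV_ball n (x : 'rV[R]_n) r : measurable (ball x r).
Proof.
have [r0|r0] := ltP 0 r; last first.
  rewrite (_ : ball x r = set0)//; apply/seteqP; split=> // y /ball_rVE[].
  by rewrite ltNge r0.
rewrite (_ : ball x r = \bigcap_(i : 'I_n) (rV_coord i @^-1` ball (x ord0 i) r)).
  apply: fin_bigcap_measurable => // i _.
  apply: measurable_preimage; first exact: measurable_rV_coord.
  exact: measurable_ball.
apply/seteqP; split=> y /=; first by move=> /ball_rVE[_ xy] i _; exact: xy.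
by move=> xy; apply/ball_rVE; split=> // i; exact: xy.
Qed.

(** The sigma-algebra is generated by the coordinates. An open set is a countable union of sup-norm
    balls with rational centres and radii 1/(k+1), and such balls are finite intersections of
    coordinate preimages. *)
Lemma open_measurable_rV n (A : set 'rV[R]_n) : open A -> measurable A.
Proof.
move=> oA; pose c (q : 'rV[rat]_n) : 'rV[R]_n := map_mx ratr q.
pose r (k : nat) : R := k.+1%:R^-1.
pose D := [set p : 'rV[rat]_n * nat | ball (c p.1) (r p.2) `<=` A].
rewrite (_ : A = \bigcup_(p in D) ball (c p.1) (r p.2)).
  rewrite bigcup_mkcond; apply: countable_bigcupT_measurable => // p.
  by case: ifPn => // _; exact: measurable_rV_ball.
apply/seteqP; split=> [x Ax|x [p Dp]]; last exact: Dp.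
have [e /= e0 eA] : exists2 e : R, 0 < e & ball x e `<=` A.
  by have /nbhs_ballP[e e0 eA] := open_nbhs_nbhs (conj oA Ax); exists e.
have [k ke] : exists k, r k < e / 2.
  have [k] := ltr_add_invr (y := 0) (x := e / 2) (divr_gt0 e0 (ltr0n R 2)).
  by rewrite add0r; exists k.
have rk0 : 0 < r k by rewrite invr_gt0.
have q_ i : {q : rat | `|x ord0 i - ratr q| < r k}.
  apply: cid; have [q] := @rat_in_itvoo R (x ord0 i - r k) (x ord0 i + r k) ltac:(lra).
  by rewrite in_itv/= => /andP[q1 q2]; exists q; rewrite ltr_norml; apply/andP; split; lra.
have xq : ball (c (\row_i sval (q_ i))) (r k) x.
  apply/ball_rVE; split=> // i; rewrite !mxE distrC.
  by case: (q_ i).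
exists (\row_i sval (q_ i), k) => //=.
move=> y /= qy; apply: eA; have -> : e = e / 2 + e / 2 by field.
apply: (@ball_triangle _ _ (c (\row_i sval (q_ i)))).
- by apply: (@le_ball _ _ _ (r k)); [exact: ltW|exact: ball_sym].
- by apply: (@le_ball _ _ _ (r k)); [exact: ltW|].
Qed.

Lemma continuous_measurable_rV n (f : 'rV[R]_n -> R) :
  continuous f -> measurable_fun setT f.
Proof.
move=> /continuousP cf; apply: (measurability _ (RGenOpens.measurableE R)).
by move=> _ [_ [a [b ->] <-]]; rewrite setTI; apply: open_measurable_rV; exact/cf/interval_open.
Qed.

(** The pushforward agrees with the product measure on rectangles, and uniqueness of the product
    measure does the rest. This carries translation invariance through the recursive definition of
    [volume]. *)
Lemma pushforward_id d1 d2 (T1 : measurableType d1) (T2 : measurableType d2)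
  (m1 : {sigma_finite_measure set T1 -> \bar R})
  (m2 : {sigma_finite_measure set T2 -> \bar R}) (f1 : T1 -> T1) (f2 : T2 -> T2) :
  measurable_fun setT f1 -> measurable_fun setT f2 ->
  (forall A, measurable A -> m1 (f1 @^-1` A) = m1 A) ->
  (forall A, measurable A -> m2 (f2 @^-1` A) = m2 A) ->
  forall A, measurable A ->
    (m1 \x m2)%E ((fun p => (f1 p.1, f2 p.2)) @^-1` A) = (m1 \x m2)%E A.
Proof.
move=> mf1 mf2 E1 E2 A mA.
have mf : measurable_fun setT (fun p : T1 * T2 => (f1 p.1, f2 p.2)).
  apply/measurable_fun_pairP; split.
    exact: (measurableT_comp mf1 measurable_fst).
  exact: (measurableT_comp mf2 measurable_snd).
pose m' : {measure set (T1 * T2) -> \bar R} :=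
  measure_function_pushforward__canonical__measure_function_Measure (m1 \x m2)%E mf.
apply/esym; rewrite (@product_measure_unique _ _ _ _ _ m1 m2 m')// => B C mB mC.
rewrite /m' /= /pushforward /= (_ : _ @^-1` _ = (f1 @^-1` B) `*` (f2 @^-1` C))//.
rewrite product_measure1E; last 2 first.
- exact: measurable_preimage mf1 _ _.
- exact: measurable_preimage mf2 _ _.
by congr (_ * _)%E; [exact: E1|exact: E2].
Qed.

Lemma lebesgue_measure_shift (h : R) (A : set (measurableTypeR R)) : measurable A ->
  lebesgue_measure ((fun x : measurableTypeR R => (x + h : measurableTypeR R)) @^-1` A) =
  lebesgue_measure A.
Proof.
have mh : measurable_fun setT (fun x : measurableTypeR R => (x + h : measurableTypeR R)).
  by apply: measurable_funD.
pose m' : {measure set (measurableTypeR R) -> \bar R} :=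
  measure_function_pushforward__canonical__measure_function_Measure lebesgue_measure mh.
move=> mA; apply/esym; apply: (@lebesgue_measure_unique _ m') => //= _ [[a b]] _ <-.
rewrite /pushforward (_ : _ @^-1` _ = `]a - h, b - h]%classic); last first.
  by apply/seteqP; split=> x /=; rewrite !in_itv/= ltrBlDr lerBrDr.
by rewrite !lebesgue_measure_itv/= !lte_fin ltrD2r -!EFinB opprB addrA subrK.
Qed.

Lemma measurable_rV_shift n (h : 'rV[R]_n) : measurable_fun setT (fun x : 'rV[R]_n => x + h).
Proof.
apply: measurable_fun_rVP => i.
rewrite (_ : _ \o _ = (fun x : 'rV[R]_n => rV_coord i x + h ord0 i)); last first.
  by apply/funext => x; rewrite /rV_coord/= mxE.
by apply: measurable_funD => //; exact: measurable_rV_coord.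
Qed.

Lemma volume_shift n (h : 'rV[R]_n) A : measurable A ->
  volume n ((fun x : 'rV[R]_n => x + h) @^-1` A) = volume n A.
Proof.
elim: n => [|n IH] in h A *.
  by move=> _; congr (volume 0 _); apply/funext => x /=; rewrite [h]thinmx0 addr0.
move=> mA; rewrite /= /volume_cons /pushforward.
rewrite -[in RHS](@pushforward_id _ _ _ _ lebesgue_measure (volume n)
  (fun x => x + h ord0 ord0) (fun x => x + rsubmx (h : 'M[R]_(1, 1 + n)))).
- congr product_measure1; apply/funext => -[a x] /=; congr A.
  apply/rowP => i; rewrite mxE; case: (@split_ordP 1 n i) => j ->.
    by rewrite !rV_consE0 (ord1 j); congr (_ + h _ _); exact: val_inj.
  by rewrite !rV_consES !mxE.
- exact: measurable_funD.
- exact: measurable_rV_shift.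
- by move=> B mB; exact: lebesgue_measure_shift.
- by move=> B mB; exact: IH.
- by apply: measurable_preimage => //; exact: measurable_rV_cons.
Qed.

Lemma volume_ball n (x : 'rV[R]_n) r : 0 < r -> volume n (ball x r) = ((r *+ 2) ^+ n)%:E.
Proof.
move=> r0; elim: n => [|n IH] in x *.
  by rewrite /= diracE mem_set//; apply/ball_rVE; split=> // -[].
rewrite /= /volume_cons /pushforward.
rewrite (_ : _ @^-1` _ = ball (x ord0 ord0) r `*` ball (rsubmx (x : 'M[R]_(1, 1 + n))) r).
  rewrite product_measure1E//; last 2 first.
  - exact: measurable_ball.
  - exact: measurable_rV_ball.
  rewrite exprS EFinM; congr (_ * _)%E; last exact: IH.
  by apply: lebesgue_measure_ball; exact: ltW.
apply/seteqP; split=> -[a y] /=.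
  case/ball_rVE => _ xay; split=> /=.
    have := xay ord0; have -> : ord0 = lshift n (ord0 : 'I_1) by exact: val_inj.
    by rewrite rV_consE0.
  apply/ball_rVE; split=> // i; have := xay (rshift 1 i).
  by rewrite rV_consES !mxE.
case=> /= xa /ball_rVE[_ xy]; apply/ball_rVE; split=> // i.
case: (@split_ordP 1 n i) => j ->; last by have := xy j; rewrite rV_consES !mxE.
rewrite rV_consE0; have -> : lshift n j = ord0 :> 'I_(n.+1) by rewrite (ord1 j); exact: val_inj.
exact: xa.
Qed.

End volume_basics.

(** * The Euclidean norm compared with the sup norm *)

Section euclidean_norm.
Context {R : realType} {n : nat}.
Implicit Types x y : 'rV[R]_n.

Lemma coord_le_norm x i : `|x ord0 i| <= `|x|.
Proof.
rewrite [leRHS]/Num.Def.normr/= mx_normrE.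
exact: (le_bigmax _ (fun ij : 'I_1 * 'I_n => `|x ij.1 ij.2|) (ord0, i)).
Qed.

Lemma dotpC x y : dotp x y = dotp y x.
Proof. by apply: eq_bigr => i _; rewrite mulrC. Qed.

Lemma dotpDl x y z : dotp (x + y) z = dotp x z + dotp y z.
Proof. by rewrite -big_split; apply: eq_bigr => i _; rewrite mxE mulrDl. Qed.

Lemma dotpZl a x y : dotp (a *: x) y = a * dotp x y.
Proof. by rewrite /dotp big_distrr/=; apply: eq_bigr => i _; rewrite mxE mulrA. Qed.

Lemma dotpNl x y : dotp (- x) y = - dotp x y.
Proof. by rewrite -scaleN1r dotpZl mulN1r. Qed.

Lemma dotp_ge0 x : 0 <= dotp x x.
Proof. by apply: sumr_ge0 => i _; rewrite -expr2 sqr_ge0. Qed.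

Lemma enorm_ge0 x : 0 <= enorm x. Proof. exact: sqrtr_ge0. Qed.

Lemma sqr_enorm x : enorm x ^+ 2 = dotp x x.
Proof. by rewrite sqr_sqrtr// dotp_ge0. Qed.

Lemma enormN x : enorm (- x) = enorm x.
Proof. by rewrite /enorm dotpNl dotpC dotpNl opprK. Qed.

Lemma enormB x y : enorm (x - y) = enorm (y - x).
Proof. by rewrite -enormN opprB. Qed.

Lemma normr_le_enorm x : `|x| <= enorm x.
Proof.
rewrite [leLHS]/Num.Def.normr/= mx_normrE; apply: bigmax_le; first exact: enorm_ge0.
move=> [i j] _ /=; rewrite (ord1 i) -(@ler_pXn2r _ 2)// ?nnegrE ?enorm_ge0//.
rewrite sqr_enorm /dotp (bigD1 j)//= -expr2 real_normK ?num_real// lerDl.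
by apply: sumr_ge0 => k _; rewrite -expr2 sqr_ge0.
Qed.

Lemma normr_dotp_le x y : `|dotp x y| <= n%:R * (`|x| * `|y|).
Proof.
rewrite (le_trans (ler_norm_sum _ _ _))//.
rewrite (le_trans (ler_sum _ (G := fun=> `|x| * `|y|) _))//.
  by move=> i _; rewrite normrM ler_pM// coord_le_norm.
by rewrite sumr_const card_ord mulr_natl.
Qed.

(** The crude factor [n] in place of its square root is the source of the factors [n] in
    [kernel_annulus], in the Hardy inequality and in [Theta]. *)
Lemma enorm_le_normr x : enorm x <= n%:R * `|x|.
Proof.
have nx0 : 0 <= n%:R * `|x| by rewrite mulr_ge0.
rewrite -(@ler_pXn2r _ 2)// ?nnegrE ?enorm_ge0// sqr_enorm.
rewrite (le_trans (ler_norm _))// (le_trans (normr_dotp_le _ _))//.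
rewrite -expr2 exprMn ler_wpM2r ?sqr_ge0// -natrX ler_nat.
by case: n => // k; rewrite expnS leq_pmulr// expn_gt0.
Qed.

Lemma continuous_enorm : continuous (@enorm R n).
Proof.
move=> x; apply: (@cvg_comp _ _ _ (fun x : 'rV[R]_n => dotp x x) (@Num.sqrt R)); last first.
  exact: sqrt_continuous.
have cc i : continuous (fun z : 'rV[R]_n => z ord0 i) by exact: coord_continuous.
suff : continuous (fun x : 'rV[R]_n => dotp x x) by exact.
apply: continuous_big => [|i _]; first exact: add_continuous.
by move=> z; exact: (cvgM (cc i z) (cc i z)).
Qed.

Lemma measurable_rV_sub : measurable_fun setT
  (fun p : 'rV[R]_n * 'rV[R]_n => p.1 - p.2).
Proof.
apply: measurable_fun_rVP => i.
rewrite (_ : _ \o _ = (fun p : 'rV[R]_n * 'rV[R]_n => rV_coord i p.1 - rV_coord i p.2)).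
  by apply: measurable_funB; apply: measurableT_comp => //; exact: measurable_rV_coord.
by apply/funext => p; rewrite /rV_coord/= !mxE.
Qed.

Lemma measurable_enorm_sub : measurable_fun setT
  (fun p : 'rV[R]_n * 'rV[R]_n => enorm (p.1 - p.2)).
Proof.
exact: (measurableT_comp (continuous_measurable_rV continuous_enorm) measurable_rV_sub).
Qed.

End euclidean_norm.

Section dyadic.
Context {R : realType}.

Lemma powR_geometric (u q e : R) k : 0 <= u -> 0 <= q ->
  (u * q ^+ k) `^ e = u `^ e * (q `^ e) ^+ k.
Proof.
move=> u0 q0; rewrite powRM ?exprn_ge0//; congr (_ * _).
by rewrite -powR_mulrn// -powRrM mulrC powRrM powR_mulrn// powR_ge0.
Qed.

Lemma geometric_sum_le (a q : R) N : 0 <= a -> 0 <= q -> q < 1 ->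
  \sum_(k < N) a * q ^+ k <= a / (1 - q).
Proof.
move=> a0 q0 q1; rewrite -big_distrr/= ler_wpM2l// -[leRHS]mul1r.
rewrite ler_pdivlMr ?subr_gt0// mulrC -opprB mulNr -subrX1 opprB gerBl.
exact: exprn_ge0.
Qed.

Lemma dyadic_interval (r t : R) : 0 < r -> r <= t ->
  exists k, r * 2 ^+ k <= t < r * 2 ^+ k.+1.
Proof.
move=> r0 rt.
have ex : exists k, t < r * 2 ^+ k.
  have [k tk] : exists k, t / r < k%:R.
    by exists (Num.truncn (t / r)).+1; exact: truncnS_gt.
  exists k; rewrite mulrC -ltr_pdivrMr// (lt_le_trans tk)// -natrX ler_nat.
  exact/ltnW/ltn_expl.
case: (ex_minnP ex) => -[|k] tk kmin.
  by move: tk; rewrite expr0 mulr1 ltNge rt.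
exists k; rewrite tk andbT leNgt; apply/negP => /kmin.
by rewrite ltnn.
Qed.

End dyadic.

(** * The singular kernels *)

(** Written as an inverse so that the quotients in [gagliardo] and [Tail] unfold to products with
    it. *)
Definition kernel (R : realType) n (p : R) (x y : 'rV[R]_n) : R :=
  (enorm (x - y) `^ p)^-1.

Section kernel_basics.
Context {R : realType} {n : nat}.
Notation mu := (@volume R n).
Implicit Types (x y : 'rV[R]_n) (p : R).

Lemma kernel_ge0 p x y : 0 <= kernel p x y.
Proof. by rewrite invr_ge0 powR_ge0. Qed.

Lemma kernelC p x y : kernel p x y = kernel p y x.
Proof. by rewrite /kernel enormB. Qed.

Lemma enorm0 : enorm (0 : 'rV[R]_n) = 0.
Proof.
by apply/eqP; rewrite eq_le enorm_ge0 (le_trans (enorm_le_normr _))// normr0 mulr0.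
Qed.

Lemma kernel_diag p x : p != 0 -> kernel p x x = 0.
Proof. by move=> p0; rewrite /kernel subrr enorm0 powR0// invr0. Qed.

Lemma kernel_le p x y (r : R) : 0 <= p -> 0 < r -> r <= enorm (x - y) ->
  kernel p x y <= r `^ (- p).
Proof.
move=> p0 r0 rxy; rewrite /kernel -powRN.
rewrite !powRN lef_pV2 ?posrE ?powR_gt0// ?(lt_le_trans r0)//.
by apply: ge0_ler_powR => //; rewrite nnegrE ?enorm_ge0// ltW.
Qed.

Lemma kernel_ge p x y (r : R) : 0 <= p -> 0 < enorm (x - y) -> enorm (x - y) <= r ->
  r `^ (- p) <= kernel p x y.
Proof.
move=> p0 d0 dr; rewrite /kernel powRN lef_pV2 ?posrE ?powR_gt0// ?(lt_le_trans d0)//.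
by apply: ge0_ler_powR => //; rewrite nnegrE ?enorm_ge0// (le_trans _ dr)// enorm_ge0.
Qed.

Lemma measurable_kernel p : measurable_fun setT
  (fun q : 'rV[R]_n * 'rV[R]_n => kernel p q.1 q.2).
Proof.
rewrite (_ : (fun q => _) = (fun q : 'rV[R]_n * 'rV[R]_n => enorm (q.1 - q.2) `^ (- p))).
  apply: (measurableT_comp (measurable_powR (- p))); exact: measurable_enorm_sub.
by apply/funext => q; rewrite powRN.
Qed.

Lemma measurable_kernel2 p x : measurable_fun setT (kernel p x).
Proof.
have := measurableT_comp (measurable_kernel p) (measurable_pair1 x).
exact.
Qed.

End kernel_basics.

(** Bounding [f] by the whole series of the [h k] avoids cutting [D] into measurable pieces on which
    one particular [h k] is the right bound. *)
Lemma integral_le_some d (T : measurableType d) (R : realType)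
    (mu : {measure set T -> \bar R}) (D : set T) (f : T -> \bar R)
    (h : nat -> T -> \bar R) (B : \bar R) :
  measurable D -> measurable_fun D f -> (forall x, D x -> 0 <= f x)%E ->
  (forall k, measurable_fun D (h k)) -> (forall k x, 0 <= h k x)%E ->
  (forall x, D x -> exists k, (f x <= h k x)%E) ->
  (forall N, \sum_(0 <= k < N) \int[mu]_(x in D) h k x <= B)%E ->
  (\int[mu]_(x in D) f x <= B)%E.
Proof.
move=> mD mf f0 mh h0 fh hB.
apply: (@le_trans _ _ (\int[mu]_(x in D) (\sum_(0 <= k <oo) h k x))%E).
  apply: ge0_le_integral => //; first by apply: ge0_emeasurable_sum => // k x _ _.
  move=> x Dx; have [k fk] := fh x Dx; apply: (le_trans fk).
  apply: (@le_trans _ _ (\sum_(0 <= i < k.+1) h i x)%E); last exact: nneseries_lim_ge.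
  by rewrite big_nat_recr//= leeDr// sume_ge0.
rewrite integral_nneseries//; apply: lime_le.
  by apply: is_cvg_nneseries => k _ _; exact: integral_ge0.
exact: nearW.
Qed.

Lemma integral_le_balls (R : realType) n (D : set 'rV[R]_n) (f : 'rV[R]_n -> \bar R) x
    (a r : nat -> R) (B : R) :
  measurable D -> measurable_fun D f -> (forall y, D y -> 0 <= f y)%E ->
  (forall k, 0 <= a k) -> (forall k, 0 < r k) ->
  (forall y, D y -> exists2 k, `|x - y| < r k & (f y <= (a k)%:E)%E) ->
  (forall N, \sum_(k < N) a k * (r k *+ 2) ^+ n <= B) ->
  (\int[volume n]_(y in D) f y <= B%:E)%E.
Proof.
move=> mD mf f0 a0 r0 fa aB.
have mB k : measurable (ball x (r k)) by exact: measurable_rV_ball.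
have m1 k : measurable_fun D (EFin \o \1_(ball x (r k)) : 'rV[R]_n -> \bar R).
  by apply/measurable_EFinP/measurable_funTS; exact: measurable_indic.
apply: (integral_le_some (h := fun k y => (a k)%:E * (\1_(ball x (r k)) y)%:E)%E) => //.
- by move=> k; apply: measurable_funeM; exact: m1.
- by move=> k y; rewrite mule_ge0 ?lee_fin.
- move=> y Dy; have [k xy fk] := fa y Dy; exists k.
  by rewrite indicE mem_set ?mule1// rV_ballE.
move=> N; apply: (@le_trans _ _ (\sum_(0 <= k < N) (a k * (r k *+ 2) ^+ n)%:E)%E).
  apply: lee_sum => k _; rewrite ge0_integralZl_EFin//; last exact: m1.
  rewrite integral_indic// EFinM lee_wpmul2l ?lee_fin//.
  rewrite -(volume_ball x (r0 k)) le_measure ?inE//.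
  exact: measurableI.
by rewrite sumEFin lee_fin big_mkord.
Qed.

Section kernel_integrals.
Context {R : realType} {n : nat} (s : R).
Hypotheses (n_ge1 : (1 <= n)%N) (s_gt0 : 0 < s) (s_lt1 : s < 1).
Notation mu := (@volume R n).
Notation p := (n%:R + s).
Notation p' := (n%:R - 1 + s).

Let p_ge0 : 0 <= p. Proof. by rewrite addr_ge0// ltW. Qed.

Let p'_ge0 : 0 <= p'.
Proof. by rewrite addr_ge0 ?subr_ge0 ?ler1n// ltW. Qed.

Let powR_split (u q : R) : 0 < u -> u `^ q * u ^+ n = u `^ (q + n%:R).
Proof.
move=> u0; rewrite -powR_mulrn ?ltW// -powRD//.
by apply/implyP => _; rewrite gt_eqF.
Qed.

(** The shell between r 2^k and r 2^(k+1) contributes at most 4^n (r 2^k)^(-s): kernel bound times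
    the volume of the enclosing cube. The ratio 2^(-s) is below 1 since s > 0. *)
Lemma kernel_tail : exists2 C, 0 < C & forall (x : 'rV[R]_n) r A, 0 < r ->
  measurable A -> A `<=` [set y | r <= `|x - y|] ->
  (\int[mu]_(y in A) (kernel p x y)%:E <= (C * r `^ (- s))%:E)%E.
Proof.
pose q : R := 2 `^ (- s).
have q0 : 0 < q by rewrite powR_gt0.
have q1 : q < 1.
  rewrite /q -mulN1r powRrM powR_inv1//.
  suff : 2^-1 `^ s < 1 `^ s by rewrite powR1.
  by apply: gt0_ltr_powR; rewrite ?nnegrE ?invr_ge0// invf_lt1// ltr1n.
exists (4 ^+ n / (1 - q)) => [|x r A r0 mA Ar]; first by rewrite divr_gt0 ?subr_gt0.
apply: (@integral_le_balls _ _ A _ x (fun k => (r * 2 ^+ k) `^ (- p))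
  (fun k => r * 2 ^+ k.+1)) => //.
- by apply/measurable_EFinP/measurable_funTS; exact: measurable_kernel2.
- by move=> y _; rewrite lee_fin kernel_ge0.
- by move=> k; rewrite powR_ge0.
- by move=> k; rewrite mulr_gt0.
- move=> y /Ar /= ry; have [k /andP[k1 k2]] := dyadic_interval r0 ry.
  exists k => //; rewrite lee_fin; apply: kernel_le => //; first by rewrite mulr_gt0.
  exact: le_trans k1 (normr_le_enorm _).
move=> N; rewrite mulrAC -mulrA.
apply: le_trans (ler_wpM2l (exprn_ge0 n (ler0n R 4))
  (geometric_sum_le N (powR_ge0 r (- s)) (ltW q0) q1)).
rewrite big_distrr; apply: ler_sum => k _ /=.
rewrite -(powR_geometric (- s) _ (ltW r0) (ler0n R 2)).
have r2k : 0 < r * 2 ^+ k by rewrite mulr_gt0.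
rewrite (_ : r * 2 ^+ k.+1 *+ 2 = 4 * (r * 2 ^+ k)); last first.
  by rewrite exprS -mulr_natl; ring.
by rewrite exprMn mulrCA powR_split// opprD addrAC addNr add0r.
Qed.

(** The same shell count towards the singularity: the shell at scale r0 2^(-k) contributes a
    multiple of its (1 - s)-th power, summable since s < 1. *)
Lemma kernel_near : forall r0 : R, 0 < r0 -> exists2 C, 0 < C &
  forall (x : 'rV[R]_n) A, measurable A -> A `<=` [set y | `|x - y| <= r0] ->
  (\int[mu]_(y in A) (kernel p' x y)%:E <= C%:E)%E.
Proof.
move=> r0 r00; pose q : R := (2^-1) `^ (1 - s).
have s1 : 0 < 1 - s by rewrite subr_gt0.
have q0 : 0 < q by rewrite powR_gt0 ?invr_gt0.
have q1 : q < 1.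
  suff : 2^-1 `^ (1 - s) < 1 `^ (1 - s) by rewrite powR1.
  by apply: gt0_ltr_powR; rewrite ?nnegrE ?invr_ge0// invf_lt1// ltr1n.
exists (8 ^+ n * ((r0 / 2) `^ (1 - s) / (1 - q))).
  by rewrite mulr_gt0// divr_gt0 ?subr_gt0// powR_gt0// divr_gt0.
move=> x A mA Ar.
have h0 k : 0 < r0 / 2 * 2^-1 ^+ k by rewrite mulr_gt0 ?exprn_gt0// ?divr_gt0// invr_gt0.
(* The k-th shell is r0 2^(-k-1) < |x - y| <= r0 2^(-k). Its ball gets radius 2 r0 2^(-k), so that
   membership in the open ball is strict; the point [y = x] lies in no shell, but the kernel
   vanishes there. *)
apply: (@integral_le_balls _ _ A _ x (fun k => (r0 / 2 * 2^-1 ^+ k) `^ (- p'))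
  (fun k => 4 * (r0 / 2 * 2^-1 ^+ k))) => //.
- by apply/measurable_EFinP/measurable_funTS; exact: measurable_kernel2.
- by move=> y _; rewrite lee_fin kernel_ge0.
- by move=> k; rewrite powR_ge0.
- by move=> k; rewrite mulr_gt0.
- move=> y /Ar /= yr; have [xy|xy] := eqVneq y x.
    exists 0%N; rewrite xy ?subrr ?normr0 ?mulr_gt0//.
    by rewrite kernel_diag ?lee_fin ?powR_ge0// gt_eqF// ltr_wpDl// subr_ge0 ler1n.
  have t0 : 0 < `|x - y| by rewrite normr_gt0 subr_eq0 eq_sym.
  have [k /andP[k1 k2]] := dyadic_interval t0 yr.
  have k20 : 0 < 2 ^+ k :> R by rewrite exprn_gt0.
  have e : r0 / 2 * 2^-1 ^+ k = r0 / 2 / 2 ^+ k by rewrite exprVn.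
  exists k; rewrite e.
    by rewrite mulrA ltr_pdivlMr// (le_lt_trans k1)//; lra.
  rewrite lee_fin; apply: kernel_le => //; first by rewrite -e.
  apply: le_trans (normr_le_enorm _); apply: ltW.
  by rewrite !ltr_pdivrMr// -mulrA -exprSr.
move=> N.
apply: le_trans (ler_wpM2l (exprn_ge0 n (ler0n R 8))
  (geometric_sum_le N (powR_ge0 (r0 / 2) (1 - s)) (ltW q0) q1)).
rewrite big_distrr; apply: ler_sum => k _ /=.
have r02 : 0 <= r0 / 2 by rewrite divr_ge0// ltW.
rewrite -powR_geometric ?invr_ge0//.
rewrite (_ : 4 * _ *+ 2 = 8 * (r0 / 2 * 2^-1 ^+ k)); last by rewrite -mulr_natl; ring.
by rewrite exprMn mulrCA powR_split// (_ : _ + _ = 1 - s)//; ring.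
Qed.

(** The cube of side [r] centred at [x] plus 3r/2 in every coordinate has coordinatewise distances
    from [x] between r and 2r, hence Euclidean distances between r and 2nr. Its volume is r^n and
    the kernel on it is at least (2nr)^(-n-s). *)
Lemma kernel_annulus : exists2 c, 0 < c & forall (x : 'rV[R]_n) r A, 0 < r ->
  measurable A -> [set y | r < enorm (x - y) < n%:R * 2 * r] `<=` A ->
  ((c * r `^ (- s))%:E <= \int[mu]_(y in A) (kernel p x y)%:E)%E.
Proof.
pose N2 : R := n%:R * 2.
have N20 : 0 < N2 by rewrite mulr_gt0// ltr0n.
exists (N2 `^ (- p)) => [|x r A r0 mA Ar]; first by rewrite powR_gt0.
pose z := x + const_mx (3 / 2 * r).
have zA y : ball z (r / 2) y -> r < enorm (x - y) < N2 * r.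
  move=> /ball_rVE[_ zy]; apply/andP; split.
    have i0 : 'I_n by exact: (Ordinal n_ge1).
    apply: lt_le_trans (normr_le_enorm _); apply: lt_le_trans (coord_le_norm _ i0).
    have := zy i0; rewrite !mxE ltr_norml => /andP[h1 h2].
    by rewrite distrC ltr_normr; apply/orP; left; lra.
  apply: le_lt_trans (enorm_le_normr _) _.
  rewrite -mulrA ltr_pM2l ?ltr0n// [ltLHS]/Num.Def.normr/= mx_normrE.
  apply: bigmax_lt; first by rewrite mulr_gt0.
  move=> [i j] _ /=; rewrite (ord1 i); have := zy j; rewrite !mxE !ltr_norml.
  by move=> /andP[h1 h2]; apply/andP; split; lra.
have mB : measurable (ball z (r / 2)) by exact: measurable_rV_ball.
apply: (@le_trans _ _ (\int[mu]_(y in ball z (r / 2)) ((N2 * r) `^ (- p))%:E)%E).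
  have vB : mu (ball z (r / 2)) = (r ^+ n)%:E.
    rewrite volume_ball ?divr_gt0//; congr (_ ^+ _)%:E.
    by rewrite -mulr_natr; field.
  rewrite integral_cst// [X in (_ * X)%E]vB -EFinM lee_fin.
  by rewrite (powRM _ (ltW N20) (ltW r0)) -mulrA powR_split// opprD addrAC addNr add0r.
apply: (@le_trans _ _ (\int[mu]_(y in ball z (r / 2)) (kernel p x y)%:E)%E).
  apply: ge0_le_integral => //.
  - by move=> y _; rewrite lee_fin powR_ge0.
  - by apply/measurable_EFinP/measurable_funTS; exact: measurable_kernel2.
  - move=> y /zA/andP[ry yr]; rewrite lee_fin; apply: kernel_ge => //; last exact: ltW.
    exact: lt_trans ry.
apply: ge0_subset_integral => //.
- by apply/measurable_EFinP/measurable_funTS; exact: measurable_kernel2.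
- by move=> y _; rewrite lee_fin kernel_ge0.
- by move=> y /zA; exact: Ar.
Qed.

End kernel_integrals.

(** * Lipschitz charts and the fractional Hardy inequality *)

Section charts.
Context {R : realType} {n : nat}.
Implicit Types (Omega : set 'rV[R]_n) (x y z e : 'rV[R]_n) (r L : R).

(* Near [x], either [Omega] fills a ball or it is the positivity set of a
   Lipschitz height function [rho] of unit speed along [e]. *)
Definition has_chart Omega r L x : Prop :=
  ball x r `<=` Omega \/
  exists e (rho : 'rV[R]_n -> R),
    [/\ `|e| <= 1, forall y z, `|rho y - rho z| <= L * `|y - z|,
        forall y t, rho (y + t *: e) = rho y + t &
        forall z, ball x r z -> (Omega z <-> 0 < rho z)].

Lemma has_chart_le Omega r r' L L' x : r' <= r -> L <= L' ->
  has_chart Omega r L x -> has_chart Omega r' L' x.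
Proof.
move=> rr LL [xr|[e [rho [e1 rhoL rhot Or]]]].
  by left => y; move/(le_ball rr); exact: xr.
right; exists e, rho; split=> // [y z|z /(le_ball rr)]; last exact: Or.
by rewrite (le_trans (rhoL y z))// ler_wpM2r.
Qed.

Hypothesis n_ge1 : (1 <= n)%N.

(** At a boundary point [rho] is the height above the graph of [gam] in the direction [e]. The
    conclusion concerns all nearby centres, as the covering argument requires. *)
Lemma lipschitz_boundary_chart Omega x : open Omega -> lipschitz_boundary Omega ->
  closure Omega x -> exists r L, 0 < r /\ forall y, ball x r y -> has_chart Omega r L y.
Proof.
move=> oO lO cx.
have half r : 0 < r -> forall y, ball x (r / 2) y -> ball y (r / 2) `<=` ball x r.
  move=> r0 y xy z yz; rewrite (_ : r = r / 2 + r / 2); last by field.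
  exact: ball_triangle xy yz.
have [Ox|nOx] := pselect (Omega x).
  have [r /= r0 rO] : exists2 r : R, 0 < r & ball x r `<=` Omega.
    by have /nbhs_ballP[r r0 rO] := open_nbhs_nbhs (conj oO Ox); exists r.
  exists (r / 2), 0; split; first by rewrite divr_gt0.
  by move=> y xy; left => z yz; apply: rO; apply: half yz.
have [] := lO x; first by split=> // /interior_subset.
move=> r [L [e [gam [r0 e1 gamL Og]]]].
have n0 : 0 < n%:R :> R by rewrite ltr0n.
pose rho z := dotp z e - gam (z - dotp z e *: e).
have ee : dotp e e = 1 by rewrite -sqr_enorm e1 expr1n.
have ne1 : `|e| <= 1 by rewrite -e1 normr_le_enorm.
have perp z : dotp (z - dotp z e *: e) e = 0.
  by rewrite dotpDl dotpNl dotpZl ee mulr1 subrr.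
have dote z : `|dotp z e| <= n%:R * `|z|.
  rewrite (le_trans (normr_dotp_le _ _))// ler_pM2l// -[leRHS]mulr1.
  exact: ler_wpM2l.
(* Division by [n] puts the sup-norm ball inside the Euclidean one, and halving lets one chart serve
   every centre in the half ball. In the Lipschitz constant [n] bounds the product with [e], and
   [1 + n] the projection orthogonal to [e]. *)
exists (r / n%:R / 2), (n%:R + `|L| * (n%:R * (1 + n%:R))); split.
  by rewrite !divr_gt0.
move=> y xy; right; exists e, rho; split=> //.
- move=> a b; rewrite /rho.
  rewrite (_ : _ - _ - _ = dotp (a - b) e -
    (gam (a - dotp a e *: e) - gam (b - dotp b e *: e))); last first.
    by rewrite dotpDl dotpNl; ring.
  rewrite (le_trans (ler_normB _ _))// mulrDl lerD//.
  rewrite (le_trans (gamL _ _ (perp a) (perp b)))//.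
  rewrite (_ : _ - _ - _ = (a - b) - dotp (a - b) e *: e); last first.
    rewrite dotpDl dotpNl scalerBl; apply/rowP => i; rewrite !mxE; ring.
  rewrite (le_trans (ler_wpM2r (enorm_ge0 _) (ler_norm L)))// -mulrA ler_wpM2l//.
  rewrite (le_trans (enorm_le_normr _))// -mulrA ler_wpM2l// mulrDl mul1r.
  rewrite (le_trans (ler_normB _ _))// lerD// normrZ (le_trans _ (dote _))//.
  by rewrite -[leRHS]mulr1 ler_wpM2l.
- move=> a t; rewrite /rho dotpDl dotpZl ee mulr1 scalerDl.
  have -> : a + t *: e - (dotp a e *: e + t *: e) = a - dotp a e *: e.
    by rewrite opprD addrACA subrr addr0.
  by rewrite addrAC.
- move=> z /(half _ (divr_gt0 r0 n0) _ xy); rewrite rV_ballE /= => xz.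
  have /Og : enorm (z - x) < r.
    by rewrite (le_lt_trans (enorm_le_normr _))// distrC mulrC -ltr_pdivlMr.
  by rewrite /rho subr_gt0.
Qed.

(** Compactness of the closure. One index i carries both the radius 1/(i+1) and the Lipschitz
    constant i+1, so that by [has_chart_le] having a chart is an eventual property of i near each
    point. *)
Lemma uniform_charts Omega : open Omega -> bounded_set Omega ->
  lipschitz_boundary Omega ->
  exists r L, [/\ 0 < r, 1 <= L & forall x, Omega x -> has_chart Omega r L x].
Proof.
move=> oO bO lO.
have : compact (closure Omega).
  apply: bounded_closed_compact; last exact: closed_closure.
  case: bO => M [Mr OM]; exists M; split=> // N MN x cx.
  have NM0 : 0 < (N - M) / 2 by lra.
  have [y [Oy]] := cx _ (nbhsx_ballx x _ NM0); rewrite rV_ballE /= => xy.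
  have := OM ((M + N) / 2) ltac:(lra) y Oy; have := ler_normD (x - y) y.
  by rewrite /= subrK; lra.
move=> /compact_near_coveringP.
move=> /(_ nat \oo (fun i x => has_chart Omega i.+1%:R^-1 i.+1%:R x) _).
case=> [x cx|N _ NO].
  have [r [L [r0 rO]]] := lipschitz_boundary_chart oO lO cx.
  have [k kr] : exists k : nat, r^-1 < k%:R.
    by exists (Num.truncn (r^-1)).+1; exact: truncnS_gt.
  have [l lL] : exists k : nat, L < k%:R.
    by exists (Num.truncn L).+1; exact: truncnS_gt.
  exists (ball x r, [set i | (maxn k l <= i)%N]) => /=.
    split; first exact: nbhsx_ballx.
    by exists (maxn k l).
  move=> [y i] /= [/rO xy]; rewrite geq_max => /andP[ki li].
  apply: has_chart_le xy.
    rewrite invf_ple ?posrE// (le_trans (ltW kr))// ler_nat; exact: ltnW.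
  by rewrite (le_trans (ltW lL))// ler_nat ltnW.
exists N.+1%:R^-1, N.+1%:R; split=> [||x Ox]; rewrite ?invr_gt0 ?ler1n//.
by apply: (NO N) => //=; exact: subset_closure.
Qed.

End charts.

(** * Tonelli and Fubini on rectangles, by extension by zero *)

Section tonelli_setX.
Context d1 d2 (T1 : measurableType d1) (T2 : measurableType d2) (R : realType).
Variables (m1 : {sigma_finite_measure set T1 -> \bar R})
  (m2 : {sigma_finite_measure set T2 -> \bar R}).
Variables (A : set T1) (B : set T2) (f : T1 * T2 -> \bar R).
Hypotheses (mA : measurable A) (mB : measurable B).
Hypotheses (mf : measurable_fun setT f).
Local Open Scope ereal_scope.

Let g := f \_ (A `*` B).

Let mg : measurable_fun setT g.
Proof.
apply/(measurable_restrictT _ _).1; first exact: measurableX.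
exact: measurable_funTS.
Qed.

Let g1 x : (fun y => g (x, y)) = if x \in A then (fun y => f (x, y)) \_ B else cst 0.
Proof.
apply/funext => y; rewrite /g /patch; case: ifPn => [/[!inE]/= -[Ax By]|].
  by rewrite mem_set// mem_set.
case: ifPn => // xA; case: ifPn => // yB; rewrite notin_setE/= => -[].
by rewrite !inE in xA yB.
Qed.

Let g2 y : (fun x => g (x, y)) = if y \in B then (fun x => f (x, y)) \_ A else cst 0.
Proof.
apply/funext => x; rewrite /g /patch; case: ifPn => [/[!inE]/= -[Ax By]|].
  by rewrite mem_set// mem_set.
case: ifPn => // yB; case: ifPn => // xA; rewrite notin_setE/= => -[].
by rewrite !inE in xA yB.
Qed.

Let G1 : fubini_F m2 g = (fun x => \int[m2]_(y in B) f (x, y)) \_ A.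
Proof.
apply/funext => x; rewrite /fubini_F g1 /patch; case: ifPn => xA.
  by rewrite [RHS]integral_mkcond.
by rewrite integral0_eq.
Qed.

Let G2 : fubini_G m1 g = (fun y => \int[m1]_(x in A) f (x, y)) \_ B.
Proof.
apply/funext => y; rewrite /fubini_G g2 /patch; case: ifPn => yB.
  by rewrite [RHS]integral_mkcond.
by rewrite integral0_eq.
Qed.

Section tonelli.
Hypothesis f0 : forall z, 0 <= f z.

Let g0 z : 0 <= g z. Proof. by rewrite /g /patch; case: ifP. Qed.

Lemma tonelli_setX1 :
  \int[m1 \x m2]_(z in A `*` B) f z = \int[m1]_(x in A) \int[m2]_(y in B) f (x, y).
Proof. by rewrite integral_mkcond fubini_tonelli1// G1 -integral_mkcond. Qed.

Lemma tonelli_setX2 :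
  \int[m1 \x m2]_(z in A `*` B) f z = \int[m2]_(y in B) \int[m1]_(x in A) f (x, y).
Proof. by rewrite integral_mkcond fubini_tonelli2// G2 -integral_mkcond. Qed.

Lemma measurable_tonelli_setX1 :
  measurable_fun A (fun x => \int[m2]_(y in B) f (x, y)).
Proof.
apply/(measurable_restrictT _ _).2 => //.
by rewrite -G1; exact: measurable_fun_fubini_tonelli_F.
Qed.

Lemma measurable_tonelli_setX2 :
  measurable_fun B (fun y => \int[m1]_(x in A) f (x, y)).
Proof.
apply/(measurable_restrictT _ _).2 => //.
by rewrite -G2; exact: measurable_fun_fubini_tonelli_G.
Qed.

End tonelli.

Section fubini.
Hypothesis intf : (m1 \x m2).-integrable (A `*` B) f.

Let intg : (m1 \x m2).-integrable setT g.
Proof. by apply/(integrable_mkcond _ _).1 => //; exact: measurableX. Qed.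

Lemma fubini_setX1 :
  \int[m1 \x m2]_(z in A `*` B) f z = \int[m1]_(x in A) \int[m2]_(y in B) f (x, y).
Proof. by rewrite integral_mkcond -integral12_prod_meas1// G1 -integral_mkcond. Qed.

Lemma fubini_setX2 :
  \int[m1 \x m2]_(z in A `*` B) f z = \int[m2]_(y in B) \int[m1]_(x in A) f (x, y).
Proof. by rewrite integral_mkcond -integral21_prod_meas1// G2 -integral_mkcond. Qed.

End fubini.

End tonelli_setX.

(** * Layers along the boundary and their volume *)

Section boundary_layers.
Context {R : realType} {n : nat}.
Notation mu := (@volume R n).
Implicit Types (Omega : set 'rV[R]_n) (x y z e : 'rV[R]_n) (t : R).

Definition layer Omega t : set 'rV[R]_n := [set x | Omega x /\ ~ (ball x t `<=` Omega)].

Lemma layerP Omega t x : layer Omega t x <->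
  Omega x /\ exists2 z, ~ Omega z & `|x - z| < t.
Proof.
rewrite /layer/= rV_ballE; split=> -[Ox]; last first.
  by case=> z nOz xz; split=> // /(_ z xz).
by move=> /existsNP[z /not_implyP[xz Oz]]; split=> //; exists z.
Qed.

Lemma measurable_layer Omega t : open Omega -> measurable (layer Omega t).
Proof.
move=> oO; rewrite (_ : layer _ _ = Omega `&` \bigcup_(z in ~` Omega) [set x | `|z - x| < t]).
  apply: open_measurable_rV; apply: openI => //; apply: bigcup_open => z _.
  by rewrite -rV_ballE; exact: ball_open.
apply/seteqP; split=> x.
  by move=> /layerP[Ox [z nOz xz]]; split=> //; exists z => //=; rewrite distrC.
by move=> [Ox [z nOz /= xz]]; apply/layerP; split=> //; exists z => //; rewrite distrC.
Qed.

(** A layer point is closer than [t <= r] to the complement, which rules out the chart whose ball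
    fills [Omega]. For the height bound, a point outside [Omega] within [t] of [y] has [rho <= 0],
    and [rho] is [L]-Lipschitz. *)
Lemma layer_height Omega (r L t : R) x : 0 < t -> 1 <= L -> t <= r ->
  has_chart Omega r L x -> layer Omega t x ->
  exists e (rho : 'rV[R]_n -> R),
    [/\ `|e| <= 1, forall y z, `|rho y - rho z| <= L * `|y - z|,
        forall y u, rho (y + u *: e) = rho y + u,
        forall y, `|x - y| < r -> (Omega y <-> 0 < rho y) &
        forall y, `|x - y| + t <= r -> layer Omega t y -> 0 < rho y < L * t].
Proof.
move=> t0 L1 tr [xr [_ nxt]|[e [rho [e1 rhoL rhot]]]].
  by exfalso; apply: nxt; exact: subset_trans (le_ball tr) xr.
rewrite rV_ballE /= => Or _; exists e, rho; split=> // y xyr /layerP[Oy [z nOz yz]].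
have -> : 0 < rho y by apply/Or => //; rewrite (lt_le_trans _ xyr)// ltrDl.
rewrite /=.
have rz : rho z <= 0.
  rewrite leNgt; apply/negP => rz; apply: nOz; apply/Or => //.
  by rewrite (le_lt_trans (ler_distD y _ _))// (lt_le_trans _ xyr)// ltrD2l.
have ry : 0 < rho y by apply/Or => //; rewrite (lt_le_trans _ xyr)// ltrDl.
apply: (@le_lt_trans _ _ `|rho y - rho z|).
  by rewrite ger0_norm; lra.
by rewrite (le_lt_trans (rhoL y z))// ltr_pM2l// (lt_le_trans ltr01).
Qed.

(* The translates of the layer by multiples of [L * t] along [e] have disjoint
   height ranges, so [N] of them fit in a ball of radius [(1 + L) N t]. *)
Lemma layer_volume_le Omega (r L t : R) (N : nat) y : open Omega ->
  0 < t -> 1 <= L -> (0 < N)%N -> 3 * (N%:R * t) <= r ->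
  (forall x, Omega x -> has_chart Omega r L x) ->
  (N%:R%:E * mu (layer Omega t `&` ball y (N%:R * t)) <=
    ((2 * (1 + L) * (N%:R * t)) ^+ n)%:E)%E.
Proof.
move=> oO t0 L1 N0 Ntr charts; set S := _ `&` _.
have L0 : 0 < L by exact: lt_le_trans L1.
have Nt0 : 0 < N%:R * t by rewrite mulr_gt0// ltr0n.
have tNt : t <= N%:R * t by apply: ler_peMl; [exact: ltW|rewrite ler1n].
have mS : measurable S.
  by apply: measurableI; [exact: measurable_layer|exact: measurable_rV_ball].
have [->|/set0P[x [xl yx]]] := eqVneq S set0.
  by rewrite measure0 mule0 lee_fin exprn_ge0// !mulr_ge0// ?addr_ge0 ?ltW.
have Ox : Omega x by case: xl.
have tr : t <= r by lra.
have [e [rho [e1 rhoL rhot _ Sh]]] := layer_height t0 L1 tr (charts x Ox) xl.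
rewrite rV_ballE /= in yx.
(* Two points of the ball are less than 2Nt apart, and [layer_height] wants a further [t <= N t] of
   room: hence the hypothesis 3Nt <= r. *)
have {}Sh z : S z -> 0 < rho z < L * t.
  move=> [lz]; rewrite rV_ballE/= => yz; apply: Sh => //.
  by have := ler_distD y x z; rewrite (distrC x y); lra.
pose T (k : nat) z := z + - (k%:R * (L * t) *: e).
have TS k : mu (T k @^-1` S) = mu S by exact: volume_shift.
have mTS k : measurable (T k @^-1` S).
  by apply: measurable_preimage => //; exact: measurable_rV_shift.
have rhoT k z : rho (T k z) = rho z - k%:R * (L * t).
  by rewrite /T -scaleNr rhot.
have tI : trivIset setT (fun k => T k @^-1` S).
  apply/trivIsetP => i j _ _ ij; apply/seteqP; split=> // z [/Sh] /=.
  rewrite !rhoT => /andP[i0 iL] /Sh; rewrite !rhoT => /andP[j0 jL].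
  have Lt0 : 0 < L * t by rewrite mulr_gt0.
  have ltS (a b : nat) : a%:R * (L * t) < rho z -> rho z - b%:R * (L * t) < L * t ->
      (a < b.+1)%N.
    by move=> h1 h2; rewrite -(ltr_nat R) -(ltr_pM2r Lt0) -natr1 mulrDl mul1r; lra.
  have ij1 : (i < j.+1)%N by apply: ltS; lra.
  have ji1 : (j < i.+1)%N by apply: ltS; lra.
  by move/eqP: ij; apply; apply/eqP; rewrite eqn_leq -ltnS ij1 -ltnS ji1.
have -> : (N%:R%:E * mu S)%E = mu (\big[setU/set0]_(k < N) (T k @^-1` S)).
  rewrite (measure_bigsetU mu mTS tI) (eq_bigr (fun=> mu S)); last by move=> k _; exact: TS.
  by rewrite big_const_ord iter_addr addr0 mule_natl.
rewrite (_ : 2 * (1 + L) * (N%:R * t) = ((1 + L) * (N%:R * t)) *+ 2); last first.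
  by rewrite mulr2n; ring.
rewrite -(volume_ball y); last by rewrite mulr_gt0// addr_gt0.
rewrite le_measure ?inE//.
- by apply: bigsetU_measurable => k _.
- exact: measurable_rV_ball.
rewrite -(bigcup_mkord N (fun k => T k @^-1` S)) => z [k /= kN [_]].
rewrite !rV_ballE /= => yz.
have -> : y - z = (y - T k z) - k%:R * (L * t) *: e.
  by rewrite /T; apply/rowP => i; rewrite !mxE; ring.
rewrite (le_lt_trans (ler_normB _ _))// mulrDl mul1r ltr_leD// normrZ.
have kLt0 : 0 <= k%:R * (L * t) by rewrite !mulr_ge0// ltW.
rewrite ger0_norm// (le_trans (ler_piMr kLt0 e1))//.
by rewrite mulrCA ler_pM2l// ler_pM2r// ler_nat ltnW.
Qed.

End boundary_layers.

(** * Comparison of the mass of |v| in two consecutive layers *)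

Section averaging.
Context {R : realType} {n : nat}.
Notation mu := (@volume R n).
Variables (Omega : set 'rV[R]_n) (r L : R) (v : 'rV[R]_n -> R).
Hypotheses (oO : open Omega) (L1 : 1 <= L).
Hypothesis charts : forall x, Omega x -> has_chart Omega r L x.
Hypothesis mv : measurable_fun setT v.

Definition near_pairs (rho : R) : set ('rV[R]_n * 'rV[R]_n) :=
  [set p | `|p.1 - p.2| < rho].

Lemma measurable_near_pairs rho : measurable (near_pairs rho).
Proof.
have mn : measurable_fun setT (fun p : 'rV[R]_n * 'rV[R]_n => `|p.1 - p.2|).
  apply: (measurableT_comp (continuous_measurable_rV _) measurable_rV_sub).
  exact: norm_continuous.
rewrite (_ : near_pairs rho = (fun p : 'rV[R]_n * 'rV[R]_n => `|p.1 - p.2|) @^-1` `]-oo, rho[).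
  by apply: measurable_preimage => //; exact: measurable_itv.
by apply/seteqP; split=> p /=; rewrite in_itv.
Qed.

(** The unweighted part of the Gagliardo seminorm at scales below [rho]: the price of replacing |v
    x| by |v y| in an average. *)
Definition osc_near rho : \bar R := (\int[mu \x mu]_(p in Omega `*` Omega)
  (\1_(near_pairs rho) p * `|v p.1 - v p.2|)%:E)%E.

Let mO : measurable Omega. Proof. exact: open_measurable_rV. Qed.

Let mvB : measurable_fun setT (fun p : 'rV[R]_n * 'rV[R]_n => `|v p.1 - v p.2|).
Proof.
apply: measurableT_comp => //; apply: measurable_funB.
  exact: (measurableT_comp mv measurable_fst).
exact: (measurableT_comp mv measurable_snd).
Qed.

Let mosc rho : measurable_fun setT (fun p : 'rV[R]_n * 'rV[R]_n =>
  (\1_(near_pairs rho) p * `|v p.1 - v p.2|)%:E).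
Proof.
apply/measurable_EFinP; apply: measurable_funM => //.
by apply: measurable_indic; exact: measurable_near_pairs.
Qed.

Let mnv rho : measurable_fun setT (fun p : 'rV[R]_n * 'rV[R]_n =>
  (\1_(near_pairs rho) p * `|v p.2|)%:E).
Proof.
apply/measurable_EFinP; apply: measurable_funM.
  by apply: measurable_indic; exact: measurable_near_pairs.
by apply: measurableT_comp => //; exact: (measurableT_comp mv measurable_snd).
Qed.

Let mx (f : 'rV[R]_n * 'rV[R]_n -> \bar R) x : measurable_fun setT f ->
  measurable_fun setT (fun y => f (x, y)).
Proof. by move=> mf; exact: (measurableT_comp mf (measurable_pair1 x)). Qed.

Section step.
Variables (t : R) (N : nat).
Hypotheses (t0 : 0 < t) (N2 : (2 <= N)%N) (Ntr : 3 * (N%:R * t) <= r).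
Let D := N%:R * t.

Let N0 : (0 < N)%N. Proof. exact: leq_trans N2. Qed.
Let D0 : 0 < D. Proof. by rewrite mulr_gt0// ltr0n. Qed.
Let tD : t <= D / 2.
Proof.
by rewrite ler_pdivlMr// mulrC ler_pM2r// (ler_nat R 2).
Qed.
Let L0 : 0 < L. Proof. exact: lt_le_trans L1. Qed.

(** Average |v x| <= |v y| + |v x - v y| over a ball [A] of points [y] obtained by moving inwards
    from [x]; the factor on the left is the volume of [A]. *)
Lemma layer_pointwise x : layer Omega t x ->
  (((D / (2 * L)) ^+ n * `|v x|)%:E <=
    \int[mu]_(y in layer Omega D) (\1_(near_pairs D) (x, y) * `|v y|)%:E +
    \int[mu]_(y in Omega) (\1_(near_pairs D) (x, y) * `|v x - v y|)%:E)%E.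
Proof.
move=> xl; have D0' := D0; have tD' := tD; have L0' := L0.
have Ox : Omega x by case: xl.
have Ntr' : 3 * D <= r := Ntr.
have tr : t <= r by lra.
have [e [rho [e1 rhoL rhot Or _]]] := layer_height t0 L1 tr (charts Ox) xl.
(* The shift raises the height by D/4 and the radius can lower it by at most L * D/(4L) = D/4, so
   [A] stays inside [Omega]. All its points are within D/2 of [x], hence still in the layer of
   thickness [D] because t <= D/2. *)
pose A := ball (x + (D / 4) *: e) (D / (4 * L)).
have mA : measurable A by exact: measurable_rV_ball.
have DL0 : 0 < D / (4 * L) by rewrite divr_gt0// mulr_gt0.
have DL4 : D / (4 * L) <= D / 4.
  by rewrite ler_pM2l// lef_pV2 ?posrE ?mulr_gt0// ler_peMr.
have vA : mu A = ((D / (2 * L)) ^+ n)%:E.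
  rewrite volume_ball//; congr (_ ^+ _)%:E; rewrite -mulr_natl; field.
  by rewrite gt_eqF.
have AT y : A y -> `|x - y| < D - t /\ layer Omega D y.
  rewrite /A rV_ballE /= => Ay.
  have xy : `|x - y| < D / 2.
    rewrite (_ : x - y = (x + (D / 4) *: e - y) - (D / 4) *: e); last first.
      by apply/rowP => i; rewrite !mxE; ring.
    rewrite (le_lt_trans (ler_normB _ _))// normrZ ger0_norm; last by lra.
    have : D / 4 * `|e| <= D / 4 by rewrite ler_piMr//; lra.
    lra.
  split; first by lra.
  apply/layerP; split.
    apply/Or; first by lra.
    have x0 : 0 < rho x by apply/Or; [rewrite subrr normr0; lra|].
    have := rhoL (x + (D / 4) *: e) y; rewrite rhot => h.
    have : L * `|x + (D / 4) *: e - y| < D / 4.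
      by move: Ay; rewrite -(ltr_pM2l L0') => /lt_le_trans; apply; rewrite le_eqVlt;
        apply/orP; left; apply/eqP; field; rewrite gt_eqF.
    have := ler_norm (rho x + D / 4 - rho y); lra.
  have /layerP[_ [z nOz xz]] := xl; exists z => //.
  by rewrite (le_lt_trans (ler_distD x y z))// (distrC y); lra.
apply: (@le_trans _ _ (\int[mu]_(y in A) (`|v y| + `|v x - v y|)%:E)%E).
  rewrite EFinM -[X in (X * _)%E]vA muleC -integral_cst//.
  apply: ge0_le_integral => //.
  - by move=> y _; rewrite lee_fin.
  - apply/measurable_EFinP/measurable_funTS/measurable_funD.
      exact: measurableT_comp.
    by apply: measurableT_comp => //; exact: measurable_funB.
  - move=> y _; rewrite lee_fin -lerBlDl.
    exact: lerB_dist.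
under eq_integral do rewrite EFinD.
have mvx : measurable_fun A (fun y => (`|v y|)%:E).
  by apply/measurable_EFinP/measurable_funTS; exact: measurableT_comp.
have mvxy : measurable_fun A (fun y => (`|v x - v y|)%:E).
  apply/measurable_EFinP/measurable_funTS.
  by apply: measurableT_comp => //; exact: measurable_funB.
rewrite ge0_integralD//; apply: leeD.
- rewrite (eq_integral (fun y => (\1_(near_pairs D) (x, y) * `|v y|)%:E)).
    apply: ge0_subset_integral => //.
    + exact: measurable_layer.
    + by apply: measurable_funTS; exact: (mx x (mnv D)).
    + by move=> y /AT[].
  move=> y /[!inE] /AT[xy _]; rewrite indicE mem_set ?mul1r//.
  by rewrite /near_pairs/= (lt_trans xy)// ltrBlDr ltrDl.
- rewrite (eq_integral (fun y => (\1_(near_pairs D) (x, y) * `|v x - v y|)%:E)).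
    apply: ge0_subset_integral => //.
    + by apply: measurable_funTS; exact: (mx x (mosc D)).
    + by move=> y /AT[_ []].
  move=> y /[!inE] /AT[xy _]; rewrite indicE mem_set ?mul1r//.
  by rewrite /near_pairs/= (lt_trans xy)// ltrBlDr ltrDl.
Qed.

(** Integrate [layer_pointwise] and exchange the integrals: each [y] is weighted by the volume of
    the thin layer within [D] of it, and [layer_volume_le] supplies the decisive factor 1/N. *)
Lemma layer_step :
  (((D / (2 * L)) ^+ n)%:E * \int[mu]_(x in layer Omega t) (`|v x|)%:E <=
    ((2 * (1 + L) * D) ^+ n / N%:R)%:E * \int[mu]_(x in layer Omega D) (`|v x|)%:E
    + osc_near D)%E.
Proof.
have mvn A : measurable_fun A (fun y => (`|v y|)%:E).
  by apply/measurable_EFinP/measurable_funTS; exact: measurableT_comp.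
have mLt : measurable (layer Omega t) by exact: measurable_layer.
have mLD : measurable (layer Omega D) by exact: measurable_layer.
have V0 : 0 <= (D / (2 * L)) ^+ n by apply: exprn_ge0; apply: ltW; apply: divr_gt0 => //; exact: mulr_gt0.
rewrite -ge0_integralZl_EFin//.
have f10 x : (0 <= \int[mu]_(y in layer Omega D) (\1_(near_pairs D) (x, y) * `|v y|)%:E)%E.
  by apply: integral_ge0 => y _; rewrite lee_fin; apply: mulr_ge0.
have f20 x : (0 <= \int[mu]_(y in Omega) (\1_(near_pairs D) (x, y) * `|v x - v y|)%:E)%E.
  by apply: integral_ge0 => y _; rewrite lee_fin; apply: mulr_ge0.
have p10 (p : 'rV[R]_n * 'rV[R]_n) : (0 <= (\1_(near_pairs D) p * `|v p.2|)%:E)%E.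
  by rewrite lee_fin; apply: mulr_ge0.
have p20 (p : 'rV[R]_n * 'rV[R]_n) : (0 <= (\1_(near_pairs D) p * `|v p.1 - v p.2|)%:E)%E.
  by rewrite lee_fin; apply: mulr_ge0.
have mf1 := measurable_tonelli_setX1 mu mLt mLD (mnv D) p10.
have mf2 := measurable_tonelli_setX1 mu mLt mO (mosc D) p20.
apply: (@le_trans _ _ (\int[mu]_(x in layer Omega t)
    (\int[mu]_(y in layer Omega D) (\1_(near_pairs D) (x, y) * `|v y|)%:E +
     \int[mu]_(y in Omega) (\1_(near_pairs D) (x, y) * `|v x - v y|)%:E))%E).
  apply: ge0_le_integral => //.
  - by move=> x _; rewrite mule_ge0.
  - by apply: measurable_funeM; exact: mvn.
  - exact: emeasurable_funD.
  - by move=> x xl; rewrite -EFinM; exact: layer_pointwise.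
rewrite ge0_integralD//; apply: leeD; last first.
  rewrite -(tonelli_setX1 mu mu mLt mO (mosc D) p20).
  apply: ge0_subset_integral => //.
  - exact: measurableX.
  - exact: measurableX.
  - exact: measurable_funTS.
  - by move=> p [[]].
rewrite -(tonelli_setX1 mu mu mLt mLD (mnv D) p10) (tonelli_setX2 mu mu mLt mLD (mnv D) p10).
have c0 : 0 <= (2 * (1 + L) * D) ^+ n / N%:R.
  apply: divr_ge0 => //; apply: exprn_ge0; apply: ltW.
  by apply: mulr_gt0 D0; apply: mulr_gt0 => //; exact: addr_gt0.
rewrite -ge0_integralZl_EFin//.
apply: ge0_le_integral => //.
- by move=> y _; apply: integral_ge0 => x _; exact: p10.
- exact: (measurable_tonelli_setX2 mu mLt mLD (mnv D) p10).
- by apply: measurable_funeM; exact: mvn.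
move=> y _ /=.
rewrite (eq_integral (fun x => (`|v y|)%:E * (\1_(ball y D) x)%:E)%E); last first.
  move=> x _; rewrite -EFinM mulrC; congr (_ * _)%:E; rewrite !indicE; congr (_%:R).
  by congr nat_of_bool; apply/idP/idP; rewrite !inE rV_ballE /near_pairs/= distrC.
have mB : measurable (ball y D) by exact: measurable_rV_ball.
rewrite ge0_integralZl_EFin//; last first.
  by apply/measurable_EFinP/measurable_funTS; exact: measurable_indic.
rewrite integral_indic// muleC lee_wpmul2r ?lee_fin// EFinM.
rewrite lee_pdivlMr ?ltr0n// muleC setIC.
by have := layer_volume_le y oO t0 L1 N0 Ntr charts.
Qed.

End step.

End averaging.

Section geometric_decay.
Context {R : realType}.

Lemma half_recurrence_sum (M B : nat -> R) J : (forall j, 0 <= M j) ->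
  (forall j, 0 <= B j) -> (forall j, M j.+1 <= M j / 2 + B j) ->
  \sum_(j < J) M j <= 2 * M 0%N + 2 * \sum_(j < J) B j.
Proof.
move=> M0 B0 MB.
(* The term [2 * M J] carries the induction: [M J + 2 * M J.+1 <= 2 * M J + 2 * B J] by the
   recurrence. *)
suff H : \sum_(j < J) M j + 2 * M J <= 2 * M 0%N + 2 * \sum_(j < J) B j.
  by apply: le_trans H; rewrite lerDl mulr_ge0.
elim: J => [|J IH]; first by rewrite !big_ord0 add0r mulr0 addr0.
rewrite !big_ord_recr/=; have := MB J; lra.
Qed.

(** With ratio at least 2, the terms before any index add up to at most the term at that index. So
    the last term below [X] counts at most twice. *)
Lemma truncated_geometric_sum (a q X : R) J : 0 <= a -> 2 <= q -> 0 <= X ->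
  \sum_(j < J) (if a * q ^+ j <= X then a * q ^+ j else 0) <= 2 * X.
Proof.
move=> a0 q2 X0.
have full k : \sum_(j < k) a * q ^+ j <= a * q ^+ k.
  elim: k => [|k IH]; first by rewrite big_ord0 expr0 mulr1.
  rewrite big_ord_recr/= exprS.
  have : 0 <= a * q ^+ k by rewrite mulr_ge0// exprn_ge0// (le_trans _ q2).
  have : 2 * (a * q ^+ k) <= q * (a * q ^+ k).
    by rewrite ler_wpM2r// mulr_ge0// exprn_ge0// (le_trans _ q2).
  rewrite (mulrCA a q); lra.
elim: J => [|J IH]; first by rewrite big_ord0 mulr_ge0.
rewrite big_ord_recr/=; case: ifPn => [aX|_]; last by rewrite addr0.
have : \sum_(j < J) (if a * q ^+ j <= X then a * q ^+ j else 0) <= a * q ^+ J.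
  apply: le_trans (full J); apply: ler_sum => j _; case: ifPn => // _.
  by rewrite mulr_ge0// exprn_ge0// (le_trans _ q2).
lra.
Qed.

End geometric_decay.

(** * The fractional Hardy inequality *)

Section hardy.
Context {R : realType} {n : nat} (s : R).
Hypotheses (n_ge1 : (1 <= n)%N) (s_gt0 : 0 < s) (s_lt1 : s < 1).
Notation mu := (@volume R n).
Notation p := (n%:R + s).
Variable Omega : set 'rV[R]_n.
Hypotheses (oO : open Omega) (bO : bounded_set Omega) (lO : lipschitz_boundary Omega).

Let mO : measurable Omega. Proof. exact: open_measurable_rV. Qed.

Let p0 : 0 < p. Proof. by rewrite ltr_wpDl. Qed.

Definition outer_kernel x : \bar R := (\int[mu]_(y in ~` Omega) (kernel p x y)%:E)%E.

Lemma outer_kernel_ge0 x : (0 <= outer_kernel x)%E.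
Proof. by apply: integral_ge0 => y _; rewrite lee_fin kernel_ge0. Qed.

Lemma measurable_outer_kernel A : measurable A -> measurable_fun A outer_kernel.
Proof.
move=> mA; apply: (measurable_tonelli_setX1 mu (f := fun q : 'rV[R]_n * 'rV[R]_n =>
  (kernel p q.1 q.2)%:E)) => //; first exact: measurableC.
- by apply/measurable_EFinP; exact: measurable_kernel.
- by move=> q; rewrite lee_fin kernel_ge0.
Qed.

Variable v : 'rV[R]_n -> R.
Hypothesis mv : measurable_fun setT v.
Hypothesis v1 : (\int[mu]_(x in Omega) (`|v x|)%:E < +oo)%E.
Notation gag := (\int[(mu \x mu)%E]_(q in Omega `*` Omega)
  (`|v q.1 - v q.2| * kernel p q.1 q.2)%:E)%E.
Hypothesis v2 : (gag < +oo)%E.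

Let mvB : measurable_fun setT (fun q : 'rV[R]_n * 'rV[R]_n => `|v q.1 - v q.2|).
Proof.
apply: measurableT_comp => //; apply: measurable_funB.
  exact: (measurableT_comp mv measurable_fst).
exact: (measurableT_comp mv measurable_snd).
Qed.

(** For a fixed pair the weights tau_j^(-p) grow geometrically and count only while tau_j > |x - y|,
    so they sum to at most 2 |x - y|^(-p). The factor n^p passes from the sup norm to the Euclidean
    kernel. *)
Lemma osc_near_sum_le (tau0 q : R) J : 0 < tau0 -> 0 < q -> q <= 2^-1 ->
  (\sum_(j < J) (((tau0 * q ^+ j) `^ (- p))%:E * osc_near Omega v (tau0 * q ^+ j))
    <= (2 * n%:R `^ p)%:E * gag)%E.
Proof.
move=> t0 q0 q2; pose tau j := tau0 * q ^+ j.
have tau_gt0 j : 0 < tau j by rewrite mulr_gt0// exprn_gt0.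
(* Since p >= n >= 1, raising [q^-1 >= 2] to the power p does not decrease it. *)
have Q2 : 2 <= q `^ (- p).
  rewrite -mulN1r powRrM (powR_inv1 (ltW q0)).
  apply: (@le_trans _ _ q^-1); first by rewrite -[leLHS]invrK lef_pV2 ?posrE ?invr_gt0.
  apply: le1r_powR; first by rewrite invf_ge1//; lra.
  by apply: (@le_trans _ _ n%:R); rewrite ?ler1n// lerDl ltW.
pose f j (z : 'rV[R]_n * 'rV[R]_n) : \bar R :=
  ((tau j `^ (- p))%:E * (\1_(near_pairs (tau j)) z * `|v z.1 - v z.2|)%:E)%E.
have mf0 j : measurable_fun setT (fun z => (\1_(near_pairs (tau j)) z * `|v z.1 - v z.2|)%:E).
  apply/measurable_EFinP; apply: measurable_funM => //.
  by apply: measurable_indic; exact: measurable_near_pairs.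
have mf j : measurable_fun (Omega `*` Omega) (f j).
  by apply: measurable_funTS; apply: measurable_funeM.
have f0 j z : (0 <= f j z)%E.
  by rewrite mule_ge0 ?lee_fin ?powR_ge0//; apply: mulr_ge0.
have mXO : measurable (Omega `*` Omega) by exact: measurableX.
have mk : measurable_fun (Omega `*` Omega) (fun q : 'rV[R]_n * 'rV[R]_n =>
    (`|v q.1 - v q.2| * kernel p q.1 q.2)%:E).
  apply/measurable_EFinP/measurable_funTS/measurable_funM => //.
  exact: measurable_kernel.
have -> : (\sum_(j < J) ((tau j `^ (- p))%:E * osc_near Omega v (tau j)) =
    \int[mu \x mu]_(z in Omega `*` Omega) \sum_(j < J) f j z)%E.
  rewrite ge0_integral_sum//.
  apply: eq_bigr => j _; rewrite ge0_integralZl_EFin ?powR_ge0//.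
  exact: measurable_funTS.
rewrite -ge0_integralZl_EFin//; last first.
  by move=> z _; rewrite lee_fin mulr_ge0// kernel_ge0.
apply: ge0_le_integral => //.
- by move=> z _; apply: sume_ge0.
- by apply: emeasurable_sum.
- by apply: measurable_funeM.
move=> [x y] _; rewrite /f /=.
have [->|xy] := eqVneq x y.
  rewrite subrr normr0 mul0r mule0 big1// => j _; by rewrite mulr0 mule0.
have d0 : 0 < `|x - y| by rewrite normr_gt0 subr_eq0.
pose X := `|x - y| `^ (- p).
under eq_bigr do rewrite -EFinM mulrA.
rewrite sumEFin lee_fin -big_distrl/= mulrC [leRHS]mulrCA ler_wpM2l//.
apply: (@le_trans _ _ (2 * X)).
  apply: le_trans (truncated_geometric_sum J (powR_ge0 tau0 (- p)) Q2 (powR_ge0 _ _)).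
  apply: ler_sum => j _; rewrite -(powR_geometric _ _ (ltW t0) (ltW q0)).
  rewrite indicE; case: ifPn => [_|]; first by rewrite ler_piMr ?powR_ge0// lern1 leq_b1.
  rewrite -ltNge => h; rewrite memNset ?mulr0// /near_pairs/= => xyj.
  move: h; rewrite /X !powRN ltf_pV2 ?posrE ?powR_gt0 ?(tau_gt0 j)//.
  by rewrite ltNge ge0_ler_powR ?nnegrE ?(ltW p0) ?(ltW d0) ?(ltW (tau_gt0 j)) ?(ltW xyj).
rewrite -mulrA ler_wpM2l// -ler_pdivrMl ?powR_gt0 ?ltr0n// mulrC -powRN -powRM//.
apply: kernel_ge; first exact: ltW.
  exact: lt_le_trans (normr_le_enorm _).
by rewrite mulrC enorm_le_normr.
Qed.

Let L1fin t : (\int[mu]_(x in layer Omega t) (`|v x|)%:E)%E \is a fin_num.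
Proof.
rewrite ge0_fin_numE; last by apply: integral_ge0 => x _; rewrite lee_fin.
apply: le_lt_trans v1; apply: ge0_subset_integral => //.
- exact: measurable_layer.
- by apply/measurable_EFinP/measurable_funTS; exact: measurableT_comp.
- by move=> x [].
Qed.

Let osc_fin t : 0 < t -> osc_near Omega v t \is a fin_num.
Proof.
move=> t0; have osc0 : (0 <= osc_near Omega v t)%E.
  by apply: integral_ge0 => z _; rewrite lee_fin; apply: mulr_ge0.
rewrite ge0_fin_numE// ltey; apply/eqP => oscy.
have q0 : 0 < 2^-1 :> R by rewrite invr_gt0.
have : ((2 * n%:R `^ p)%:E * gag < +oo)%E.
  by apply: lte_mul_pinfty => //; rewrite lee_fin mulr_ge0// powR_ge0.
have := osc_near_sum_le 1 t0 q0 (lexx _).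
rewrite big_ord1 expr0 mulr1 oscy gt0_muley ?lte_fin ?powR_gt0// leye_eq => /eqP ->.
by rewrite ltxx.
Qed.

(* With [N] large, the weighted masses [M j = tau_j^(-s) m_j] of the layers at
   scale [tau_j = tau_0 N^(-j)] satisfy [M (j+1) <= M j / 2 + B j]. *)
Lemma layer_masses_sum : exists tau0 q S : R,
  [/\ 0 < tau0, 0 < q, q < 1 & forall J, \sum_(j < J)
    (tau0 * q ^+ j) `^ (- s) *
      fine (\int[mu]_(x in layer Omega (tau0 * q ^+ j)) (`|v x|)%:E) <= S].
Proof.
have [r [L [r0 L1 charts]]] := uniform_charts n_ge1 oO bO lO.
have L0 : 0 < L by exact: lt_le_trans L1.
pose C1 := (2 * (1 + L)) ^+ n * (2 * L) ^+ n.
have C10 : 0 < C1 by rewrite mulr_gt0// exprn_gt0// mulr_gt0// addr_gt0.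
have s1 : 0 < 1 - s by rewrite subr_gt0.
(* Chosen so that N^(1-s) >= 2 C1, that is N^s C1 / N <= 1/2: this is the contraction factor of the
   recurrence. The offset [.+2] also secures N >= 2. *)
pose N := (Num.truncn ((2 * C1) `^ (1 - s)^-1)).+2.
have N0 : 0 < N%:R :> R by rewrite ltr0n.
have CN : 2 * C1 <= N%:R `^ (1 - s).
  have C2 : 0 <= 2 * C1 by rewrite mulr_ge0// ltW.
  have -> : 2 * C1 = ((2 * C1) `^ (1 - s)^-1) `^ (1 - s).
    by rewrite -powRrM mulVf ?gt_eqF// powRr1.
  apply: ge0_ler_powR; rewrite ?nnegrE ?powR_ge0// ?(ltW s1)//.
  apply: le_trans (ltW (truncnS_gt _)) _.
  by rewrite ler_nat.
pose q : R := N%:R^-1.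
have q0 : 0 < q by rewrite invr_gt0.
have q2 : q <= 2^-1 by rewrite lef_pV2 ?posrE// (ler_nat R 2).
(* Starting at r/3 gives 3 N tau_(j+1) = 3 tau_j <= r, the size condition of [layer_step]. *)
pose tau j := r / 3 * q ^+ j.
have r30 : 0 < r / 3 by rewrite divr_gt0.
have tau_gt0 j : 0 < tau j by rewrite mulr_gt0// exprn_gt0.
have tauS j : N%:R * tau j.+1 = tau j.
  by rewrite /tau exprS mulrCA [N%:R * _]mulrA mulfV ?mul1r// gt_eqF.
have tau_le j : 3 * tau j <= r.
  have : q ^+ j <= 1 by rewrite exprn_ile1// ?ltW//; lra.
  by move=> qj; rewrite /tau mulrA mulrCA divff// mulr1 ler_piMr// ltW.
pose a j := fine (\int[mu]_(x in layer Omega (tau j)) (`|v x|)%:E).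
pose o j := fine (osc_near Omega v (tau j)).
have a0 j : 0 <= a j by apply: fine_ge0; apply: integral_ge0 => x _; rewrite lee_fin.
have o0 j : 0 <= o j.
  by apply: fine_ge0; apply: integral_ge0 => x _; rewrite lee_fin; apply: mulr_ge0.
have step j : (tau j / (2 * L)) ^+ n * a j.+1 <= (2 * (1 + L) * tau j) ^+ n / N%:R * a j + o j.
  have N2 : (2 <= N)%N by [].
  have Nr : 3 * (N%:R * tau j.+1) <= r by rewrite tauS.
  have := layer_step oO L1 charts mv (tau_gt0 j.+1) N2 Nr.
  rewrite tauS -(fineK (L1fin (tau j.+1))) -(fineK (L1fin (tau j))).
  by rewrite -(fineK (osc_fin (tau_gt0 j))) -!EFinM -EFinD lee_fin.
pose B j := N%:R `^ s * (2 * L) ^+ n * (tau j `^ (- p) * o j).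
have step' j : tau j.+1 `^ (- s) * a j.+1 <= tau j `^ (- s) * a j / 2 + B j.
  have tn0 : 0 < (tau j / (2 * L)) ^+ n by rewrite exprn_gt0// divr_gt0// mulr_gt0.
  have tq : tau j.+1 `^ (- s) = N%:R `^ s * tau j `^ (- s).
    rewrite -(tauS j) powRM ?ler0n ?(ltW (tau_gt0 _))// mulrA -powRD; last first.
      by apply/implyP => _; rewrite gt_eqF.
    by rewrite subrr powRr0 mul1r.
  have := step j; rewrite -ler_pdivlMl// => /(ler_wpM2l (powR_ge0 (tau j.+1) (- s))).
  move/le_trans; apply; rewrite mulrDr mulrDr.
  have Tn0 : tau j ^+ n != 0 by rewrite expf_neq0// gt_eqF.
  have NN0 : N%:R != 0 :> R by rewrite gt_eqF.
  have -> : ((tau j / (2 * L)) ^+ n)^-1 = (2 * L) ^+ n / tau j ^+ n.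
    by rewrite expr_div_n invf_div.
  have Tp : tau j `^ (- p) = tau j `^ (- s) / tau j ^+ n.
    rewrite opprD addrC powRD; last by apply/implyP => _; rewrite gt_eqF.
    by rewrite [in X in _ * X]powRN powR_mulrn// ltW.
  have NC : N%:R `^ s * C1 / N%:R <= 2^-1.
    have : N%:R `^ s * (2 * C1) <= N%:R.
      have NN : N%:R `^ s * N%:R `^ (1 - s) = N%:R.
        rewrite -powRD; last by apply/implyP => _; rewrite gt_eqF.
        by rewrite addrC subrK powRr1// ltW.
      by rewrite -[leRHS]NN ler_pM2l// powR_gt0.
    by rewrite ler_pdivrMr//; lra.
  rewrite tq /B Tp (exprMn n (2 * (1 + L)) (tau j)); apply: lerD;
    last by rewrite le_eqVlt; apply/orP; left; apply/eqP; field.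
  have /(ler_wpM2r (mulr_ge0 (powR_ge0 (tau j) (- s)) (a0 j))) := NC.
  rewrite [leRHS]mulrC; apply: le_trans; rewrite le_eqVlt; apply/orP; left; apply/eqP.
  by rewrite /C1; field; rewrite NN0 Tn0.
exists (r / 3), q.
have [q1 g0] : q < 1 /\ gag \is a fin_num.
  split; first by lra.
  rewrite ge0_fin_numE// integral_ge0// => z _.
  by rewrite lee_fin mulr_ge0// kernel_ge0.
exists (2 * (tau 0 `^ (- s) * a 0%N) +
  2 * (N%:R `^ s * (2 * L) ^+ n * (2 * n%:R `^ p * fine gag))); split=> // J.
apply: le_trans (half_recurrence_sum (M := fun j => tau j `^ (- s) * a j) J _ _ step') _.
- by move=> j; rewrite mulr_ge0// powR_ge0.
- by move=> j; rewrite !mulr_ge0// ?powR_ge0// exprn_ge0// mulr_ge0// ltW.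
rewrite lerD2l ler_pM2l// -big_distrr/= ler_wpM2l//.
  by rewrite mulr_ge0// ?powR_ge0// exprn_ge0// mulr_ge0// ltW.
rewrite -lee_fin EFinM fineK//.
apply: le_trans (osc_near_sum_le J r30 q0 q2).
rewrite -sumEFin; apply: lee_sum => j _.
by rewrite EFinM /o fineK// osc_fin.
Qed.

(** Let k be the first index for which the ball of radius tau_k about x lies in [Omega]. Then
    [kernel_tail] bounds the outer kernel at x by a multiple of tau_k^(-s), and if k = j+1 then x
    lies in the layer of thickness tau_j. So [h k] dominates at x, and the [h k] sum to the weighted
    layer masses; the shift from j+1 to j costs q^(-s). *)
Lemma hardy : (\int[mu]_(x in Omega) ((`|v x|)%:E * outer_kernel x) < +oo)%E.
Proof.
have [Ct Ct0 tail] := kernel_tail (n := n) s_gt0.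
have [tau0 [q [S [t0 q0 q1 sumS]]]] := layer_masses_sum.
pose tau j := tau0 * q ^+ j.
have tau_gt0 j : 0 < tau j by rewrite mulr_gt0// exprn_gt0.
have mLj j : measurable (layer Omega (tau j)) by exact: measurable_layer.
have mnv : measurable_fun setT (fun x => (`|v x|)%:E).
  by apply/measurable_EFinP; exact: measurableT_comp.
pose h k x : \bar R := if k is j.+1 then
    ((Ct * tau j.+1 `^ (- s))%:E * ((`|v x|)%:E * (\1_(layer Omega (tau j)) x)%:E))%E
  else ((Ct * tau 0%N `^ (- s))%:E * (`|v x|)%:E)%E.
have Ctau0 k : 0 <= Ct * tau k `^ (- s) by rewrite mulr_ge0 ?powR_ge0 ?(ltW Ct0).
have mind j : measurable_fun setT (fun x => (\1_(layer Omega (tau j)) x)%:E : \bar R).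
  by apply/measurable_EFinP; exact: measurable_indic.
have mh k : measurable_fun Omega (h k).
  apply: measurable_funTS; case: k => [|k] /=; apply: measurable_funeM => //.
  exact: emeasurable_funM.
have h0 k x : (0 <= h k x)%E.
  by case: k => [|k] /=; rewrite !mule_ge0 ?lee_fin.
pose A := fine (\int[mu]_(x in Omega) (`|v x|)%:E).
apply: (@le_lt_trans _ _ (Ct * tau 0 `^ (- s) * A + Ct * q `^ (- s) * S)%:E); last exact: ltry.
apply: (integral_le_some (h := h)) => //.
- apply: emeasurable_funM; first exact: measurable_funTS.
  exact: measurable_outer_kernel.
- by move=> x _; rewrite mule_ge0// ?lee_fin// outer_kernel_ge0.
- move=> x Ox.
  have Kx k : ball x (tau k) `<=` Omega ->
      ((`|v x|)%:E * outer_kernel x <= (Ct * tau k `^ (- s))%:E * (`|v x|)%:E)%E.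
    move=> xk; rewrite muleC lee_wpmul2r ?lee_fin//.
    apply: tail => //; first exact: measurableC.
    move=> y nOy /=; rewrite leNgt; apply/negP => xy; apply: nOy; apply: xk.
    by rewrite rV_ballE.
  have ex : exists k, `[< ball x (tau k) `<=` Omega >].
    have [e /= e0 eO] : exists2 e : R, 0 < e & ball x e `<=` Omega.
      by have /nbhs_ballP[e e0 eO] := open_nbhs_nbhs (conj oO Ox); exists e.
    have qlt1 : `|q| < 1 by rewrite gtr0_norm.
    have /cvgrPdist_lt /(_ e e0) [k _ /(_ k (leqnn k))] := cvg_geometric tau0 qlt1.
    rewrite sub0r normrN /= => ke; exists k; apply/asboolP.
    by apply: subset_trans eO; apply: le_ball; rewrite ltW// (le_lt_trans (ler_norm _)).
  case: (ex_minnP ex) => -[|k] /asboolP xk kmin; first by exists 0%N; exact: Kx.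
  exists k.+1; rewrite /= indicE mem_set ?mule1; first exact: Kx.
  split=> // /asboolP/kmin; by rewrite ltnn.
case=> [|J].
  have A0 : 0 <= A by apply: fine_ge0; apply: integral_ge0 => x _; rewrite lee_fin.
  have S0 : 0 <= S by have := sumS 0%N; rewrite big_ord0.
  by rewrite big_geq// lee_fin addr_ge0// !mulr_ge0// ?powR_ge0// ltW.
rewrite big_nat_recl// [X in (_ <= X)%E]EFinD; apply: leeD.
  rewrite /h ge0_integralZl_EFin//; last exact: measurable_funTS.
  rewrite [leRHS]EFinM /A fineK// ge0_fin_numE//.
  by apply: integral_ge0 => x _; rewrite lee_fin.
rewrite [leRHS]EFinM.
apply: (@le_trans _ _ ((Ct * q `^ (- s))%:E * (\sum_(j < J) tau j `^ (- s) *
  fine (\int[mu]_(x in layer Omega (tau j)) (`|v x|)%:E))%:E)%E); last first.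
  by rewrite lee_wpmul2l// lee_fin// mulr_ge0 ?powR_ge0 ?(ltW Ct0).
rewrite -EFinM big_distrr/= -sumEFin big_mkord; apply: lee_sum => j _.
rewrite ge0_integralZl_EFin//; last first.
  by apply: measurable_funTS; exact: emeasurable_funM.
have -> : (\int[mu]_(x in Omega) ((`|v x|)%:E * (\1_(layer Omega (tau j)) x)%:E) =
    \int[mu]_(x in layer Omega (tau j)) (`|v x|)%:E)%E.
  rewrite -[in RHS](setIidr (_ : layer Omega (tau j) `<=` Omega)); last by move=> x [].
  by rewrite integral_mkcondr epatch_indic.
have -> : tau j.+1 `^ (- s) = q `^ (- s) * tau j `^ (- s).
  rewrite -(powRM _ (ltW q0) (ltW (tau_gt0 j))) /tau exprS; congr (_ `^ _); ring.
by rewrite -(fineK (L1fin (tau j))) -EFinM !mulrA.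
Qed.

End hardy.

(** * The energy of pairs of points *)

(** The jump [a] is an argument of its own, so that the same density serves pairs inside [Omega] and
    the interaction of a value with the exterior datum. *)
Definition pair_energy (R : realType) n (c : R -> R) (s a : R) (x y : 'rV[R]_n) : R :=
  c (a / enorm (x - y)) / enorm (x - y) `^ (n%:R - 1 + s).

Section pair_energy.
Context {R : realType} {n : nat} (s : R) (c : R -> R) (cs lam : R).
Hypotheses (n_ge1 : (1 <= n)%N) (s_gt0 : 0 < s) (ed : energy_density c cs lam).
Notation p := (n%:R + s).
Notation p' := (n%:R - 1 + s).
Implicit Types (x y : 'rV[R]_n) (a b t : R).
Notation Phi := (pair_energy c s).

Let p'_gt0 : 0 < p'. Proof. by rewrite ltr_wpDl// subr_ge0 ler1n. Qed.

Let p_gt0 : 0 < p. Proof. by rewrite ltr_wpDl. Qed.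

Let d_p d : 0 < d -> d * d `^ p' = d `^ p.
Proof.
move=> d0; rewrite -{1}(powRr1 (ltW d0)) -powRD; last by apply/implyP => _; rewrite gt_eqF.
by congr (_ `^ _); ring.
Qed.

Let enorm_cases x y : enorm (x - y) = 0 \/ 0 < enorm (x - y).
Proof. by have := enorm_ge0 (x - y); rewrite le_eqVlt => /predU1P[]; [left|right]. Qed.

(** Apply [ed_gap] to [t] and [- t]: the midpoint value is [c 0 = 0] and, by evenness, the mean is
    [c t]. *)
Lemma density_ge0 t : 0 <= c t.
Proof.
have [k k0 /(_ t (- t) (lexx _))] := ed_gap ed `|t|.
rewrite normrN lexx subrr mul0r (ed_eq0 ed) (ed_even ed) => /(_ isT).
have : 0 <= k * (t - - t) ^+ 2 by rewrite mulr_ge0 ?sqr_ge0// ltW.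
lra.
Qed.

Lemma continuous_density : continuous c.
Proof.
move=> t; apply/cvgrPdist_lt => e e0; near=> u.
apply: le_lt_trans (ed_lip ed _ _) _; rewrite mulrC -ltr_pdivlMr ?(ed_slope_gt0 ed)//.
near: u; apply: cvgr_dist_lt => //; first by rewrite divr_gt0 ?(ed_slope_gt0 ed).
Unshelve. all: by end_near. Qed.

Lemma pair_energy0 x y : Phi 0 x y = 0.
Proof. by rewrite /pair_energy mul0r (ed_eq0 ed) mul0r. Qed.

Lemma pair_energyN a x y : Phi (- a) x y = Phi a x y.
Proof. by rewrite /pair_energy mulNr (ed_even ed). Qed.

Lemma pair_energyC a x y : Phi a x y = Phi a y x.
Proof. by rewrite /pair_energy enormB. Qed.

Lemma pair_energy_ge0 a x y : 0 <= Phi a x y.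
Proof. by rewrite divr_ge0 ?density_ge0 ?powR_ge0. Qed.

Lemma pair_energy_lip a b x y : `|Phi a x y - Phi b x y| <= cs * `|a - b| * kernel p x y.
Proof.
rewrite /pair_energy /kernel; have [->|d0] := enorm_cases x y.
  by rewrite !invr0 !mulr0 (ed_eq0 ed) !mul0r subrr normr0 (powR0 (lt0r_neq0 p_gt0)) invr0 mulr0.
set d := enorm _ in d0 *.
have dp0 : 0 < d `^ p' by rewrite powR_gt0.
rewrite -mulrBl normrM normfV (ger0_norm (ltW dp0)) ler_pdivrMr//.
apply: (le_trans (ed_lip ed _ _)); rewrite -mulrBl normrM normfV (ger0_norm (ltW d0)).
rewrite -(d_p d0) le_eqVlt; apply/orP; left; apply/eqP; field.
by rewrite !gt_eqF.
Qed.

Lemma pair_energy_le a x y : Phi a x y <= cs * `|a| * kernel p x y.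
Proof.
have := pair_energy_lip a 0 x y; rewrite pair_energy0 !subr0.
by rewrite ger0_norm// pair_energy_ge0.
Qed.

Lemma pair_energy_lb a x y :
  cs * `|a| * kernel p x y - lam * kernel p' x y <= Phi a x y.
Proof.
rewrite /pair_energy /kernel; have [->|d0] := enorm_cases x y.
  rewrite invr0 mulr0 (ed_eq0 ed) mul0r (powR0 (lt0r_neq0 p_gt0)).
  by rewrite (powR0 (lt0r_neq0 p'_gt0)) invr0 !mulr0 subrr.
set d := enorm _ in d0 *.
have dp0 : 0 < d `^ p' by rewrite powR_gt0.
rewrite ler_pdivlMr//; apply: le_trans (ed_lb ed (a / d)).
rewrite normrM normfV (ger0_norm (ltW d0)) -(d_p d0) le_eqVlt.
by apply/orP; left; apply/eqP; field; rewrite !gt_eqF.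
Qed.

Lemma pair_energy_mid a b x y : Phi ((a + b) / 2) x y <= (Phi a x y + Phi b x y) / 2.
Proof.
rewrite /pair_energy; set d := enorm _; set w := (d `^ p')^-1.
have w0 : 0 <= w by rewrite invr_ge0 powR_ge0.
have [k k0] := ed_gap ed (Num.max `|a / d| `|b / d|).
move=> /(_ (a / d) (b / d)); rewrite !le_max !lexx orbT => /(_ isT isT).
have : 0 <= k * (a / d - b / d) ^+ 2 by rewrite mulr_ge0 ?sqr_ge0// ltW.
rewrite -mulrDl mulrAC [_ / 2 / d]mulrAC => h1 h2.
have : c ((a + b) / d / 2) <= (c (a / d) + c (b / d)) / 2 by lra.
by move=> /(ler_wpM2r w0); rewrite mulrAC -!mulrA; lra.
Qed.

(** Distance at least 1 keeps the quotients a/d and b/d in [-M, M]; distance at most D keeps the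
    gap, weakened by d^2 and by the kernel, bounded below uniformly in the pair. *)
Lemma pair_energy_gap (M D : R) : 0 < D -> exists2 k, 0 < k & forall a b x y,
  `|a| <= M -> `|b| <= M -> 1 <= enorm (x - y) -> enorm (x - y) <= D ->
  Phi ((a + b) / 2) x y + k * (a - b) ^+ 2 <= (Phi a x y + Phi b x y) / 2.
Proof.
move=> D0; have [k k0 gap] := ed_gap ed M.
exists (k / D ^+ 2 / D `^ p') => [|a b x y aM bM d1 dD].
  by rewrite !divr_gt0 ?exprn_gt0 ?powR_gt0.
rewrite /pair_energy; set d := enorm _ in d1 dD *.
have d0 : 0 < d by exact: lt_le_trans d1.
have norm_le e : `|e| <= M -> `|e / d| <= M.
  move=> eM; rewrite normrM normfV (ger0_norm (ltW d0)) ler_pdivrMr//.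
  by apply: (le_trans eM); rewrite ler_peMr// (le_trans _ eM).
have := gap (a / d) (b / d) (norm_le a aM) (norm_le b bM).
have dp0 : 0 < d `^ p' by rewrite powR_gt0.
have -> : (a / d + b / d) / 2 = (a + b) / 2 / d by rewrite -mulrDl mulrAC.
have -> : a / d - b / d = (a - b) / d by rewrite -mulrBl.
rewrite -(ler_pM2r (_ : 0 < (d `^ p')^-1)) ?invr_gt0//.
have h : k / D ^+ 2 / D `^ p' * (a - b) ^+ 2 <= k * ((a - b) / d) ^+ 2 * (d `^ p')^-1.
  have -> : k / D ^+ 2 / D `^ p' * (a - b) ^+ 2 =
      k * (a - b) ^+ 2 * ((D ^+ 2)^-1 * (D `^ p')^-1) by ring.
  have -> : k * ((a - b) / d) ^+ 2 * (d `^ p')^-1 =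
      k * (a - b) ^+ 2 * ((d ^+ 2)^-1 * (d `^ p')^-1) by rewrite expr_div_n; ring.
  apply: ler_wpM2l; first by rewrite mulr_ge0 ?sqr_ge0 ?(ltW k0).
  apply: ler_pM; rewrite ?invr_ge0 ?sqr_ge0 ?powR_ge0//.
    by rewrite lef_pV2 ?posrE ?exprn_gt0// ler_pXn2r// nnegrE ltW.
  rewrite lef_pV2 ?posrE ?powR_gt0//.
  by apply: ge0_ler_powR; rewrite ?nnegrE ?(ltW p'_gt0) ?(ltW d0) ?(ltW D0).
by move=> h2; lra.
Qed.

Lemma measurable_pair_energy (f : 'rV[R]_n * 'rV[R]_n -> R) : measurable_fun setT f ->
  measurable_fun setT (fun q => Phi (f q) q.1 q.2).
Proof.
move=> mf; rewrite (_ : (fun q => _) = (fun q : 'rV[R]_n * 'rV[R]_n =>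
  c (f q / enorm (q.1 - q.2)) * kernel p' q.1 q.2))//.
apply: measurable_funM; last exact: measurable_kernel.
apply: (measurableT_comp (continuous_measurable_fun continuous_density)).
rewrite (_ : (fun q => _) = (fun q : 'rV[R]_n * 'rV[R]_n => f q * kernel 1 q.1 q.2)).
  by apply: measurable_funM => //; exact: measurable_kernel.
by apply/funext => q; rewrite /kernel powRr1// enorm_ge0.
Qed.

End pair_energy.

(** * Interaction with the exterior datum *)

Section exterior_energy.
Context {R : realType} {n : nat} (s : R) (c : R -> R) (cs lam : R).
Hypotheses (n_ge1 : (1 <= n)%N) (s_gt0 : 0 < s) (ed : energy_density c cs lam).
Notation p := (n%:R + s).
Notation p' := (n%:R - 1 + s).
Notation mu := (@volume R n).
Notation Phi := (pair_energy c s).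
Variables (Omega : set 'rV[R]_n) (phi : 'rV[R]_n -> R).
Hypotheses (oO : open Omega) (mphi : measurable_fun setT phi).
Implicit Types (x y : 'rV[R]_n) (t u : R).

Let cs0 : 0 < cs. Proof. exact: ed_slope_gt0 ed. Qed.

Let mO : measurable Omega. Proof. exact: open_measurable_rV. Qed.

Let mCO : measurable (~` Omega). Proof. exact: measurableC. Qed.

(* The interaction of a value [t] at [x] with the exterior datum, normalised to
   vanish at [t = 0] so that it converges without decay of [phi]. *)
Definition ext_diff x t y : R := Phi (t - phi y) x y - Phi (phi y) x y.

Definition ext_energy x t : R := \int[mu]_(y in ~` Omega) ext_diff x t y.

(** The subtracted term cancels in the difference, and the shifts by [phi y] cancel in the jump.
    Hence a bound free of [phi], and convergence for any measurable datum. *)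
Lemma ext_diff_lip x t u y :
  `|ext_diff x t y - ext_diff x u y| <= cs * `|t - u| * kernel p x y.
Proof.
have -> : ext_diff x t y - ext_diff x u y = Phi (t - phi y) x y - Phi (u - phi y) x y.
  by rewrite /ext_diff; ring.
have -> : t - u = (t - phi y) - (u - phi y) by ring.
exact: (pair_energy_lip s_gt0 ed).
Qed.

Lemma ext_diff0 x y : ext_diff x 0 y = 0.
Proof. by rewrite /ext_diff sub0r (pair_energyN s ed) subrr. Qed.

Lemma ext_diff_abs x t y : `|ext_diff x t y| <= cs * `|t| * kernel p x y.
Proof. by have := ext_diff_lip x t 0 y; rewrite ext_diff0 !subr0. Qed.

Lemma measurable_ext_diff (f : 'rV[R]_n -> R) : measurable_fun setT f ->
  measurable_fun setT (fun q : 'rV[R]_n * 'rV[R]_n => ext_diff q.1 (f q.1) q.2).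
Proof.
move=> mf; have mphi2 : measurable_fun setT (fun q : 'rV[R]_n * 'rV[R]_n => phi q.2).
  exact: (measurableT_comp mphi measurable_snd).
apply: measurable_funB.
  apply: (measurable_pair_energy s ed (f := fun q => f q.1 - phi q.2)).
  apply: measurable_funB => //; exact: (measurableT_comp mf measurable_fst).
exact: (measurable_pair_energy s ed (f := fun q => phi q.2)).
Qed.

Lemma measurable_ext_diff2 x t : measurable_fun setT (ext_diff x t).
Proof.
have := measurableT_comp (measurable_ext_diff (f := cst t) _) (measurable_pair1 x).
by apply.
Qed.

Lemma outer_kernel_lty x : Omega x -> (outer_kernel s Omega x < +oo)%E.
Proof.
move=> Ox; have [C C0 tail] := kernel_tail (n := n) s_gt0.
have [e /= e0 eO] : exists2 e : R, 0 < e & ball x e `<=` Omega.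
  by have /nbhs_ballP[e e0 eO] := open_nbhs_nbhs (conj oO Ox); exists e.
apply: le_lt_trans (tail x e (~` Omega) e0 mCO _) (ltry _).
move=> y nOy /=; rewrite leNgt; apply/negP => xy; apply: nOy; apply: eO.
by rewrite rV_ballE.
Qed.

Section at_point.
Variable x : 'rV[R]_n.
Hypothesis Ox : Omega x.

Let K := fine (outer_kernel s Omega x).

Let KE : outer_kernel s Omega x = K%:E.
Proof. by rewrite fineK// ge0_fin_numE ?outer_kernel_ge0// outer_kernel_lty. Qed.

Lemma kernel_integrable : mu.-integrable (~` Omega) (EFin \o kernel p x).
Proof.
apply/integrableP; split.
  by apply/measurable_EFinP/measurable_funTS; exact: measurable_kernel2.
under eq_integral do rewrite /= ger0_norm ?kernel_ge0//.
exact: outer_kernel_lty.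
Qed.

Let kernelZ_integrable (k : R) : mu.-integrable (~` Omega) (EFin \o (fun y => k * kernel p x y)).
Proof.
rewrite (_ : EFin \o _ = (fun y => k%:E * (EFin \o kernel p x) y)%E)//.
by apply: integrableZl => //; exact: kernel_integrable.
Qed.

Lemma ext_diff_integrable t : mu.-integrable (~` Omega) (EFin \o ext_diff x t).
Proof.
apply: le_integrable (kernelZ_integrable (cs * `|t|)) => //.
  by apply/measurable_EFinP/measurable_funTS; exact: measurable_ext_diff2.
move=> y _ /=; rewrite lee_fin (le_trans (ext_diff_abs _ _ _))//.
exact: ler_norm.
Qed.

Lemma ext_energy_lip t u : `|ext_energy x t - ext_energy x u| <= cs * `|t - u| * K.
Proof.
rewrite /ext_energy -RintegralB//; try exact: ext_diff_integrable.
have intB : mu.-integrable (~` Omega) (EFin \o (fun y => ext_diff x t y - ext_diff x u y)).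
  rewrite (_ : EFin \o _ = ((EFin \o ext_diff x t) \- (EFin \o ext_diff x u))%E)//.
  by apply: integrableB => //; exact: ext_diff_integrable.
apply: le_trans (le_normr_Rintegral mCO intB) _.
rewrite /K -[fine _]/(\int[mu]_(y in ~` Omega) kernel p x y) -RintegralZl//; last exact: kernel_integrable.
apply: le_Rintegral => //; first exact: integrable_norm.
by move=> y _; exact: ext_diff_lip.
Qed.

Lemma ext_energy0 : ext_energy x 0 = 0.
Proof.
rewrite /ext_energy; under eq_Rintegral do rewrite ext_diff0.
by rewrite Rintegral_cst// mul0r.
Qed.

(** Integrate the gap over [B] and plain midpoint convexity over the rest of the exterior. The case
    [k = 0] with [B] empty gives convexity of [ext_energy] in its value. *)
Lemma ext_energy_gap (B : set 'rV[R]_n) (k : R) t u : measurable B ->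
  B `<=` ~` Omega -> (mu B < +oo)%E ->
  (forall y, B y -> Phi ((t - phi y + (u - phi y)) / 2) x y + k * (t - u) ^+ 2 <=
     (Phi (t - phi y) x y + Phi (u - phi y) x y) / 2) ->
  ext_energy x ((t + u) / 2) + k * fine (mu B) * (t - u) ^+ 2 <=
  (ext_energy x t + ext_energy x u) / 2.
Proof.
move=> mB BO Bfin gap.
have ind1 : (\int[mu]_(y in ~` Omega) (\1_B y)%:E = mu B)%E.
  by rewrite integral_indic//; congr (mu _); exact/setIidPl.
have indB : mu.-integrable (~` Omega) (EFin \o \1_B).
  apply/integrableP; split.
    by apply/measurable_EFinP/measurable_funTS; exact: measurable_indic.
  under eq_integral do rewrite /= ger0_norm//.
  by rewrite ind1.
have -> : k * fine (mu B) * (t - u) ^+ 2 =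
    \int[mu]_(y in ~` Omega) (k * (t - u) ^+ 2 * \1_B y).
  by rewrite RintegralZl// /Rintegral ind1 mulrAC.
have {}indB : mu.-integrable (~` Omega) (EFin \o (fun y => k * (t - u) ^+ 2 * \1_B y)).
  rewrite (_ : EFin \o _ = (fun y => (k * (t - u) ^+ 2)%:E * (EFin \o \1_B) y)%E)//.
  exact: integrableZl.
have intD f1 f2 : mu.-integrable (~` Omega) (EFin \o f1) ->
    mu.-integrable (~` Omega) (EFin \o f2) ->
    mu.-integrable (~` Omega) (EFin \o (fun y => f1 y + f2 y)).
  by move=> if1 if2; exact: (integrableD mCO if1 if2).
have intt := ext_diff_integrable t; have intu := ext_diff_integrable u.
have intm := ext_diff_integrable ((t + u) / 2).
rewrite /ext_energy [leRHS]mulrC -RintegralD// -RintegralD// -RintegralZl//; last exact: intD.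
apply: le_Rintegral => //; first exact: intD.
  have h := integrableZl mCO 2^-1 (intD _ _ intt intu).
  exact: h.
move=> y nOy.
have e : (t + u) / 2 - phi y = (t - phi y + (u - phi y)) / 2 by field.
rewrite /ext_diff indicE; case: (boolP (y \in B)) => [/set_mem/gap|_].
  by rewrite e mulr1; lra.
by rewrite e mulr0; have := pair_energy_mid s ed (t - phi y) (u - phi y) x y; lra.
Qed.

Section lower_bound.
Variables (O : set 'rV[R]_n) (c1 : R).
Hypotheses (mO' : measurable O) (OO : O `<=` ~` Omega) (c10 : 0 <= c1).
Hypothesis near_far : (c1%:E + \int[mu]_(y in ~` Omega `\` O) (kernel p x y)%:E <=
  \int[mu]_(y in O) (kernel p x y)%:E)%E.

(** The factor 2 arises because |phi| is paid twice on [O]: once in |t - phi| >= |t| - |phi|, once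
    for the subtracted energy of [phi]. *)
Definition defect : \bar R := ((2 * cs)%:E * Tail s phi O x +
  lam%:E * \int[mu]_(y in O) (kernel p' x y)%:E)%E.

(* On [O] the energy density is bounded below by its asymptotic cone, which
   beats the possible loss on the far field [~` Omega `\` O]. *)
Lemma ext_energy_lb t : ((cs * c1 * `|t|)%:E <= (ext_energy x t)%:E + defect)%E.
Proof.
(* The added term makes the integrand nonnegative, so the integral over the whole exterior dominates
   the one over [O]. *)
pose w y := ext_diff x t y + cs * `|t| * kernel p x y.
have w0 y : 0 <= w y.
  by have := ext_diff_abs x t y; rewrite ler_norml /w => /andP[]; lra.
have mw : measurable_fun setT (fun y => (w y)%:E).
  apply/measurable_EFinP; apply: measurable_funD; first exact: measurable_ext_diff2.
  by apply: measurable_funM => //; exact: measurable_kernel2.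
have mk q A : measurable_fun A (fun y => (kernel q x y)%:E).
  by apply/measurable_EFinP/measurable_funTS; exact: measurable_kernel2.
have k0 q y : (0 <= (kernel q x y)%:E)%E by rewrite lee_fin kernel_ge0.
have mpk A : measurable_fun A (fun y => (`|phi y| * kernel p x y)%:E).
  apply/measurable_EFinP/measurable_funTS; apply: measurable_funM.
    exact: measurableT_comp.
  exact: measurable_kernel2.
have wint : (\int[mu]_(y in ~` Omega) (w y)%:E = (ext_energy x t + cs * `|t| * K)%:E)%E.
  rewrite /w.
  under eq_integral do rewrite EFinD.
  rewrite integralD//; [|exact: ext_diff_integrable|exact: kernelZ_integrable].
  rewrite EFinD; congr (_ + _)%E.
    by rewrite /ext_energy /Rintegral fineK//; apply: integrable_fin_num => //;
      exact: ext_diff_integrable.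
  under eq_integral do rewrite EFinM.
  rewrite integralZl//; last exact: kernel_integrable.
  by rewrite [RHS]EFinM -KE.
have tp0 : (0 <= Tail s phi O x)%E.
  by apply: integral_ge0 => y _; rewrite lee_fin mulr_ge0// kernel_ge0.
have lam0 := ed_lam_ge0 ed.
(* On [O] the cone bound contributes [cs * |t|] times the kernel and the term added in [w]
   contributes it again. Splitting [K] into its parts over [O] and over the far field then leaves
   [cs * |t|] times their difference, which is at least [c1]. *)
have main : ((2 * cs * `|t|)%:E * \int[mu]_(y in O) (kernel p x y)%:E <=
    (ext_energy x t + cs * `|t| * K)%:E + defect)%E.
  rewrite -wint /defect.
  apply: (@le_trans _ _ (\int[mu]_(y in O) (w y)%:E + ((2 * cs)%:E *
    \int[mu]_(y in O) (`|phi y| * kernel p x y)%:E +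
    lam%:E * \int[mu]_(y in O) (kernel p' x y)%:E))%E); last first.
    rewrite leeD2r//; apply: ge0_subset_integral => //; first exact: measurable_funTS.
    by move=> y _; rewrite lee_fin.
  have pk0 y : (0 <= (`|phi y| * kernel p x y)%:E)%E by rewrite lee_fin mulr_ge0// kernel_ge0.
  have cs20 : 0 <= 2 * cs by rewrite mulr_ge0// ltW.
  have cst0 : 0 <= 2 * cs * `|t| by rewrite mulr_ge0.
  rewrite -!ge0_integralZl_EFin//.
  rewrite -ge0_integralD//; first last.
  - exact: measurable_funeM.
  - by move=> y _; rewrite mule_ge0.
  - exact: measurable_funeM.
  - by move=> y _; rewrite mule_ge0.
  rewrite -ge0_integralD//; first last.
  - by apply: emeasurable_funD; exact: measurable_funeM.
  - by move=> y _; rewrite adde_ge0// mule_ge0.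
  - exact: measurable_funTS.
  - by move=> y _; rewrite lee_fin.
  apply: ge0_le_integral => //.
  - by move=> y _; rewrite mule_ge0.
  - exact: measurable_funeM.
  - apply: emeasurable_funD; first exact: measurable_funTS.
    by apply: emeasurable_funD; exact: measurable_funeM.
  move=> y _; rewrite -!EFinM -!EFinD lee_fin /w /ext_diff.
  have h1 := pair_energy_lb n_ge1 s_gt0 ed (t - phi y) x y.
  have h2 := pair_energy_le s_gt0 ed (phi y) x y.
  have h3 : cs * `|t| * kernel p x y <= cs * (`|t - phi y| + `|phi y|) * kernel p x y.
    rewrite ler_wpM2r ?kernel_ge0// ler_wpM2l ?(ltW cs0)//.
    by rewrite -{1}(subrK (phi y) t) ler_normD.
  lra.
have split : (outer_kernel s Omega x = \int[mu]_(y in O) (kernel p x y)%:E +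
    \int[mu]_(y in ~` Omega `\` O) (kernel p x y)%:E)%E.
  rewrite -ge0_integral_setU//; first by rewrite setDUK.
  - exact: measurableD.
  - by apply/disj_setPS => y [Oy []].
have i0 A : (0 <= \int[mu]_(y in A) (kernel p x y)%:E)%E by exact: integral_ge0.
(* Finiteness of [K] forces both partial kernel integrals to be finite, so the subtraction takes
   place in the reals. *)
move: split main near_far; rewrite KE.
case: (\int[mu]_(y in O) _)%E (i0 O) => [ko|//|//]; last by case: (integral _ _ _) (i0 (~` Omega `\` O)).
case: (\int[mu]_(y in ~` Omega `\` O) _)%E (i0 (~` Omega `\` O)) => [kf|//|//].
rewrite -EFinD => kf0 ko0 [Ks].
have d0 : (0 <= defect)%E.
  have cs20 : 0 <= 2 * cs by rewrite mulr_ge0// ltW.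
  rewrite /defect; apply: adde_ge0; apply: mule_ge0; rewrite ?lee_fin//.
  exact: integral_ge0.
case: defect d0 => [b _|_ _ _|//]; last by rewrite addey// leey.
rewrite -EFinM -!EFinD !lee_fin => main nf.
have : cs * `|t| * (c1 + kf) <= cs * `|t| * ko by rewrite ler_wpM2l// mulr_ge0// ltW.
by move: main; rewrite Ks; lra.
Qed.

End lower_bound.

End at_point.

End exterior_energy.

(** Tonelli for the positive and the negative part; the signed integrand that calls for it is
    [ext_diff]. *)
Lemma measurable_integral_section d1 d2 (T1 : measurableType d1)
    (T2 : measurableType d2) (R : realType)
    (m2 : {sigma_finite_measure set T2 -> \bar R}) (A : set T1) (B : set T2)
    (f : T1 * T2 -> \bar R) : measurable A -> measurable B -> measurable_fun setT f ->
  measurable_fun A (fun x => \int[m2]_(y in B) f (x, y))%E.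
Proof.
move=> mA mB mf.
rewrite (_ : (fun x => _) = (fun x => (\int[m2]_(y in B) f^\+%E (x, y)) -
    \int[m2]_(y in B) f^\-%E (x, y))%E); last first.
  apply/funext => x; rewrite [LHS]integralE; congr (_ - _)%E; apply: eq_integral => y _;
    by rewrite ?funeposE ?funenegE.
apply: emeasurable_funB; apply: measurable_tonelli_setX1 => //.
- exact: measurable_funepos.
- exact: measurable_funeneg.
Qed.

(** * The class [calW] and the density of its seminorm *)

Section sobolev_class.
Context {R : realType} {n : nat} (s : R).
Notation p := (n%:R + s).
Notation mu := (@volume R n).
Variable Omega : set 'rV[R]_n.
Hypothesis oO : open Omega.
Implicit Types u v w : 'rV[R]_n -> R.

Let mO : measurable Omega. Proof. exact: open_measurable_rV. Qed.

Definition jump v (q : 'rV[R]_n * 'rV[R]_n) : R := `|v q.1 - v q.2| * kernel p q.1 q.2.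

Lemma jump_ge0 v q : 0 <= jump v q.
Proof. by rewrite mulr_ge0// kernel_ge0. Qed.

Lemma measurable_jump v : measurable_fun setT v -> measurable_fun setT (jump v).
Proof.
move=> mv; apply: measurable_funM; last exact: measurable_kernel.
apply: measurableT_comp => //; apply: measurable_funB.
  exact: (measurableT_comp mv measurable_fst).
exact: (measurableT_comp mv measurable_snd).
Qed.

Lemma gagliardoE v : measurable_fun setT v ->
  gagliardo s Omega v = (\int[mu \x mu]_(q in Omega `*` Omega) (jump v q)%:E)%E.
Proof.
move=> mv; rewrite (tonelli_setX1 mu mu mO mO)//.
- by apply/measurable_EFinP; exact: measurable_jump.
- by move=> q; rewrite lee_fin jump_ge0.
Qed.

Lemma calWP v : calW s Omega v <-> [/\ measurable_fun setT v,
  (\int[mu]_(x in Omega) (`|v x|)%:E < +oo)%E &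
  (\int[mu \x mu]_(q in Omega `*` Omega) (jump v q)%:E < +oo)%E].
Proof.
have e mv := gagliardoE (v := v) mv.
have a0 : (0 <= \int[mu]_(x in Omega) (`|v x|)%:E)%E by apply: integral_ge0 => x _; rewrite lee_fin.
have b0 : (0 <= \int[mu \x mu]_(q in Omega `*` Omega) (jump v q)%:E)%E.
  by apply: integral_ge0 => q _; rewrite lee_fin jump_ge0.
have eL : L1norm Omega (EFin \o v) = (\int[mu]_(x in Omega) (`|v x|)%:E)%E by [].
split=> [[mv]|[mv v1 v2]].
  rewrite /W1norm e// eL => h; split=> //; apply: le_lt_trans h.
    by rewrite leeDl.
  by rewrite leeDr.
by split=> //; rewrite /W1norm e// eL lte_add_pinfty.
Qed.

Lemma calWB u v (a b : R) : calW s Omega u -> calW s Omega v ->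
  calW s Omega (fun x => a * u x + b * v x).
Proof.
move=> /calWP[mu' u1 u2] /calWP[mv v1 v2]; apply/calWP.
have mw : measurable_fun setT (fun x => a * u x + b * v x).
  by apply: measurable_funD; exact: measurable_funM.
have mn (f : 'rV[R]_n -> R) : measurable_fun setT f -> measurable_fun Omega (fun x => (`|f x|)%:E).
  by move=> mf; apply/measurable_EFinP/measurable_funTS; exact: measurableT_comp.
have mXO : measurable (Omega `*` Omega) by exact: measurableX.
have mj (f : 'rV[R]_n -> R) : measurable_fun setT f ->
    measurable_fun (Omega `*` Omega) (fun q => (jump f q)%:E).
  by move=> mf; apply/measurable_EFinP/measurable_funTS; exact: measurable_jump.
split=> //.
- apply: (@le_lt_trans _ _ (\int[mu]_(x in Omega)
    ((`|a|%:E * (`|u x|)%:E) + (`|b|%:E * (`|v x|)%:E)))%E).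
    apply: ge0_le_integral => //; first exact: mn.
      by apply: emeasurable_funD; apply: measurable_funeM; exact: mn.
    by move=> x _; rewrite lee_fin -!normrM ler_normD.
  rewrite ge0_integralD//; first last.
  - by apply: measurable_funeM; exact: mn.
  - by apply: measurable_funeM; exact: mn.
  rewrite !ge0_integralZl_EFin//; [|exact: mn|exact: mn].
  by apply: lte_add_pinfty; apply: lte_mul_pinfty.
- apply: (@le_lt_trans _ _ (\int[mu \x mu]_(q in Omega `*` Omega)
    ((`|a|%:E * (jump u q)%:E) + (`|b|%:E * (jump v q)%:E)))%E).
    apply: ge0_le_integral => //.
    + by move=> q _; rewrite lee_fin jump_ge0.
    + exact: mj.
    + by apply: emeasurable_funD; apply: measurable_funeM; exact: mj.
    move=> q _; rewrite lee_fin /jump !mulrA -mulrDl ler_wpM2r ?kernel_ge0//.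
    rewrite -!normrM; apply: le_trans (ler_normD _ _); rewrite le_eqVlt; apply/orP; left.
    by apply/eqP; congr (`| _ |); ring.
  rewrite ge0_integralD//; first last.
  - by apply: measurable_funeM; exact: mj.
  - by move=> q _; rewrite mule_ge0// lee_fin jump_ge0.
  - by apply: measurable_funeM; exact: mj.
  - by move=> q _; rewrite mule_ge0// lee_fin jump_ge0.
  rewrite !ge0_integralZl_EFin//; try exact: mj; try by move=> q _; rewrite lee_fin jump_ge0.
  by apply: lte_add_pinfty; apply: lte_mul_pinfty.
Qed.

End sobolev_class.

(** * Absolute convergence of energy differences *)

Section energy_difference.
Context {R : realType} {n : nat} (s : R) (c : R -> R) (cs lam : R).
Hypotheses (n_ge1 : (1 <= n)%N) (s_gt0 : 0 < s) (s_lt1 : s < 1).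
Hypothesis ed : energy_density c cs lam.
Notation p := (n%:R + s).
Notation p' := (n%:R - 1 + s).
Notation mu := (@volume R n).
Notation Phi := (pair_energy c s).
Variable Omega : set 'rV[R]_n.
Hypotheses (oO : open Omega) (bO : bounded_set Omega) (lO : lipschitz_boundary Omega).
Implicit Types (u v w : 'rV[R]_n -> R) (x y : 'rV[R]_n).
Local Open Scope ereal_scope.

Let mO : measurable Omega. Proof. exact: open_measurable_rV. Qed.
Let mCO : measurable (~` Omega). Proof. exact: measurableC. Qed.

Definition energy_at v (q : 'rV[R]_n * 'rV[R]_n) : R := Phi (v q.1 - v q.2)%R q.1 q.2.

Lemma energy_atC v x y : energy_at v (x, y) = energy_at v (y, x).
Proof. by rewrite /energy_at/= -opprB (pair_energyN s ed) (pair_energyC). Qed.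

Lemma measurable_energy_at v : measurable_fun setT v -> measurable_fun setT (energy_at v).
Proof.
move=> mv; apply: (measurable_pair_energy s ed (f := fun q => v q.1 - v q.2)%R).
apply: measurable_funB.
  exact: (measurableT_comp mv measurable_fst).
exact: (measurableT_comp mv measurable_snd).
Qed.

Lemma Qset_decomp : Qset Omega =
  (Omega `*` Omega) `|` ((Omega `*` ~` Omega) `|` (~` Omega `*` Omega)).
Proof.
apply/seteqP; split=> [[x y] /= h|[x y] /=].
  have [Ox|nOx] := pselect (Omega x); have [Oy|nOy] := pselect (Omega y).
  - by left.
  - by right; left.
  - by right; right.
  - by exfalso; apply: h.
by case=> [[Ox Oy] []|[[Ox nOy] []|[nOx Oy] []]].
Qed.

Lemma measurable_Qset : measurable (Qset Omega).
Proof. by apply: measurableC; exact: measurableX. Qed.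

Lemma jumpC v x y : jump s v (x, y) = jump s v (y, x).
Proof. by rewrite /jump/= distrC kernelC. Qed.

Section cross.
Variable v : 'rV[R]_n -> R.
Hypotheses (Wv : calW s Omega v) (v0 : {ae mu, forall x, (~` Omega) x -> v x = 0%R}).

Let mv : measurable_fun setT v. Proof. by case: Wv. Qed.

Let mj : measurable_fun setT (fun q => (jump s v q)%:E).
Proof. by apply/measurable_EFinP; exact: measurable_jump. Qed.

Let cross_inner x : \int[mu]_(y in ~` Omega) (jump s v (x, y))%:E =
  (`|v x|)%:E * outer_kernel s Omega x.
Proof.
rewrite /outer_kernel -ge0_integralZl_EFin//; last 2 first.
- by move=> y _; rewrite lee_fin kernel_ge0.
- by apply/measurable_EFinP/measurable_funTS; exact: measurable_kernel2.
apply: ge0_ae_eq_integral => //.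
- by apply: measurable_funTS; exact: (measurableT_comp mj (measurable_pair1 x)).
- apply: measurable_funeM; apply/measurable_EFinP/measurable_funTS.
  exact: measurable_kernel2.
- by move=> y _; rewrite lee_fin jump_ge0.
- by move=> y _; rewrite mule_ge0// lee_fin kernel_ge0.
by apply: filterS v0 => y vy nOy; rewrite /jump/= vy// subr0 EFinM.
Qed.

(** As [v] vanishes outside, the inner integral of the jump over the exterior is |v x| times the
    outer kernel, which is the integrand of [hardy]. *)
Lemma cross_lty : \int[mu \x mu]_(q in Omega `*` ~` Omega) (jump s v q)%:E < +oo /\
  \int[mu \x mu]_(q in ~` Omega `*` Omega) (jump s v q)%:E < +oo.
Proof.
have [_ v1 v2] := (calWP s oO v).1 Wv.
have j0 q : 0 <= (jump s v q)%:E by rewrite lee_fin jump_ge0.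
have h := hardy n_ge1 s_gt0 s_lt1 oO bO lO mv v1 v2.
have h' : \int[mu]_(x in Omega) (\int[mu]_(y in ~` Omega) (jump s v (x, y))%:E) < +oo.
  by under eq_integral do rewrite cross_inner.
split; first by rewrite (tonelli_setX1 mu mu mO mCO mj j0).
rewrite (tonelli_setX2 mu mu mCO mO mj j0).
by under eq_integral do under eq_integral do rewrite jumpC.
Qed.

Lemma jump_Qset_lty : \int[mu \x mu]_(q in Qset Omega) (jump s v q)%:E < +oo.
Proof.
have [_ _ v2] := (calWP s oO v).1 Wv.
have [c1 c2] := cross_lty.
have mXX := measurableX mO mO; have mXC := measurableX mO mCO.
have mCX := measurableX mCO mO.
have j0 q : 0 <= (jump s v q)%:E by rewrite lee_fin jump_ge0.
rewrite Qset_decomp ge0_integral_setU//; last 3 first.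
- exact: measurableU.
- exact: measurable_funTS.
- by apply/disj_setPS => -[x y] [[/= Ox Oy] [[_ nOy]|[nOx _]]].
rewrite ge0_integral_setU//; last 2 first.
- exact: measurable_funTS.
- by apply/disj_setPS => -[x y] [[/= Ox Oy] [nOx _]].
by apply: lte_add_pinfty => //; exact: lte_add_pinfty.
Qed.

End cross.

Section difference.
Variables u v : 'rV[R]_n -> R.
Hypotheses (Wu : calW s Omega u) (Wv : calW s Omega v).
Hypothesis uv : {ae mu, forall x, (~` Omega) x -> v x = u x}.

Let mu' : measurable_fun setT u. Proof. by case: Wu. Qed.
Let mv : measurable_fun setT v. Proof. by case: Wv. Qed.

(** By the Lipschitz bound the difference is at most [cs] times the jump of [h = u - v]. Since [h]
    vanishes outside [Omega], its jump is integrable over the whole of [Qset Omega], whatever the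
    common exterior values are. *)
Lemma energy_at_diff_integrable : (mu \x mu).-integrable (Qset Omega)
  (EFin \o (fun q => energy_at u q - energy_at v q)%R).
Proof.
pose h x := (1 * u x + -1 * v x)%R.
have Wh : calW s Omega h by exact: calWB.
have h0 : {ae mu, forall x, (~` Omega) x -> h x = 0%R}.
  by apply: filterS uv => x vu nOx; rewrite /h vu// mul1r mulN1r subrr.
have mh : measurable_fun setT h by case: Wh.
have jint : (mu \x mu).-integrable (Qset Omega) (EFin \o jump s h).
  apply/integrableP; split.
    by apply/measurable_EFinP/measurable_funTS; exact: measurable_jump.
  under eq_integral do rewrite /= ger0_norm ?jump_ge0//.
  exact: jump_Qset_lty.
apply: le_integrable (integrableZl measurable_Qset cs jint) => //.
- exact: measurable_Qset.
- apply/measurable_EFinP/measurable_funTS; apply: measurable_funB;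
  exact: measurable_energy_at.
move=> [x y] _ /=; rewrite lee_fin /energy_at/=.
apply: le_trans (pair_energy_lip s_gt0 ed _ _ _ _) _; apply: le_trans (ler_norm _).
rewrite -mulrA ler_wpM2l ?(ltW (ed_slope_gt0 ed))// /jump/= ler_wpM2r ?kernel_ge0//.
by rewrite /h !mul1r !mulN1r le_eqVlt; apply/orP; left; apply/eqP; congr (`| _ |)%R; ring.
Qed.

End difference.

End energy_difference.

(** * The total energy *)

Section functional.
Context {R : realType} {n : nat} (s : R) (c : R -> R) (cs lam : R).
Hypotheses (n_ge1 : (1 <= n)%N) (s_gt0 : 0 < s) (s_lt1 : s < 1).
Hypothesis ed : energy_density c cs lam.
Notation p := (n%:R + s).
Notation p' := (n%:R - 1 + s).
Notation mu := (@volume R n).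
Variables (Omega : set 'rV[R]_n) (phi : 'rV[R]_n -> R).
Hypotheses (oO : open Omega) (bO : bounded_set Omega) (lO : lipschitz_boundary Omega).
Hypothesis mphi : measurable_fun setT phi.
Variables (O : set 'rV[R]_n) (c1 : R).
Hypotheses (mO' : measurable O) (OO : O `<=` ~` Omega) (c10 : 0 < c1).
Local Open Scope ereal_scope.
Hypothesis near_far : forall x, Omega x ->
  c1%:E + \int[mu]_(y in ~` Omega `\` O) (kernel p x y)%:E <=
  \int[mu]_(y in O) (kernel p x y)%:E.
Notation ext := (ext_energy s c Omega phi).
Notation b := (fun x => defect s cs lam phi x O).
Hypothesis b_lty : \int[mu]_(x in Omega) b x < +oo.
Implicit Types (u v w : 'rV[R]_n -> R) (x y : 'rV[R]_n).

Let mO : measurable Omega. Proof. exact: open_measurable_rV. Qed.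
Let mCO : measurable (~` Omega). Proof. exact: measurableC. Qed.
Let mOO : measurable (Omega `*` Omega). Proof. exact: measurableX. Qed.
Let cs0 : (0 < cs)%R. Proof. exact: ed_slope_gt0 ed. Qed.

(* [defect] makes the density nonnegative; being independent of [v], it cancels in
   the differences of [total_energy]. *)
Definition ext_density v x : \bar R := (ext x (v x))%:E + b x.

(** The factor 2 accounts for the two mixed rectangles of [Qset Omega], which carry equal energy by
    symmetry. *)
Definition total_energy v : \bar R :=
  \int[mu \x mu]_(q in Omega `*` Omega) (energy_at s c v q)%:E +
  2%:E * \int[mu]_(x in Omega) ext_density v x.

Lemma ext_energyE x t : Omega x ->
  (ext x t)%:E = \int[mu]_(y in ~` Omega) (ext_diff s c phi x t y)%:E.
Proof.
move=> Ox; rewrite /ext_energy /Rintegral fineK//.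
by apply: integrable_fin_num => //; exact: (ext_diff_integrable s_gt0 ed oO mphi Ox).
Qed.

Lemma measurable_ext_energy v : measurable_fun setT v ->
  measurable_fun Omega (fun x => (ext x (v x))%:E).
Proof.
move=> mv; apply: (eq_measurable_fun
  (fun x => \int[mu]_(y in ~` Omega) (ext_diff s c phi x (v x) y)%:E)).
  by move=> x /set_mem Ox; rewrite ext_energyE.
apply: (measurable_integral_section mu (f := fun q => (ext_diff s c phi q.1 (v q.1) q.2)%:E)) => //.
by apply/measurable_EFinP; exact: (measurable_ext_diff s ed mphi).
Qed.

Lemma measurable_defect : measurable_fun Omega b.
Proof.
apply: emeasurable_funD; apply: measurable_funeM.
  apply: (measurable_integral_section mu (f := fun q => (`|phi q.2| * kernel p q.1 q.2)%:E)) => //.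
  apply/measurable_EFinP; apply: measurable_funM; last exact: measurable_kernel.
  by apply: measurableT_comp => //; exact: (measurableT_comp mphi measurable_snd).
apply: (measurable_integral_section mu (f := fun q => (kernel p' q.1 q.2)%:E)) => //.
by apply/measurable_EFinP; exact: measurable_kernel.
Qed.

Lemma measurable_ext_density v : measurable_fun setT v ->
  measurable_fun Omega (ext_density v).
Proof.
move=> mv; apply: emeasurable_funD; first exact: measurable_ext_energy.
exact: measurable_defect.
Qed.

Lemma defect_ge0 x : 0 <= b x.
Proof.
have lam0 := ed_lam_ge0 ed.
have cs20 : (0 <= 2 * cs)%R by rewrite mulr_ge0// ltW.
rewrite /defect; apply: adde_ge0; apply: mule_ge0; rewrite ?lee_fin//.
  by apply: integral_ge0 => y _; rewrite lee_fin mulr_ge0// kernel_ge0.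
by apply: integral_ge0 => y _; rewrite lee_fin kernel_ge0.
Qed.

Lemma ext_density_lb v x : Omega x -> (cs * c1 * `|v x|)%:E <= ext_density v x.
Proof.
by move=> Ox; exact: (ext_energy_lb n_ge1 s_gt0 ed oO mphi Ox mO' OO (near_far Ox)).
Qed.

Lemma ext_density_ge0 v x : Omega x -> 0 <= ext_density v x.
Proof.
move=> Ox; apply: le_trans (ext_density_lb v Ox).
by rewrite lee_fin !mulr_ge0// ltW.
Qed.

Lemma defect_integrable : mu.-integrable Omega b.
Proof.
apply/integrableP; split; first exact: measurable_defect.
by under eq_integral do rewrite gee0_abs ?defect_ge0//.
Qed.

Section finite_energy.
Variable v : 'rV[R]_n -> R.
Hypothesis Wv : calW s Omega v.

Let mv : measurable_fun setT v. Proof. by case: Wv. Qed.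

(** The Lipschitz bound from the value 0, where [ext] vanishes, dominates it by [cs] times the
    integrand of [hardy]. *)
Lemma ext_energy_integrable : mu.-integrable Omega (fun x => (ext x (v x))%:E).
Proof.
have [_ v1 v2] := (calWP s oO v).1 Wv.
have mK := measurable_outer_kernel s oO mO.
have hK : mu.-integrable Omega (fun x => (`|v x|)%:E * outer_kernel s Omega x).
  apply/integrableP; split.
    apply: emeasurable_funM => //; apply/measurable_EFinP/measurable_funTS.
    exact: measurableT_comp.
  rewrite (eq_integral (fun x => (`|v x|)%:E * outer_kernel s Omega x)).
    exact: hardy.
  by move=> x _; rewrite gee0_abs// mule_ge0// outer_kernel_ge0.
apply: le_integrable (integrableZl mO cs hK) => //; first exact: measurable_ext_energy.
move=> x Ox /=.
have := ext_energy_lip s_gt0 ed oO mphi Ox (v x) 0.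
rewrite (ext_energy0 s ed phi oO) !subr0 => h.
rewrite gee0_abs ?mule_ge0 ?lee_fin ?outer_kernel_ge0 ?(ltW cs0)//.
rewrite muleA -EFinM -[outer_kernel _ _ _]fineK ?lee_fin//.
by rewrite ge0_fin_numE ?outer_kernel_ge0// (outer_kernel_lty s_gt0 oO Ox).
Qed.

Lemma energy_at_integrable :
  (mu \x mu).-integrable (Omega `*` Omega) (EFin \o energy_at s c v).
Proof.
have [_ v1 v2] := (calWP s oO v).1 Wv.
have jint : (mu \x mu).-integrable (Omega `*` Omega) (EFin \o jump s v).
  apply/integrableP; split.
    by apply/measurable_EFinP/measurable_funTS; exact: measurable_jump.
  by under eq_integral do rewrite /= ger0_norm ?jump_ge0//.
apply: le_integrable (integrableZl mOO cs jint) => //.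
  by apply/measurable_EFinP/measurable_funTS; exact: (measurable_energy_at s ed).
move=> [x y] _ /=; rewrite lee_fin ger0_norm; last exact: (pair_energy_ge0 s ed).
apply: le_trans (ler_norm _); rewrite mulrA.
exact: (pair_energy_le s_gt0 ed).
Qed.

Lemma total_energyE : total_energy v =
  \int[mu \x mu]_(q in Omega `*` Omega) (energy_at s c v q)%:E +
  2%:E * (\int[mu]_(x in Omega) (ext x (v x))%:E + \int[mu]_(x in Omega) b x).
Proof.
rewrite /total_energy integralD//; first exact: ext_energy_integrable.
exact: defect_integrable.
Qed.

Lemma total_energy_fin : total_energy v \is a fin_num.
Proof.
have i1 : \int[mu \x mu]_(q in Omega `*` Omega) (energy_at s c v q)%:E \is a fin_num.
  exact: (integrable_fin_num mOO energy_at_integrable).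
have i2 : \int[mu]_(x in Omega) (ext x (v x))%:E \is a fin_num.
  exact: (integrable_fin_num mO ext_energy_integrable).
have i3 : \int[mu]_(x in Omega) b x \is a fin_num.
  exact: (integrable_fin_num mO defect_integrable).
by rewrite total_energyE fin_numD i1 fin_numM// fin_numD i2.
Qed.

End finite_energy.

Section identity.
Variables u v : 'rV[R]_n -> R.
Hypotheses (Wu : calW_ext s Omega phi u) (Wv : calW_ext s Omega phi v).

Let vu : {ae mu, forall x, (~` Omega) x -> v x = u x}.
Proof.
case: Wu => _ uphi; case: Wv => _ vphi.
by apply: filterS2 uphi vphi => x ux vx nOx; rewrite ux// vx.
Qed.

Let f q : R := (energy_at s c u q - energy_at s c v q)%R.

Let fint := energy_at_diff_integrable n_ge1 s_gt0 s_lt1 ed oO bO lO Wu.1 Wv.1 vu.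

Let mXC : measurable (Omega `*` ~` Omega). Proof. exact: measurableX. Qed.
Let mCX : measurable (~` Omega `*` Omega). Proof. exact: measurableX. Qed.

Let mf : measurable_fun setT (EFin \o f).
Proof.
apply/measurable_EFinP; apply: measurable_funB; apply: (measurable_energy_at s ed).
  by case: Wu => -[].
by case: Wv => -[].
Qed.

Let inner x : Omega x -> \int[mu]_(y in ~` Omega) (f (x, y))%:E =
  (ext x (u x))%:E - (ext x (v x))%:E.
Proof.
move=> Ox; have intu := ext_diff_integrable s_gt0 ed oO mphi Ox (u x).
have intv := ext_diff_integrable s_gt0 ed oO mphi Ox (v x).
rewrite (ext_energyE (u x) Ox) (ext_energyE (v x) Ox) -(integralB mCO intu intv).
apply: ae_eq_integral.
- exact: mCO.
- by apply: measurable_funTS; exact: (measurableT_comp mf (measurable_pair1 x)).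
- exact: measurable_int (integrableB mCO intu intv).
case: Wu => _ uphi; case: Wv => _ vphi.
apply: filterS2 uphi vphi => y uy vy nOy.
rewrite /f /energy_at/= uy// vy// -EFinB; congr (_%:E).
by rewrite /ext_diff; ring.
Qed.

(** The three rectangles of [Qset Omega] are integrated separately. The integrand is signed, so the
    mixed ones use Fubini, justified by [fint]; the normalising energy of [phi] and the defect
    cancel between [u] and [v]. *)
Lemma total_energy_diff : \int[mu \x mu]_(q in Qset Omega) (f q)%:E =
  total_energy u - total_energy v.
Proof.
have iu := ext_energy_integrable Wu.1; have iv := ext_energy_integrable Wv.1.
have iouter : \int[mu]_(x in Omega) (\int[mu]_(y in ~` Omega) (f (x, y))%:E) =
    \int[mu]_(x in Omega) (ext x (u x))%:E - \int[mu]_(x in Omega) (ext x (v x))%:E.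
  rewrite -integralB//; apply: eq_integral => x /set_mem Ox; exact: inner.
have sub1 : Omega `*` Omega `<=` Qset Omega by rewrite Qset_decomp => q; left.
have sub2 : Omega `*` ~` Omega `<=` Qset Omega by rewrite Qset_decomp => q; right; left.
have sub3 : ~` Omega `*` Omega `<=` Qset Omega by rewrite Qset_decomp => q; right; right.
have mQ := measurable_Qset oO.
have E1 : \int[mu \x mu]_(q in Omega `*` ~` Omega) (f q)%:E =
    \int[mu]_(x in Omega) (ext x (u x))%:E - \int[mu]_(x in Omega) (ext x (v x))%:E.
  by apply: etrans iouter; exact: (fubini_setX1 mO mCO (integrableS mQ mXC sub2 fint)).
have E2 : \int[mu \x mu]_(q in ~` Omega `*` Omega) (f q)%:E =
    \int[mu]_(x in Omega) (ext x (u x))%:E - \int[mu]_(x in Omega) (ext x (v x))%:E.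
  apply: etrans iouter.
  apply: etrans (fubini_setX2 mCO mO (integrableS mQ mCX sub3 fint)) _.
  apply: eq_integral => x _; apply: eq_integral => y _.
  by rewrite /= (energy_atC s ed u) (energy_atC s ed v).
have E0 : \int[mu \x mu]_(q in Omega `*` Omega) (f q)%:E =
    \int[mu \x mu]_(q in Omega `*` Omega) (energy_at s c u q)%:E -
    \int[mu \x mu]_(q in Omega `*` Omega) (energy_at s c v q)%:E.
  exact: (integralB mOO (energy_at_integrable Wu.1) (energy_at_integrable Wv.1)).
have EQ : \int[mu \x mu]_(q in Qset Omega) (f q)%:E =
    \int[mu \x mu]_(q in Omega `*` Omega) (f q)%:E +
    (\int[mu \x mu]_(q in Omega `*` ~` Omega) (f q)%:E +
     \int[mu \x mu]_(q in ~` Omega `*` Omega) (f q)%:E).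
  have d1 : [disjoint Omega `*` ~` Omega & ~` Omega `*` Omega].
    by apply/disj_setPS => -[x y] [[/= Ox Oy] [nOx _]].
  have d2 : [disjoint Omega `*` Omega & Omega `*` ~` Omega `|` ~` Omega `*` Omega].
    by apply/disj_setPS => -[x y] [[/= Ox Oy] [[_ nOy]|[nOx _]]].
  have mfD D : measurable_fun D (EFin \o f) by exact: measurable_funTS.
  have mXCU := measurableU _ _ mXC mCX.
  rewrite Qset_decomp.
  have h1 := integral_setU (mu \x mu) mXC mCX (mfD _) d1.
  have h2 := integral_setU (mu \x mu) mOO mXCU (mfD _) d2.
  by apply: etrans h2 _; congr (_ + _); exact: h1.
have Au := integrable_fin_num mOO (energy_at_integrable Wu.1).
have Av := integrable_fin_num mOO (energy_at_integrable Wv.1).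
have Hu := integrable_fin_num mO iu; have Hv := integrable_fin_num mO iv.
have Bf := integrable_fin_num mO defect_integrable.
rewrite EQ E0 E1 E2 (total_energyE Wu.1) (total_energyE Wv.1).
move: Au Av Hu Hv Bf => /=.
case: (\int[_]_(q in _) _) => [a1|//|//] _; case: (\int[_]_(q in _) _) => [a2|//|//] _.
case: (\int[_]_(q in _) _) => [a3|//|//] _; case: (\int[_]_(q in _) _) => [a4|//|//] _.
case: (\int[_]_(q in _) _) => [a5|//|//] _.
by rewrite -?(EFinM, EFinD, EFinN); congr (_%:E); ring.
Qed.

End identity.

End functional.

(** Adds the inner and the exterior midpoint inequality with the weights of [total_energy]; the
    terms may be infinite, so distributivity rests on their signs. *)
Lemma half_sum {R : realType} (a1 a2 a3 d1 d2 d3 g : \bar R) (k : R) : (0 <= k)%R ->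
  (0 <= a2 -> 0 <= a3 -> 0 <= d1 -> 0 <= d2 -> 0 <= d3 -> 0 <= g ->
  a1 <= (2^-1)%:E * (a2 + a3) -> d1 + k%:E * g <= (2^-1)%:E * (d2 + d3) ->
  a1 + 2%:E * d1 + (2 * k)%:E * g <= (2^-1)%:E * ((a2 + 2%:E * d2) + (a3 + 2%:E * d3)))%E.
Proof.
move=> k0 a20 a30 d10 d20 d30 g0 h1 h2.
have two : (0 <= 2%:E :> \bar R)%E by rewrite lee_fin.
have -> : ((a2 + 2%:E * d2) + (a3 + 2%:E * d3) = (a2 + a3) + 2%:E * (d2 + d3))%E.
  by rewrite ge0_muleDr// addeACA.
rewrite ge0_muleDr ?adde_ge0 ?mule_ge0 ?adde_ge0// muleCA -addeA; apply: leeD => //.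
rewrite EFinM -muleA -ge0_muleDr// ?mule_ge0 ?lee_fin//.
by rewrite lee_wpmul2l.
Qed.

(** * Coercivity and quantitative convexity of the total energy *)

Section energy_bounds.
Context {R : realType} {n : nat} (s : R) (c : R -> R) (cs lam : R).
Hypotheses (n_ge1 : (1 <= n)%N) (s_gt0 : 0 < s) (s_lt1 : s < 1).
Hypothesis ed : energy_density c cs lam.
Notation p := (n%:R + s).
Notation p' := (n%:R - 1 + s).
Notation mu := (@volume R n).
Variables (Omega : set 'rV[R]_n) (phi : 'rV[R]_n -> R).
Hypotheses (oO : open Omega) (mphi : measurable_fun setT phi).
Variables (O : set 'rV[R]_n) (c1 : R).
Hypotheses (mO' : measurable O) (OO : O `<=` ~` Omega) (c10 : 0 < c1).
Local Open Scope ereal_scope.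
Hypothesis near_far : forall x, Omega x ->
  c1%:E + \int[mu]_(y in ~` Omega `\` O) (kernel p x y)%:E <=
  \int[mu]_(y in O) (kernel p x y)%:E.
Notation ext := (ext_energy s c Omega phi).
Notation b := (fun x => defect s cs lam phi x O).
Notation J := (total_energy s c cs lam Omega phi O).
Notation dens := (ext_density s c cs lam Omega phi O).
Implicit Types (u v w : 'rV[R]_n -> R) (x y : 'rV[R]_n).

Let mO : measurable Omega. Proof. exact: open_measurable_rV. Qed.
Let mOO : measurable (Omega `*` Omega). Proof. exact: measurableX. Qed.
Let cs0 : (0 < cs)%R. Proof. exact: ed_slope_gt0 ed. Qed.
Let e0 v q : 0 <= (energy_at s c v q)%:E.
Proof. by rewrite lee_fin (pair_energy_ge0 s ed). Qed.
Let me v D : measurable_fun setT v -> measurable_fun D (fun q => (energy_at s c v q)%:E).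
Proof. by move=> mv; apply/measurable_EFinP/measurable_funTS; exact: (measurable_energy_at s ed). Qed.
Let d0 v x : Omega x -> 0 <= dens v x.
Proof. exact: (ext_density_ge0 n_ge1 s_gt0 ed oO mphi mO' OO c10 near_far). Qed.
Let md v : measurable_fun setT v -> measurable_fun Omega (dens v).
Proof. exact: (measurable_ext_density s_gt0 ed oO mphi mO'). Qed.

Lemma total_energy_ge0 v : 0 <= J v.
Proof.
rewrite /total_energy; apply: adde_ge0; first by apply: integral_ge0 => q _; exact: e0.
by apply: mule_ge0 => //; apply: integral_ge0 => x; exact: d0.
Qed.

(** The cone bound on interior pairs yields the seminorm and the bound on [ext_density] yields the
    L^1 norm. The loss [lam] stays on the right, since extended reals are not subtracted. *)
Lemma total_energy_coercive v : measurable_fun setT v ->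
  cs%:E * \int[mu \x mu]_(q in Omega `*` Omega) (jump s v q)%:E +
  (2 * (cs * c1))%:E * \int[mu]_(x in Omega) (`|v x|)%:E <=
  J v + lam%:E * \int[mu \x mu]_(q in Omega `*` Omega) (kernel p' q.1 q.2)%:E.
Proof.
move=> mv; rewrite addeAC; apply: leeD; last first.
  rewrite EFinM -muleA lee_wpmul2l// -ge0_integralZl_EFin//; last 2 first.
  - by apply/measurable_EFinP/measurable_funTS; exact: measurableT_comp.
  - by rewrite mulr_ge0// ltW.
  apply: ge0_le_integral => //.
  - by move=> x _; rewrite mule_ge0// lee_fin mulr_ge0// ltW.
  - apply: measurable_funeM; apply/measurable_EFinP/measurable_funTS.
    exact: measurableT_comp.
  - exact: md.
  - move=> x Ox; rewrite -EFinM.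
    exact: (ext_density_lb n_ge1 s_gt0 ed oO mphi mO' OO near_far).
have lam0 := ed_lam_ge0 ed.
have mj : measurable_fun (Omega `*` Omega) (fun q => (jump s v q)%:E).
  by apply/measurable_EFinP/measurable_funTS; exact: measurable_jump.
have mk : measurable_fun (Omega `*` Omega) (fun q => (kernel p' q.1 q.2)%:E : \bar R).
  by apply/measurable_EFinP/measurable_funTS; exact: measurable_kernel.
have k0 (q : 'rV[R]_n * 'rV[R]_n) : 0 <= (kernel p' q.1 q.2)%:E.
  by rewrite lee_fin kernel_ge0.
have j0 q : 0 <= (jump s v q)%:E by rewrite lee_fin jump_ge0.
rewrite -!ge0_integralZl_EFin ?(ltW cs0)// -ge0_integralD//; first last.
- exact: measurable_funeM.
- by move=> q _; rewrite mule_ge0.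
- exact: me.
apply: ge0_le_integral => //.
- by move=> q _; rewrite mule_ge0// lee_fin ltW.
- exact: measurable_funeM.
- by apply: emeasurable_funD; [exact: me|exact: measurable_funeM].
move=> [x y] _; rewrite -!EFinM -EFinD lee_fin /jump /energy_at/=.
have := pair_energy_lb n_ge1 s_gt0 ed (v x - v y) x y; lra.
Qed.

Variables (B : set 'rV[R]_n) (M0 D0 : R).
Hypotheses (mB : measurable B) (BO : B `<=` ~` Omega) (B0 : 0 < mu B) (Bfin : mu B < +oo).
Hypothesis phiB : forall y, B y -> (`|phi y| <= M0)%R.
Hypothesis distB : forall x y, Omega x -> B y -> (1 <= enorm (x - y) <= D0)%R.

Definition both_le (M : R) u v : set 'rV[R]_n := [set x | (`|u x| <= M /\ `|v x| <= M)%R].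

Lemma measurable_both_le M u v : measurable_fun setT u -> measurable_fun setT v ->
  measurable (both_le M u v).
Proof.
move=> mu' mv.
have h w : measurable_fun setT w -> measurable [set x | (`|w x| <= M)%R].
  move=> mw; rewrite (_ : [set x | _] = (Num.norm \o w) @^-1` `]-oo, M]).
    by apply: measurable_preimage; [exact: measurableT_comp|exact: measurable_itv].
  by apply/seteqP; split=> x /=; rewrite in_itv.
rewrite (_ : both_le M u v = [set x | (`|u x| <= M)%R] `&` [set x | (`|v x| <= M)%R])//.
by apply: measurableI; exact: h.
Qed.

Definition mid u v x : R := (2^-1 * u x + 2^-1 * v x)%R.

(* The exterior values on [B] are common to [u] and [v], so a gap [u x - v x] at a
   single point already costs energy. *)
Lemma total_energy_mid M : exists2 k, (0 < k)%R & forall u v,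
  measurable_fun setT u -> measurable_fun setT v ->
  J (mid u v) + k%:E * \int[mu]_(x in Omega) (\1_(both_le M u v) x * (u x - v x) ^+ 2)%:E
    <= (2^-1)%:E * (J u + J v).
Proof.
have D00 : (0 < Num.max D0 1)%R by rewrite lt_max ltr01 orbT.
(* On [B] the jumps u x - phi y and v x - phi y are bounded by M + M0. The maximum with 1 only makes
   the distance bound positive. *)
have [k k0 gap] := pair_energy_gap n_ge1 s_gt0 ed (M + M0) D00.
pose beta := fine (mu B).
have beta0 : (0 < beta)%R by rewrite fine_gt0// B0.
exists (2 * (k * beta))%R; first by rewrite !mulr_gt0.
move=> u v mu' mv.
have mm : measurable_fun setT (mid u v).
  by apply: measurable_funD; exact: measurable_funM.
pose g x := (\1_(both_le M u v) x * (u x - v x) ^+ 2)%R.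
have g0 x : (0 <= g x)%R by rewrite mulr_ge0// sqr_ge0.
have mg D : measurable_fun D (fun x => (g x)%:E).
  apply/measurable_EFinP/measurable_funTS; apply: measurable_funM.
    by apply: measurable_indic; exact: measurable_both_le.
  by apply: measurable_funX; exact: measurable_funB.
have midE (t r : R) : (2^-1 * t + 2^-1 * r = (t + r) / 2)%R by field.
have h1 : \int[mu \x mu]_(q in Omega `*` Omega) (energy_at s c (mid u v) q)%:E <=
    (2^-1)%:E * (\int[mu \x mu]_(q in Omega `*` Omega) (energy_at s c u q)%:E +
      \int[mu \x mu]_(q in Omega `*` Omega) (energy_at s c v q)%:E).
  rewrite -ge0_integralD//; [|exact: me|exact: me].
  rewrite -ge0_integralZl_EFin//; last 2 first.
  - by move=> q _; rewrite adde_ge0.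
  - by apply: emeasurable_funD; exact: me.
  apply: ge0_le_integral => //.
  - exact: me.
  - by apply: measurable_funeM; apply: emeasurable_funD; exact: me.
  move=> [x y] _; rewrite -EFinD -EFinM lee_fin /energy_at/=.
  have := pair_energy_mid s ed (u x - u y) (v x - v y) x y.
  have -> : (mid u v x - mid u v y = (u x - u y + (v x - v y)) / 2)%R by rewrite /mid; field.
  lra.
have h2 : \int[mu]_(x in Omega) dens (mid u v) x + (k * beta)%:E * \int[mu]_(x in Omega) (g x)%:E
    <= (2^-1)%:E * (\int[mu]_(x in Omega) dens u x + \int[mu]_(x in Omega) dens v x).
  have kb0 : (0 <= k * beta)%R by rewrite mulr_ge0// ltW.
  have dm0 := d0 (mid u v). have du0 := d0 u. have dv0 := d0 v.
  rewrite -ge0_integralD//; [|exact: md|exact: md].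
  rewrite -!ge0_integralZl_EFin//; last 3 first.
  - by move=> x Ox; rewrite adde_ge0// d0.
  - by apply: emeasurable_funD; exact: md.
  - by move=> x _; rewrite lee_fin.
  rewrite -ge0_integralD//; first last.
  - exact: measurable_funeM.
  - by move=> x _; rewrite mule_ge0// lee_fin.
  - exact: md.
  apply: ge0_le_integral => //.
  - by move=> x Ox; rewrite adde_ge0 ?dm0// mule_ge0// lee_fin.
  - by apply: emeasurable_funD; [exact: md|exact: measurable_funeM].
  - by apply: measurable_funeM; apply: emeasurable_funD; exact: md.
  move=> x Ox; rewrite /ext_density -EFinM.
  have key : (ext x (mid u v x) + k * beta * g x <= (ext x (u x) + ext x (v x)) / 2)%R.
    rewrite /mid midE /g indicE.
    case: (boolP (x \in both_le M u v)) => [/set_mem[ux vx]|_] /=.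
      rewrite mul1r; apply: (ext_energy_gap s_gt0 ed oO mphi Ox mB BO Bfin) => y By.
      have /andP[d1 d2] := distB Ox By.
      have -> : (u x - v x = (u x - phi y) - (v x - phi y))%R by ring.
      apply: gap => //.
      + by rewrite (le_trans (ler_normB _ _))// lerD// phiB.
      + by rewrite (le_trans (ler_normB _ _))// lerD// phiB.
      + by rewrite le_max d2.
    have := ext_energy_gap (k := 0) (t := u x) (u := v x) s_gt0 ed oO mphi Ox measurable0 (sub0set _).
    rewrite measure0 /= !mul0r mulr0 !addr0; apply=> //.
  have := defect_ge0 s ed phi O x.
  (* Where the defect is infinite the right-hand side is [+oo]; elsewhere it cancels, having the
     same value at [u], [v] and their midpoint. *)
  case: (b x) => [r _|_|//]; last by rewrite !addey// gt0_muley ?leey ?lte_fin.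
  by rewrite -!EFinD -EFinM lee_fin; lra.
have D0' w : 0 <= \int[mu]_(x in Omega) dens w x by apply: integral_ge0 => x; exact: d0.
have A0 w : 0 <= \int[mu \x mu]_(q in Omega `*` Omega) (energy_at s c w q)%:E.
  by apply: integral_ge0.
have G0 : 0 <= \int[mu]_(x in Omega) (g x)%:E.
  by apply: integral_ge0 => x _; rewrite lee_fin.
exact: (half_sum (mulr_ge0 (ltW k0) (ltW beta0)) (A0 u) (A0 v) (D0' (mid u v)) (D0' u) (D0' v) G0 h1 h2).
Qed.

End energy_bounds.

(** * The direct method *)

Lemma cvg_summable_steps {R : realType} (u h : R^nat) (H : R) :
  (forall i, 0 < h i) -> (forall m, \sum_(0 <= i < m) h i <= H) ->
  (forall i, h i < 1 -> `|u i - u i.+1| <= h i) -> cvgn u.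
Proof.
move=> h0 hH uh.
have ch : cvgn (series h).
  apply: nondecreasing_is_cvgn.
    apply/nondecreasing_seqP => k; rewrite /series/= big_nat_recr//= lerDl.
    exact: ltW.
  by exists H => _ [m _ <-]; exact: hH.
have := cvg_series_cvg_0 ch.
move/cvgrPdist_lt => /(_ 1 ltr01)[N _ hN].
(* The steps are controlled by [h] only once h < 1, that is from index [N] on; as every [h i] is
   positive, the factor [K] absorbs the finitely many earlier steps. *)
pose K := 1 + \sum_(i < N) `|u i - u i.+1| / h i.
have K1 : 1 <= K.
  by rewrite lerDl; apply: sumr_ge0 => i _; rewrite divr_ge0// ltW.
have dK i : `|u i - u i.+1| <= K * h i.
  have [iN|Ni] := ltnP i N.
    rewrite -ler_pdivrMr//; apply: (@le_trans _ _ (\sum_(i < N) `|u i - u i.+1| / h i)).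
      rewrite (bigD1 (Ordinal iN))//= lerDl; apply: sumr_ge0 => j _.
      by rewrite divr_ge0// ltW.
    by rewrite lerDr.
  have := hN i Ni; rewrite /= sub0r normrN gtr0_norm// => /uh ui.
  by apply: le_trans ui _; rewrite ler_peMl// ltW.
have cd : cvgn [normed series (telescope u)].
  apply: (@series_le_cvg _ (fun i => `|telescope u i|) (fun i => K * h i)) => //.
  - by move=> i; rewrite mulr_ge0// ?(ltW (h0 i))// (le_trans ler01).
  - by move=> i; rewrite /telescope distrC.
  rewrite (_ : series _ = (fun m => K * series h m)).
    by apply: is_cvgM => //; exact: is_cvg_cst.
  by apply/funext => m; rewrite /series/= mulr_sumr.
have := normed_cvg cd; rewrite telescopeK => cu.
rewrite (_ : u = (fun k => (u k - u 0%N) + u 0%N)); last first.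
  by apply/funext => k; rewrite subrK.
by apply: is_cvgD => //; exact: is_cvg_cst.
Qed.

(** Fatou is applied to the interior and the exterior energy separately; superadditivity of the
    lower limit puts them together. Nonnegativity makes the sums of limits well defined. *)
Lemma liminf_add_le {R : realType} (a b : (\bar R)^nat) (A B : \bar R) (m : R) (e : R^nat) :
  (forall i, 0 <= a i)%E -> (forall i, 0 <= b i)%E ->
  (A <= limn_einf a)%E -> (B <= limn_einf b)%E ->
  (forall i, a i + b i <= (m + e i)%:E)%E -> e @ \oo --> 0 -> (A + B <= m%:E)%E.
Proof.
move=> a0 b0 Aa Bb ab e0.
have h0 (f : (\bar R)^nat) : (forall i, 0 <= f i)%E -> forall k, (0 <= einfs f k)%E.
  by move=> f0 k; apply: le_ereal_inf_tmp => _ [i _ <-].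
have hle (f : (\bar R)^nat) k : (einfs f k <= f k)%E.
  by apply: ereal_inf_lbound; exists k => //=.
have l0 (f : (\bar R)^nat) : (forall i, 0 <= f i)%E -> (0 <= limn_einf f)%E.
  by move=> f0; rewrite limn_einf_lim; apply: lime_ge; [exact: is_cvg_einfs|exact: nearW (h0 _ f0)].
apply: (le_trans (leeD Aa Bb)).
have ca : einfs a @ \oo --> limn_einf a by rewrite limn_einf_lim; exact: is_cvg_einfs.
have cb : einfs b @ \oo --> limn_einf b by rewrite limn_einf_lim; exact: is_cvg_einfs.
have cab : (fun k => einfs a k + einfs b k)%E @ \oo --> (limn_einf a + limn_einf b)%E.
  apply: cvgeD => //; apply: ge0_adde_def; rewrite inE; exact: l0.
have cm : (fun k => (m + e k)%:E) @ \oo --> (m%:E : \bar R).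
  apply: cvg_EFin; first exact: nearW.
  by rewrite -[X in _ --> X]addr0; apply: cvgD => //; exact: cvg_cst.
rewrite -(cvg_lim (@ereal_hausdorff R) cab) -(cvg_lim (@ereal_hausdorff R) cm).
apply: lee_lim; [by apply/cvg_ex; eexists; exact: cab|by apply/cvg_ex; eexists; exact: cm|].
by apply: nearW => k; apply: le_trans (ab k); exact: leeD.
Qed.

(** * Almost everywhere convergence from summable gaps *)

Section almost_everywhere_convergence.
Context d (T : measurableType d) (R : realType) (mu : {measure set T -> \bar R}).
Variables (D : set T) (u : (T -> R)^nat) (C : R).
Hypotheses (mD : measurable D) (Dfin : (mu D < +oo)%E).
Hypothesis mu' : forall i, measurable_fun D (u i).
Hypothesis uC : forall i, (\int[mu]_(x in D) (`|u i x|)%:E <= C%:E)%E.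
Let good i : set T := [set x | `|u i x| <= 2 ^+ i /\ `|u i.+1 x| <= 2 ^+ i].
Hypothesis uu : forall i,
  (\int[mu]_(x in D) (\1_(good i) x * (u i x - u i.+1 x) ^+ 2)%:E <= ((4 ^+ i)^-1)%:E)%E.

Let q i x := \1_(good i) x * (u i x - u i.+1 x) ^+ 2.

Let q0 i x : 0 <= q i x. Proof. by rewrite mulr_ge0// sqr_ge0. Qed.

(** The weights balance the two hypotheses: 2^(-i) times the L^1 bound and 2^i times 4^(-i) are both
    of order 2^(-i), so the integrals of the [h i] are summable. Outside [good i] one of the two
    values exceeds 2^i, and the first term alone exceeds 1. *)
Let h i x : R := (2 ^+ i)^-1 * (1 + `|u i x| + `|u i.+1 x|) + 2 ^+ i * q i x.

Let p2 i : 0 < 2 ^+ i :> R. Proof. exact: exprn_gt0. Qed.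

Let h_gt0 i x : 0 < h i x.
Proof.
apply: ltr_wpDr; first by rewrite mulr_ge0// ltW.
by rewrite mulr_gt0 ?invr_gt0// -addrA ltr_wpDr// addr_ge0.
Qed.

Let uh i x : h i x < 1 -> `|u i x - u i.+1 x| <= h i x.
Proof.
move=> h1; set t := `|u i x - u i.+1 x|; set a : R := 2 ^+ i.
have a0 : 0 < a := p2 i.
have g : good i x.
  apply: contrapT => ng; suff : 1 <= h i x by rewrite leNgt h1.
  apply: (@le_trans _ _ (a^-1 * (1 + `|u i x| + `|u i.+1 x|))); last first.
    by rewrite /h lerDl mulr_ge0// ltW.
  rewrite ler_pdivlMl// mulr1.
  have [u1|u1] := leP (`|u i x|) a;
    last by rewrite -addrA [_ + (_ + _)]addrC -addrA ler_wpDr// ?addr_ge0// ltW.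
  have [u2|u2] := leP (`|u i.+1 x|) a; first by exfalso; apply: ng.
  by rewrite ler_wpDl ?addr_ge0// ltW.
rewrite /h /q indicE mem_set// mul1r -[(_ - _) ^+ 2]real_normK ?num_real// -/t -/a.
(* Young's inequality 2t <= a t^2 + 1/a as a completed square: it turns the quadratic gap into a
   bound linear in the step. *)
have : 0 <= a^-1 * (a * t - 1) ^+ 2 by rewrite mulr_ge0 ?sqr_ge0// invr_ge0 ltW.
have -> : a^-1 * (a * t - 1) ^+ 2 = a * t ^+ 2 - 2 * t + a^-1.
  by field; rewrite gt_eqF.
have : 0 <= a * t ^+ 2 by rewrite mulr_ge0 ?sqr_ge0// ltW.
have : 0 <= a^-1 * (`|u i x| + `|u i.+1 x|) by rewrite mulr_ge0 ?addr_ge0// invr_ge0 ltW.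
have : 0 < a^-1 by rewrite invr_gt0.
rewrite -[1 + _ + _]addrA [a^-1 * (1 + _)]mulrDr mulr1; lra.
Qed.

Let mn i : measurable_fun D (fun x => (`|u i x|)%:E).
Proof. by apply/measurable_EFinP; exact: measurableT_comp. Qed.

Let mgood i : measurable (D `&` good i).
Proof.
have hw (w : T -> R) : measurable_fun D w ->
    measurable (D `&` (Num.norm \o w) @^-1` `]-oo, (2 ^+ i : R)]).
  move=> mw; have : measurable_fun D (Num.norm \o w) by exact: measurableT_comp.
  by apply => //; exact: measurable_itv.
rewrite (_ : D `&` good i = (D `&` (Num.norm \o u i) @^-1` `]-oo, 2 ^+ i]) `&`
    (D `&` (Num.norm \o u i.+1) @^-1` `]-oo, 2 ^+ i])).
  by apply: measurableI; exact: hw.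
by apply/seteqP; split=> x; rewrite /good/= !in_itv/=; tauto.
Qed.

Let mq i : measurable_fun D (fun x => (q i x)%:E).
Proof.
apply/measurable_EFinP; apply: measurable_funM; last first.
  by apply: measurable_funX; exact: measurable_funB.
apply: (eq_measurable_fun (\1_(D `&` good i) : T -> R)).
  by move=> x xD; rewrite !indicE in_setI xD.
by apply: measurable_funTS; exact: measurable_indic.
Qed.

Let mh i : measurable_fun D (fun x => (h i x)%:E).
Proof.
have mnorm k : measurable_fun D (fun x => `|u k x|) by exact: measurableT_comp.
apply/measurable_EFinP; apply: measurable_funD; apply: measurable_funM => //.
  by apply: measurable_funD => //; apply: measurable_funD.
by apply/measurable_EFinP; exact: mq.
Qed.

Let H := fine (mu D) + 2 * C + 1.

Let h_int i : (\int[mu]_(x in D) (h i x)%:E <= ((2 ^+ i)^-1 * H)%:E)%E.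
Proof.
have i2 : 0 <= (2 ^+ i)^-1 :> R by rewrite invr_ge0 ltW.
have -> : (fun x => (h i x)%:E) = (fun x =>
    ((2 ^+ i)^-1)%:E * (1%:E + (`|u i x|)%:E + (`|u i.+1 x|)%:E) + (2 ^+ i)%:E * (q i x)%:E)%E.
  by [].
have m1 : measurable_fun D (fun x => 1%:E + (`|u i x|)%:E + (`|u i.+1 x|)%:E)%E.
  by apply: emeasurable_funD => //; apply: emeasurable_funD.
rewrite ge0_integralD//; first last.
- exact: measurable_funeM.
- by move=> x _; rewrite mule_ge0// lee_fin// ltW.
- exact: measurable_funeM.
- by move=> x _; rewrite mule_ge0// -!EFinD lee_fin !addr_ge0.
have u0 x : (0 <= 1%:E + (`|u i x|)%:E + (`|u i.+1 x|)%:E)%E.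
  by rewrite -!EFinD lee_fin !addr_ge0.
have -> := ge0_integralZl_EFin mu mD (fun x _ => u0 x) m1 i2.
have -> := ge0_integralZl_EFin mu mD (fun x _ => q0 i x : (0 <= (q i x)%:E)%E) (mq i) (ltW (p2 i)).
rewrite ge0_integralD//; last 2 first.
- by move=> x _; rewrite -EFinD lee_fin addr_ge0.
- exact: emeasurable_funD.
rewrite ge0_integralD// integral_cst// mul1e -[mu D]fineK ?ge0_fin_numE//.
have -> : (((2 ^+ i)^-1 * H)%:E = ((2 ^+ i)^-1)%:E * ((fine (mu D))%:E + C%:E + C%:E) +
    (2 ^+ i)%:E * ((4 ^+ i)^-1)%:E :> \bar R)%E.
  congr (_%:E).
  have -> : (4 ^+ i : R) = 2 ^+ i * 2 ^+ i by rewrite -exprMn; congr (_ ^+ _); rewrite -natrM.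
  by rewrite /H; field; rewrite gt_eqF.
apply: leeD; last by apply: lee_wpmul2l; [exact: ltW|exact: uu].
apply: lee_wpmul2l; first exact: i2.
by apply: leeD; [apply: leeD|].
Qed.

(* [h i < 1] forces [good i], so that [h i] then bounds the [i]-th step. *)
Lemma ae_convergent : exists S, [/\ measurable S, S `<=` D, mu (D `\` S) = 0 &
  forall x, S x -> cvgn (u ^~ x)].
Proof.
pose F x := (\sum_(0 <= i <oo) (h i x)%:E)%E.
have h0 i x : (0 <= (h i x)%:E)%E by rewrite lee_fin ltW.
have F0 x : (0 <= F x)%E by exact: nneseries_ge0.
have mF : measurable_fun D F by exact: ge0_emeasurable_sum.
have H0 : 0 <= H.
  have : 0 <= C by rewrite -lee_fin; apply: le_trans (uC 0); exact: integral_ge0.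
  by rewrite /H => C0; rewrite !addr_ge0 ?mulr_ge0// fine_ge0.
have Fint : (\int[mu]_(x in D) F x < +oo)%E.
  rewrite integral_nneseries//.
  apply: (@le_lt_trans _ _ (2 * H)%:E); last exact: ltry.
  apply: lime_le; first by apply: is_cvg_nneseries => i _ _; exact: integral_ge0.
  apply: nearW => m.
  apply: (@le_trans _ _ (\sum_(0 <= i < m) ((2 ^+ i)^-1 * H)%:E)%E).
    by apply: lee_sum => i _; exact: h_int.
  rewrite sumEFin lee_fin -mulr_suml ler_wpM2r//.
  have -> : \sum_(0 <= i < m) (2 ^+ i)^-1 = 2 - 2 * (2 ^+ m)^-1 :> R.
    elim: m => [|m IH]; first by rewrite big_nil expr0 invr1; ring.
    by rewrite big_nat_recr//= IH exprS; field; rewrite gt_eqF.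
  by rewrite lerBlDr lerDl mulr_ge0// invr_ge0 ltW.
have Fi : mu.-integrable D F.
  apply/integrableP; split=> //.
  by under eq_integral do rewrite gee0_abs//.
pose S := D `&` [set x | (F x < +oo)%E].
have mS : measurable S by exact: emeasurable_fun_infty_o.
exists S; split=> //; first by move=> x [].
  apply: measure_negligible; first exact: measurableD.
  apply: negligibleS (integrable_ae mD Fi) => x [Dx nS] /= h'; apply: nS; split => //.
  by have := h' Dx; rewrite ge0_fin_numE.
move=> x [Dx Fx]; apply: (@cvg_summable_steps _ (u ^~ x) (h ^~ x) (fine (F x))) => //.
- move=> m; rewrite -lee_fin fineK ?ge0_fin_numE// -sumEFin.
  exact: nneseries_lim_ge.
- by move=> i; exact: uh.
Qed.

End almost_everywhere_convergence.

Lemma cvg_lipschitz {R : realType} (f v : R^nat) (l t K : R) :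
  (forall i, `|f i - l| <= K * `|v i - t|) -> v @ \oo --> t -> f @ \oo --> l.
Proof.
move=> fK vt.
have h : (fun i => K * `|v i - t|) @ \oo --> (0 : R).
  rewrite -(mulr0 K) -(normr0 R) -(subrr t).
  by apply: cvgM; [exact: cvg_cst|apply: cvg_norm; apply: cvgB => //; exact: cvg_cst].
apply/cvgrPdist_lt => e e0; move/cvgrPdist_lt : h => /(_ e e0); apply: filterS => i.
rewrite sub0r normrN => hi; rewrite distrC.
exact: le_lt_trans (fK i) (le_lt_trans (ler_norm _) hi).
Qed.

Lemma limn_einfE {R : realType} (f : (\bar R)^nat) (l : \bar R) :
  f @ \oo --> l -> limn_einf f = l.
Proof.
by move=> fl; rewrite limn_einf_lim; apply: cvg_lim; [exact: ereal_hausdorff|exact: cvg_einfs].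
Qed.

(** * Lower semicontinuity under almost everywhere convergence *)

Section lower_semicontinuity.
Context {R : realType} {n : nat} (s : R) (c : R -> R) (cs lam : R).
Hypotheses (n_ge1 : (1 <= n)%N) (s_gt0 : 0 < s).
Hypothesis ed : energy_density c cs lam.
Notation p := (n%:R + s).
Notation mu := (@volume R n).
Variables (Omega : set 'rV[R]_n) (phi : 'rV[R]_n -> R).
Hypotheses (oO : open Omega) (mphi : measurable_fun setT phi).
Variables (O : set 'rV[R]_n) (c1 : R).
Hypotheses (mO' : measurable O) (OO : O `<=` ~` Omega) (c10 : 0 < c1).
Local Open Scope ereal_scope.
Hypothesis near_far : forall x, Omega x ->
  c1%:E + \int[mu]_(y in ~` Omega `\` O) (kernel p x y)%:E <=
  \int[mu]_(y in O) (kernel p x y)%:E.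
Notation J := (total_energy s c cs lam Omega phi O).
Notation dens := (ext_density s c cs lam Omega phi O).
Implicit Types (u v w : 'rV[R]_n -> R) (x y : 'rV[R]_n).

Let mO : measurable Omega. Proof. exact: open_measurable_rV. Qed.
Let cs0 : (0 < cs)%R. Proof. exact: ed_slope_gt0 ed. Qed.
Let e0 v q : 0 <= (energy_at s c v q)%:E.
Proof. by rewrite lee_fin (pair_energy_ge0 s ed). Qed.
Let me v : measurable_fun setT v -> measurable_fun setT (fun q => (energy_at s c v q)%:E).
Proof. by move=> mv; apply/measurable_EFinP; exact: (measurable_energy_at s ed). Qed.
Let d0 v x : Omega x -> 0 <= dens v x.
Proof. exact: (ext_density_ge0 n_ge1 s_gt0 ed oO mphi mO' OO c10 near_far). Qed.
Let md v : measurable_fun setT v -> measurable_fun Omega (dens v).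
Proof. exact: (measurable_ext_density s_gt0 ed oO mphi mO'). Qed.

Section conull.
Variable S : set 'rV[R]_n.
Hypotheses (mS : measurable S) (SO : S `<=` Omega) (S0 : mu (Omega `\` S) = 0).

Let conullE (f : 'rV[R]_n -> \bar R) : measurable_fun Omega f ->
  (forall x, Omega x -> 0 <= f x) ->
  \int[mu]_(x in Omega) f x = \int[mu]_(x in S) f x.
Proof.
move=> mf f0; have mN := measurableD mO mS.
have := ge0_negligible_integral mN mO mf f0 S0.
by rewrite setDD setIidr.
Qed.

(** Replaces [Omega] by the conull set [S] on which the sequence converges at every point, so that
    Fatou's lemma applies with pointwise limits. *)
Lemma total_energy_conull v : measurable_fun setT v -> J v =
  \int[mu \x mu]_(q in S `*` S) (energy_at s c v q)%:E + \int[mu]_(x in S) (2%:E * dens v x).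
Proof.
move=> mv; have mev := me mv; have mdv := md mv; have e0v := e0 v.
have dS x : S x -> 0 <= dens v x by move=> /SO; exact: d0.
have -> : \int[mu]_(x in S) (2%:E * dens v x) = 2%:E * \int[mu]_(x in S) dens v x.
  by apply: ge0_integralZl_EFin => //; apply: measurable_funS mdv.
rewrite /total_energy; congr (_ + _); last by congr (_ * _); apply: conullE => //; exact: d0.
have mO2 : measurable_fun Omega
    (fun x => \int[mu]_(y in Omega) (energy_at s c v (x, y))%:E).
  exact: (measurable_integral_section mu mO mO mev).
apply: etrans (tonelli_setX1 mu mu mO mO mev e0v) _.
apply: etrans (esym (tonelli_setX1 mu mu mS mS mev e0v)).
apply: etrans (conullE mO2 _) _; first by move=> x _; apply: integral_ge0.
apply: eq_integral => x _; apply: conullE => //.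
by apply: measurable_funTS; exact: (measurableT_comp mev (measurable_pair1 x)).
Qed.

(** Both densities are nonnegative and, at fixed points, Lipschitz in the values of [v], so they
    converge on [S] and Fatou's lemma bounds each integral. *)
Lemma total_energy_lsc (v_ : nat -> 'rV[R]_n -> R) v (m : R) (e : R^nat) :
  (forall i, measurable_fun setT (v_ i)) -> measurable_fun setT v ->
  (forall x, S x -> (v_ ^~ x) @ \oo --> v x) ->
  (forall i, J (v_ i) <= (m + e i)%:E) -> e @ \oo --> 0%R -> J v <= m%:E.
Proof.
move=> mv_ mv cv Jv ce; rewrite (total_energy_conull mv).
apply: (@liminf_add_le _
  (fun i => \int[mu \x mu]_(q in S `*` S) (energy_at s c (v_ i) q)%:E)
  (fun i => \int[mu]_(x in S) (2%:E * dens (v_ i) x)) _ _ m e) => //.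
- by move=> i; apply: integral_ge0.
- by move=> i; apply: integral_ge0 => x Sx; rewrite mule_ge0// d0//; exact: SO.
- have mSS := measurableX mS mS.
  apply: le_trans (fatou (mu \x mu) mSS _ _); last by move=> i q _; exact: e0.
    rewrite le_eqVlt; apply/orP; left; apply/eqP; apply: eq_integral.
    move=> [x y] /set_mem[/= Sx Sy]; apply/esym; apply: limn_einfE.
    apply: cvg_EFin; first exact: nearW.
    apply: (@cvg_lipschitz _ _ (fun i => v_ i x - v_ i y)%R _ (v x - v y)%R (cs * kernel p x y)%R).
      by move=> i; rewrite mulrAC; exact: (pair_energy_lip s_gt0 ed).
    by apply: cvgB; exact: cv.
  by move=> i; exact: measurable_funTS (me (mv_ i)).
- apply: le_trans (fatou mu mS _ _); last first.
  + by move=> i x Sx; rewrite mule_ge0// d0//; exact: SO.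
  + by move=> i; apply: measurable_funeM; exact: measurable_funS (md (mv_ i)).
  rewrite le_eqVlt; apply/orP; left; apply/eqP; apply: eq_integral.
  move=> x /set_mem Sx; apply/esym; apply: limn_einfE.
  apply: cvgeZl => //; rewrite /ext_density.
  have := defect_ge0 s ed phi O x.
  case: (defect _ _ _ _ _ _) => [r _|_|//].
    apply: cvg_EFin; first exact: nearW.
    apply: cvgD; last exact: cvg_cst.
    have Ox := SO Sx.
    apply: (@cvg_lipschitz _ _ (v_ ^~ x) _ (v x) (cs * fine (outer_kernel s Omega x))%R); last exact: cv.
    by move=> i; rewrite mulrAC; exact: (ext_energy_lip s_gt0 ed oO mphi Ox).
  (* Where the defect is infinite the density is constantly [+oo] along the sequence. *)
  by rewrite !addey//; apply: cvg_near_cst; apply: nearW => i; rewrite addey.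
- by move=> i; rewrite -(total_energy_conull (mv_ i)); exact: Jv.
Qed.

End conull.

End lower_semicontinuity.

(** * Existence and uniqueness of a minimizer of the total energy *)

Section direct_method.
Context {R : realType} {n : nat} (s : R) (c : R -> R) (cs lam : R).
Hypotheses (n_ge1 : (1 <= n)%N) (s_gt0 : 0 < s) (s_lt1 : s < 1).
Hypothesis ed : energy_density c cs lam.
Notation p := (n%:R + s).
Notation p' := (n%:R - 1 + s).
Notation mu := (@volume R n).
Variables (Omega : set 'rV[R]_n) (phi : 'rV[R]_n -> R).
Hypotheses (oO : open Omega) (bO : bounded_set Omega) (lO : lipschitz_boundary Omega).
Hypothesis mphi : measurable_fun setT phi.
Variables (O : set 'rV[R]_n) (c1 : R).
Hypotheses (mO' : measurable O) (OO : O `<=` ~` Omega) (c10 : 0 < c1).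
Local Open Scope ereal_scope.
Hypothesis near_far : forall x, Omega x ->
  c1%:E + \int[mu]_(y in ~` Omega `\` O) (kernel p x y)%:E <=
  \int[mu]_(y in O) (kernel p x y)%:E.
Hypothesis b_lty : \int[mu]_(x in Omega) (defect s cs lam phi x O) < +oo.
Hypothesis Ofin : mu Omega < +oo.
Variable K0 : R.
Hypothesis kfin : \int[mu \x mu]_(q in Omega `*` Omega) (kernel p' q.1 q.2)%:E <= K0%:E.
Variables (B : set 'rV[R]_n) (M0 D0 : R).
Hypotheses (mB : measurable B) (BO : B `<=` ~` Omega) (B0 : 0 < mu B) (Bfin : mu B < +oo).
Hypothesis phiB : forall y, B y -> (`|phi y| <= M0)%R.
Hypothesis distB : forall x y, Omega x -> B y -> (1 <= enorm (x - y) <= D0)%R.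
Notation J := (total_energy s c cs lam Omega phi O).
Notation W := (calW_ext s Omega phi).
Implicit Types (u v w : 'rV[R]_n -> R) (x y : 'rV[R]_n).

Let mO : measurable Omega. Proof. exact: open_measurable_rV. Qed.
Let mCO : measurable (~` Omega). Proof. exact: measurableC. Qed.
Let cs0 : (0 < cs)%R. Proof. exact: ed_slope_gt0 ed. Qed.
Let lam0 : (0 <= lam)%R. Proof. exact: ed_lam_ge0 ed. Qed.
Let J0 v : 0 <= J v.
Proof. exact: (total_energy_ge0 n_ge1 s_gt0 ed oO mphi mO' OO c10 near_far). Qed.
Let Jfin v : calW s Omega v -> J v \is a fin_num.
Proof. exact: (total_energy_fin n_ge1 s_gt0 s_lt1 ed oO bO lO mphi mO' b_lty). Qed.
Let mW v : W v -> measurable_fun setT v. Proof. by case=> -[]. Qed.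

Lemma coercive v : measurable_fun setT v ->
  cs%:E * \int[mu \x mu]_(q in Omega `*` Omega) (jump s v q)%:E +
  (2 * (cs * c1))%:E * \int[mu]_(x in Omega) (`|v x|)%:E <= J v + (lam * K0)%:E.
Proof.
move=> mv; apply: le_trans (total_energy_coercive n_ge1 s_gt0 ed oO mphi mO' OO c10 near_far mv) _.
by rewrite leeD2l// EFinM lee_wpmul2l.
Qed.

Lemma calW_extB u v : W u -> W v -> W (mid u v).
Proof.
move=> [Wu uphi] [Wv vphi]; split; first exact: (calWB oO _ _ Wu Wv).
by apply: filterS2 uphi vphi => x ux vx nOx; rewrite /mid ux// vx//; field.
Qed.

Definition zero_extension x : R := phi x * \1_(~` Omega) x.

Let extE x : Omega x -> zero_extension x = 0%R.
Proof. by move=> Ox; rewrite /zero_extension indicE memNset ?mulr0//; apply. Qed.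

Lemma zero_extensionW : W zero_extension.
Proof.
have mv : measurable_fun setT zero_extension.
  by apply: measurable_funM => //; exact: measurable_indic.
split; last first.
  by apply: aeW => x nOx; rewrite /zero_extension indicE mem_set// mulr1.
apply/(calWP s oO); split=> //.
- by rewrite integral0_eq// => x Ox; rewrite extE// normr0.
- by rewrite integral0_eq// => -[x y] [/= Ox Oy]; rewrite /jump/= !extE// subrr normr0 mul0r.
Qed.

(** The interior energy vanishes and so does [ext_energy] at 0, by its normalisation. Only the
    defect remains, and this yields the final bound in terms of the tail. *)
Lemma total_energy_zero_extension :
  J zero_extension = 2%:E * \int[mu]_(x in Omega) (defect s cs lam phi x O).
Proof.
rewrite /total_energy integral0_eq ?add0e; last first.
  by move=> [x y] [/= Ox Oy]; rewrite /energy_at/= !extE// subrr (pair_energy0 s ed).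
congr (_ * _); apply: eq_integral => x /set_mem Ox.
by rewrite /ext_density extE// (ext_energy0 s ed phi oO) add0e.
Qed.

Lemma exists_total_energy_min : exists2 u, W u & forall v, W v -> J u <= J v.
Proof.
pose A := [set fine (J v) | v in W].
have A0 : has_inf A.
  split; first by exists (fine (J zero_extension)); exists zero_extension => //; exact: zero_extensionW.
  by exists 0%R => _ [v Wv <-]; rewrite fine_ge0.
pose m := inf A.
have mJ v : W v -> m%:E <= J v.
  move=> Wv; rewrite -[J v]fineK ?Jfin//; last by case: Wv.
  by rewrite lee_fin; apply: ge_inf; [case: A0|exists v].
have approx (e : R) : (0 < e)%R -> exists v, W v /\ J v <= (m + e)%:E.
  move=> e_gt0; have [_ [v Wv <-] ve] := inf_adherent e_gt0 A0.
  exists v; split=> //; rewrite -[J v]fineK ?Jfin//; last by case: Wv.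
  by rewrite lee_fin ltW.
have /choice[k kP] : forall i, exists k, (0 < k)%R /\ forall u v,
  measurable_fun setT u -> measurable_fun setT v ->
  J (mid u v) + k%:E * \int[mu]_(x in Omega) (\1_(both_le (2 ^+ i) u v) x * (u x - v x) ^+ 2)%:E
    <= (2^-1)%:E * (J u + J v).
  move=> i; have [k] := total_energy_mid n_ge1 s_gt0 ed oO mphi mO' OO c10 near_far
    mB BO B0 Bfin phiB distB (2 ^+ i).
  by exists k.
(* A nonincreasing minorant of the gap constants [k i]. Monotonicity makes [eps i] bound the excess
   of both [u i] and [u i.+1]. *)
pose del i := (\prod_(j < i.+1) Num.min 1 (k j))%R.
have k0 j : (0 < Num.min 1 (k j))%R by rewrite lt_min ltr01 (kP j).1.
have k1 j : (Num.min 1 (k j) <= 1)%R by rewrite ge_min lexx.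
have del0 i : (0 < del i)%R by apply: prodr_gt0 => j _; exact: k0.
have delS i : (del i.+1 <= del i)%R.
  by rewrite /del big_ord_recr/= ler_piMr// ltW// del0.
have delk i : (del i <= k i)%R.
  rewrite /del big_ord_recr/=; apply: (@le_trans _ _ (Num.min 1 (k i))%R).
    rewrite ler_piMl ?(ltW (k0 i))//; apply: Num.Theory.prodr_ile1 => j _.
    by rewrite (ltW (k0 j)) k1.
  by rewrite ge_min lexx orbT.
have del1 i : (del i <= 1)%R by apply: Num.Theory.prodr_ile1 => j _; rewrite (ltW (k0 j)) k1.
pose eps i := (del i / 4 ^+ i)%R.
have four i : (0 < 4 ^+ i :> R)%R by exact: exprn_gt0.
have eps0 i : (0 < eps i)%R by rewrite divr_gt0.
have epsS i : (eps i.+1 <= eps i)%R.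
  rewrite /eps ler_pM ?(ltW (del0 _)) ?invr_ge0 ?(ltW (four _))//.
  by rewrite lef_pV2 ?posrE// exprS ler_peMl ?(ltW (four i))// ler1n.
have /choice[u uP] : forall i, exists v, W v /\ J v <= (m + eps i)%:E.
  by move=> i; exact: approx.
have Wu i := (uP i).1; have mu' i := mW (Wu i).
pose Q i := \int[mu]_(x in Omega) (\1_(both_le (2 ^+ i) (u i) (u i.+1)) x * (u i x - u i.+1 x) ^+ 2)%:E.
have Q0 i : 0 <= Q i by apply: integral_ge0 => x _; rewrite lee_fin mulr_ge0// sqr_ge0.
have Q4 i : Q i <= ((4 ^+ i)^-1)%:E.
  have h := (kP i).2 _ _ (mu' i) (mu' i.+1); rewrite -/(Q i) in h.
  have {}h : m%:E + (k i)%:E * Q i <= (m + eps i)%:E.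
    (* The midpoint is a competitor, so its energy is at least [m] and the gap term is at most
       [eps i]; dividing by [k i >= del i] leaves 4^(-i). *)
    apply: le_trans (leeD2r _ (mJ _ (calW_extB (Wu i) (Wu i.+1)))) _.
    apply: le_trans h _.
    apply: (@le_trans _ _ ((2^-1)%:E * ((m + eps i)%:E + (m + eps i)%:E))).
      apply: lee_wpmul2l => //; apply: leeD; first exact: (uP i).2.
      by apply: le_trans (uP i.+1).2 _; rewrite lee_fin lerD2l.
    by rewrite -EFinD -EFinM lee_fin le_eqVlt; apply/orP; left; apply/eqP; field.
  have ki := (kP i).1.
  move: h; case: (Q i) (Q0 i) => [r r0|_|//]; last by rewrite gt0_muley ?lte_fin// addey.
  rewrite -EFinM -EFinD !lee_fin lerD2l => h.
  rewrite -(ler_pM2l ki); apply: le_trans h _.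
  by rewrite ler_wpM2r ?invr_ge0 ?(ltW (four i)).
have J1 i : J (u i) <= (m + 1)%:E.
  apply: le_trans (uP i).2 _; rewrite lee_fin lerD2l ler_pdivrMr// mul1r.
  by apply: le_trans (del1 i) _; rewrite exprn_ege1// ler1n.
have cc0 : (0 < 2 * (cs * c1))%R by rewrite !mulr_gt0.
have L1 i : \int[mu]_(x in Omega) (`|u i x|)%:E <= ((m + 1 + lam * K0) / (2 * (cs * c1)))%:E.
  rewrite -(@lee_pmul2l _ (2 * (cs * c1))%:E)// ?lte_fin//.
  rewrite -EFinM [X in _ <= X%:E]mulrC divfK ?gt_eqF//.
  have := coercive (mu' i); have := J1 i => h1 h2.
  apply: le_trans (le_trans h2 (leeD2r _ h1)).
  rewrite leeDr// mule_ge0// ?lee_fin ?(ltW cs0)//.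
  by apply: integral_ge0 => q _; rewrite lee_fin jump_ge0.
have [S [mS SO S0 cS]] := ae_convergent mO Ofin (fun i => measurable_funTS (mu' i)) L1 Q4.
(* Equal to [u i] on [S], to [phi] outside [Omega] and to 0 on the null set in between. It converges
   at every point, so the limit is measurable and has exactly the exterior values [phi]. *)
pose w i x := (u i x * \1_S x + phi x * \1_(~` Omega) x)%R.
have wS i x : S x -> w i x = u i x.
  move=> Sx; rewrite /w !indicE mem_set// memNset ?mulr0 ?mulr1 ?addr0//.
  by apply; exact: SO.
have wC i x : ~ S x -> w i x = (phi x * \1_(~` Omega) x)%R.
  by move=> Sx; rewrite /w !indicE memNset// mulr0 add0r.
pose uu x := limn (w ^~ x).
have cw x : (w ^~ x) @ \oo --> uu x.
  have [Sx|Sx] := pselect (S x).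
    rewrite /uu (_ : w ^~ x = u ^~ x); first exact: (cS x Sx).
    by apply/funext => i; exact: wS.
  rewrite /uu (_ : w ^~ x = cst (phi x * \1_(~` Omega) x)%R); first exact: is_cvg_cst.
  by apply/funext => i; exact: wC.
have muu : measurable_fun setT uu.
  apply: (measurable_fun_cvg (h := w)) => [i|x _]; last exact: cw.
  apply: measurable_funD; apply: measurable_funM => //; exact: measurable_indic.
have uuphi x : ~ Omega x -> uu x = phi x.
  move=> Ox; rewrite /uu (_ : w ^~ x = cst (phi x)).
    exact: (cvg_lim (@Rhausdorff R) (cvg_cst _)).
  apply/funext => i; rewrite wC ?indicE ?mem_set ?mulr1//.
  by move=> /SO.
have Jm : J uu <= m%:E.
  apply: (total_energy_lsc n_ge1 s_gt0 ed oO mphi mO' OO c10 near_far mS SO S0 mu' muu _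
    (fun i => (uP i).2)).
    move=> x Sx; rewrite (_ : u ^~ x = w ^~ x); first exact: cw.
    by apply/funext => i; rewrite wS.
  apply: (@squeeze_cvgr _ _ _ _ (cst 0%R) (fun i => 1 * (4^-1) ^+ i)%R).
  - apply: nearW => i; rewrite (ltW (eps0 i)) /= mul1r exprVn /eps.
    by rewrite ler_piMl// invr_ge0 ltW.
  - exact: cvg_cst.
  - by apply: cvg_geometric; rewrite ger0_norm// invf_lt1// ltr1n.
(* Membership in the class comes after the energy bound: lower semicontinuity gives finite energy,
   and coercivity then bounds both parts of the norm. *)
have Wuu : W uu.
  split; last by apply: aeW => x; exact: uuphi.
  have h := le_trans (coercive muu) (leeD2r _ Jm).
  have j0 : 0 <= \int[mu \x mu]_(q in Omega `*` Omega) (jump s uu q)%:E.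
    by apply: integral_ge0 => q _; rewrite lee_fin jump_ge0.
  have i0 : 0 <= \int[mu]_(x in Omega) (`|uu x|)%:E.
    by apply: integral_ge0 => q _; rewrite lee_fin.
  have h1 := le_lt_trans h (ltry _).
  have pos (k' : R) (X : \bar R) : (0 < k')%R -> 0 <= X -> k'%:E * X < +oo -> X < +oo.
    move=> k'0 _; rewrite !ltey; apply: contraNN => /eqP ->.
    by rewrite gt0_muley ?lte_fin.
  apply/(calWP s oO); split=> //.
  - apply: (pos _ _ cc0 i0); apply: le_lt_trans h1.
    by rewrite leeDr// mule_ge0// lee_fin ltW.
  - apply: (pos _ _ cs0 j0); apply: le_lt_trans h1.
    by rewrite leeDl// mule_ge0// lee_fin ltW.
by exists uu; [exact: Wuu|move=> v Wv; exact: le_trans Jm (mJ _ Wv)].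
Qed.

(** The midpoint of two minimizers is a competitor, so the gap term vanishes and [u = v] almost
    everywhere in [Omega] where both are at most 2^i. These countably many levels exhaust
    [Omega]. *)
Lemma total_energy_min_unique u v : W u -> W v ->
  (forall w, W w -> J u <= J w) -> (forall w, W w -> J v <= J w) ->
  {ae mu, forall x, v x = u x}.
Proof.
move=> Wu Wv Ju Jv.
have Juv : J u = J v by apply/le_anti/andP; split; [exact: Ju|exact: Jv].
have fJ : J u \is a fin_num by apply: Jfin; case: Wu.
have mu' := mW Wu; have mv := mW Wv.
have h i : {ae mu, forall x, Omega x -> both_le (2 ^+ i) u v x -> v x = u x}.
  have [k k0 /(_ _ _ mu' mv) hk] := total_energy_mid n_ge1 s_gt0 ed oO mphi mO' OO c10 near_far
    mB BO B0 Bfin phiB distB (2 ^+ i).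
  pose g x := (\1_(both_le (2 ^+ i) u v) x * (u x - v x) ^+ 2)%R.
  have g0 x : (0 <= g x)%R by apply: mulr_ge0; [rewrite indicE ler0n|exact: sqr_ge0].
  have mg : measurable_fun Omega (EFin \o g).
    apply/measurable_EFinP/measurable_funTS; apply: measurable_funM.
      by apply: measurable_indic; exact: measurable_both_le.
    by apply: measurable_funX; exact: measurable_funB.
  have G0 : \int[mu]_(x in Omega) (g x)%:E = 0.
    have := le_trans (leeD2r _ (Ju _ (calW_extB Wu Wv))) hk.
    have : 0 <= \int[mu]_(x in Omega) (g x)%:E by apply: integral_ge0 => x _; rewrite lee_fin.
    rewrite -Juv; case: (J u) fJ => [r _|//|//]; rewrite -/(g).
    case: (\int[_]_(x in _) _) => [t t0|_|//]; last by rewrite gt0_muley ?lte_fin// addey.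
    rewrite -EFinM -!EFinD -EFinM lee_fin => ht.
    have kt : (k * t <= 0)%R by lra.
    congr (_%:E); apply/le_anti/andP; split; first by rewrite -(pmulr_rle0 _ k0).
    by rewrite -lee_fin.
  clear Ju Jv Juv fJ hk.
  have : \int[mu]_(x in Omega) `|(EFin \o g) x| = 0.
    by rewrite -G0; apply: eq_integral => x _; rewrite gee0_abs// lee_fin.
  move/(ae_eq_integral_abs mu mO mg); apply: filterS => x gx Ox bx.
  have /eqP := gx Ox; rewrite /= /g indicE mem_set// mul1r eqe sqrf_eq0 subr_eq0.
  by move/eqP.
case: Wu => _ uphi; case: Wv => _ vphi.
clear Ju Jv Juv fJ; have := ae_foralln h; apply: filterS3 uphi vphi => x ux vx hx.
have [Ox|nOx] := pselect (Omega x); last by rewrite ux// vx.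
pose i := (Num.bound `|u x| + Num.bound `|v x|)%N.
have bi (t : R) (j : nat) : (Num.bound t <= j)%N -> (0 <= t -> t <= 2 ^+ j)%R.
  move=> tj t0; apply: le_trans (ltW (archi_boundP t0)) _.
  by rewrite -natrX ler_nat (leq_trans tj)// ltnW// ltn_expl.
by apply: (hx i Ox); split; apply: bi => //; rewrite /i ?leq_addr ?leq_addl.
Qed.

End direct_method.

(** * The enlargement factor and the theorem *)

Section bounded_domain.
Context {R : realType} {n : nat}.
Hypothesis n_ge1 : (1 <= n)%N.
Notation mu := (@volume R n).
Variable Omega : set 'rV[R]_n.
Hypotheses (oO : open Omega) (bO : bounded_set Omega).
Implicit Types (x y z : 'rV[R]_n).

Lemma bounded_domain_norm : exists2 M : R, 0 < M & forall x, Omega x -> `|x| <= M.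
Proof.
have [M /= [_ hM]] := bO; exists (Num.max M 0 + 1).
  by rewrite ltr_wpDl// le_max lexx orbT.
by move=> x Ox; apply: hM => //; rewrite ltr_pwDr// le_max lexx.
Qed.

Lemma volume_bounded_lty : (mu Omega < +oo)%E.
Proof.
have [M M0 OM] := bounded_domain_norm.
have M1 : 0 < M + 1 by rewrite addr_gt0.
apply: (@le_lt_trans _ _ (mu (ball (0 : 'rV[R]_n) (M + 1)))).
  apply: le_measure; rewrite ?inE; [exact: open_measurable_rV|exact: measurable_rV_ball|].
  by move=> x Ox; rewrite rV_ballE/= sub0r normrN (le_lt_trans (OM x Ox))// ltrDl.
by rewrite volume_ball// ltry.
Qed.

Lemma enorm_le_ediam x y : Omega x -> Omega y -> enorm (x - y) <= ediam Omega.
Proof.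
move=> Ox Oy; have [M M0 OM] := bounded_domain_norm.
apply: ub_le_sup; last by exists (x, y).
exists (n%:R * (M + M)) => _ [[x1 y1] [/= Ox1 Oy1] <-].
apply: le_trans (enorm_le_normr _) _; rewrite ler_wpM2l//.
by apply: le_trans (ler_normB _ _) _; rewrite lerD// OM.
Qed.

Lemma ediam_gt0 x : Omega x -> 0 < ediam Omega.
Proof.
move=> Ox; have [e /= e0 eO] : exists2 e : R, 0 < e & ball x e `<=` Omega.
  by have /nbhs_ballP[e e0 eO] := open_nbhs_nbhs (conj oO Ox); exists e.
pose y := x + const_mx (e / 2).
have Oy : Omega y.
  apply: eO; apply/ball_rVE; split=> // i; rewrite !mxE opprD addrA subrr sub0r normrN.
  by rewrite gtr0_norm ?divr_gt0// ltr_pdivrMr// ltr_pMr// ltr1n.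
apply: lt_le_trans (enorm_le_ediam Oy Ox); apply: lt_le_trans (normr_le_enorm _).
apply: lt_le_trans (coord_le_norm _ (Ordinal n_ge1)).
by rewrite !mxE addrAC subrr add0r normr_gt0 gt_eqF// divr_gt0.
Qed.

Lemma enlargeP rho y : enlarge Omega rho y <-> exists2 z, Omega z & enorm (y - z) < rho.
Proof.
split=> [/ereal_inf_lt[_ [z Oz <-]]|[z Oz yz]].
  by rewrite lte_fin => yz; exists z.
apply: (@le_lt_trans _ _ (enorm (y - z))%:E); last by rewrite lte_fin.
by apply: ereal_inf_lbound; exists z.
Qed.

Lemma measurable_enlarge rho : measurable (enlarge Omega rho).
Proof.
apply: open_measurable_rV.
rewrite (_ : enlarge _ _ = \bigcup_(z in Omega) [set y | enorm (y - z) < rho]); last first.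
  apply/seteqP; split=> y; first by move/enlargeP => [z Oz yz]; exists z.
  by move=> [z Oz yz]; apply/enlargeP; exists z.
apply: bigcup_open => z Oz.
have cz : continuous (fun y : 'rV[R]_n => enorm (y - z)).
  move=> y; apply: (@continuous_comp _ _ _ (fun y => y - z) (@enorm R n)).
    by apply: (@cvgB R 'rV[R]_n _ _ _ id (cst z));
      [exact: nbhs_filter|by move=> A|by apply: cvg_cst; exact: nbhs_filter].
  exact: continuous_enorm.
rewrite (_ : [set y | _] = (fun y => enorm (y - z)) @^-1` [set t | t < rho])//.
by move/continuousP : cz; apply; exact: open_lt.
Qed.

Lemma enlarge_near rho x y : Omega x -> enlarge Omega rho y -> `|x - y| <= ediam Omega + rho.
Proof.
move=> Ox /enlargeP[z Oz yz].
have -> : x - y = (x - z) + (z - y) by rewrite addrA subrK.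
apply: le_trans (ler_normD _ _) _; apply: lerD.
  exact: le_trans (normr_le_enorm _) (enorm_le_ediam Ox Oz).
by apply: le_trans (normr_le_enorm _) _; rewrite enormB ltW.
Qed.

(** If |x| <= M on [Omega], the unit ball about the point with all coordinates M + 2 is at distance
    at least 1 from [Omega]. There [phi] is finite at every point, so some sublevel set of |phi| has
    positive measure. *)
Lemma exists_test_set (phi : 'rV[R]_n -> R) : measurable_fun setT phi ->
  exists (B : set 'rV[R]_n) (M D : R), [/\ measurable B, B `<=` ~` Omega,
    (0 < mu B < +oo)%E, (forall y, B y -> `|phi y| <= M) &
    forall x y, Omega x -> B y -> 1 <= enorm (x - y) <= D].
Proof.
move=> mphi; have [M M0 OM] := bounded_domain_norm.
pose z : 'rV[R]_n := const_mx (M + 2); pose U := ball z 1.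
pose D := n%:R * (M + (`|z| + 1)).
have dU x y : Omega x -> U y -> 1 <= enorm (x - y) <= D.
  move=> Ox Uy; apply/andP; split.
    have /ball_rVE[_ /(_ (Ordinal n_ge1))] := Uy; rewrite mxE => yz.
    apply: le_trans (normr_le_enorm _); apply: le_trans (coord_le_norm _ (Ordinal n_ge1)).
    have := le_trans (coord_le_norm x (Ordinal n_ge1)) (OM x Ox); rewrite !mxE.
    rewrite ler_norml => /andP[x1 x2]; rewrite distrC; apply: le_trans (ler_norm _).
    by move: yz; rewrite ltr_norml => /andP[y1 y2]; lra.
  apply: le_trans (enorm_le_normr _) _; rewrite ler_wpM2l//.
  apply: le_trans (ler_normB _ _) _; apply: lerD; first exact: OM.
  move: Uy; rewrite /U rV_ballE/= => zy; have -> : y = z - (z - y) by rewrite opprB addrC subrK.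
  by apply: le_trans (ler_normB _ _) _; rewrite lerD2l ltW.
have mU : measurable U by exact: measurable_rV_ball.
pose Bk (k : nat) := U `&` [set y | `|phi y| <= k%:R].
have mBk k : measurable (Bk k).
  apply: measurableI => //.
  rewrite (_ : [set y | _] = (Num.norm \o phi) @^-1` `]-oo, k%:R]).
    by apply: measurable_preimage; [exact: measurableT_comp|exact: measurable_itv].
  by apply/seteqP; split=> y /=; rewrite in_itv.
have [k Bk0] : exists k, mu (Bk k) != 0%E.
  apply: contrapT => hk.
  have : mu.-negligible U.
    apply: (@negligibleS _ _ _ mu (\bigcup_k Bk k)).
      move=> y Uy; exists (Num.bound `|phi y|) => //; split=> //=.
      by rewrite ltW// archi_boundP.
    apply: negligible_bigcup => k; exists (Bk k); split=> //.
    by apply: contrapT => /eqP h; apply: hk; exists k.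
  move/(measure_negligible mU) => U0; have := etrans (esym U0) (volume_ball z ltr01) => -[] /esym.
  by apply/eqP; rewrite expf_eq0 gt_eqF ?andbF// pmulrn_lgt0.
exists (Bk k), k%:R, D; split=> //.
- move=> y [Uy _] Oy; have /andP[+ _] := dU y y Oy Uy.
  by apply/negP; rewrite subrr -ltNge (le_lt_trans (enorm_le_normr _))// normr0 mulr0.
- rewrite lt0e Bk0 measure_ge0/=; apply: (@le_lt_trans _ _ (mu U)).
    by apply: le_measure; rewrite ?inE// => y [].
  have -> : mu U = ((1 *+ 2) ^+ n)%:E := volume_ball z ltr01.
  exact: ltry.
- by move=> y [].
- by move=> x y Ox [Uy _]; exact: dU.
Qed.

End bounded_domain.

(* [Theta] is such that the far part of the exterior kernel is at most half of the
   part in the annulus between [d] and [2 n d], where [d = ediam Omega]. *)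
Lemma exists_enlargement_factor {R : realType} (n : nat) (s : R) :
  (1 <= n)%N -> 0 < s -> exists2 Theta : R, 0 < Theta & exists2 a : R, 0 < a &
  forall Omega : set 'rV[R]_n, open Omega -> bounded_set Omega ->
  let O := enlarge Omega (Theta * ediam Omega) `\` Omega in
  forall x, Omega x ->
  ((a * ediam Omega `^ (- s))%:E +
    \int[volume n]_(y in ~` Omega `\` O) (kernel (n%:R + s) x y)%:E <=
  \int[volume n]_(y in O) (kernel (n%:R + s) x y)%:E)%E.
Proof.
move=> n_ge1 s_gt0.
have [c c0 annulus] := kernel_annulus (R := R) n_ge1 s_gt0.
have [C C0 tail] := kernel_tail (n := n) s_gt0.
have n0 : 0 < n%:R :> R by rewrite ltr0n.
(* The second entry gives C t^(-s) <= c/2, so the far field takes at most half of the annulus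
   integral. The first places the annulus, which ends at 2nd, within distance ntd. *)
pose t := Num.max 2 ((2 * C / c) `^ s^-1).
have t2 : 2 <= t by rewrite le_max lexx.
have t0 : 0 < t by exact: lt_le_trans t2.
have q0 : 0 < 2 * C / c by rewrite divr_gt0// mulr_gt0.
have tC : C * t `^ (- s) <= c / 2.
  have : 2 * C / c <= t `^ s.
    have e : ((2 * C / c) `^ s^-1) `^ s = 2 * C / c.
      by rewrite -powRrM mulVf ?(lt0r_neq0 s_gt0)// powRr1// ltW.
    rewrite -[leLHS]e; apply: ge0_ler_powR; rewrite ?nnegrE ?powR_ge0 ?(ltW s_gt0) ?(ltW t0)//.
    by rewrite /t le_max lexx orbT.
  rewrite ler_pdivrMr// => h; have ts : 0 < t `^ s by exact: powR_gt0.
  by rewrite powRN ler_pdivrMr// mulrAC ler_pdivlMr// [C * 2]mulrC [c * _]mulrC.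
(* The extra [n] converts norms: a point at Euclidean distance at least ntd is at sup-norm distance
   at least td, as [kernel_tail] requires. *)
exists (n%:R * t); first by rewrite mulr_gt0.
exists (c / 2); first by rewrite divr_gt0.
move=> Omega oO bO O x Ox.
have d0 := ediam_gt0 n_ge1 oO bO Ox; set d := ediam Omega in O d0 *.
have mO := open_measurable_rV oO.
have mO' : measurable O by apply: measurableD => //; exact: measurable_enlarge.
have near : ((c * d `^ (- s))%:E <= \int[volume n]_(y in O) (kernel (n%:R + s) x y)%:E)%E.
  apply: annulus => // y /= /andP[dy yd]; split.
    apply/enlargeP; exists x => //; rewrite enormB; apply: lt_le_trans yd _.
    by rewrite ler_wpM2r ?(ltW d0)// ler_wpM2l// ltW.
  by move=> Oy; move: dy; rewrite ltNge (enorm_le_ediam bO Ox Oy).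
have far : (\int[volume n]_(y in ~` Omega `\` O) (kernel (n%:R + s) x y)%:E <=
    (C * (t * d) `^ (- s))%:E)%E.
  apply: tail; first exact: mulr_gt0.
    by apply: measurableD => //; exact: measurableC.
  move=> y [nOy nO] /=; rewrite -(ler_pM2l n0); apply: le_trans (enorm_le_normr _).
  rewrite leNgt; apply/negP => xy; apply: nO; split=> //; apply/enlargeP; exists x => //.
  by rewrite enormB -mulrA.
apply: le_trans near; apply: le_trans (leeD2l _ far) _.
rewrite -EFinD lee_fin powRM ?(ltW t0) ?(ltW d0)// mulrA -mulrDl.
rewrite ler_wpM2r ?powR_ge0//; lra.
Qed.

(** * Minimizers of the functional as minimizers of the total energy *)

Section minimizers.
Context {R : realType} {n : nat} (s : R) (g : R -> R) (cs lam : R).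
Hypotheses (n_ge1 : (1 <= n)%N) (s_gt0 : 0 < s) (s_lt1 : s < 1).
Hypothesis ed : energy_density (calG g) cs lam.
Notation p := (n%:R + s).
Notation p' := (n%:R - 1 + s).
Notation mu := (@volume R n).
Variables (Omega : set 'rV[R]_n) (phi : 'rV[R]_n -> R).
Hypotheses (oO : open Omega) (bO : bounded_set Omega) (lO : lipschitz_boundary Omega).
Hypothesis mphi : measurable_fun setT phi.
Variable O : set 'rV[R]_n.
Hypothesis mO' : measurable O.
Local Open Scope ereal_scope.
Hypothesis b_lty : \int[mu]_(x in Omega) (defect s cs lam phi x O) < +oo.
Notation J := (total_energy s (calG g) cs lam Omega phi O).
Notation W := (calW_ext s Omega phi).
Implicit Types (u v w : 'rV[R]_n -> R) (x y : 'rV[R]_n).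

Let energy_diffE u v : energy_diff s g u v =
  (fun q => energy_at s (calG g) u q - energy_at s (calG g) v q)%R.
Proof. by apply/funext => q; rewrite /energy_diff /energy_at /pair_energy mulrBl. Qed.

Let ext_eq u v : W u -> W v -> v = u %[ae mu in ~` Omega].
Proof.
move=> [_ uphi] [_ vphi]; apply: filterS2 uphi vphi => x ux vx nOx.
by rewrite ux// vx.
Qed.

Let ext_trans u v : W u -> calW s Omega v -> v = u %[ae mu in ~` Omega] -> W v.
Proof.
move=> [_ uphi] Wv vu; split=> //; apply: filterS2 uphi vu => x ux vx nOx.
by rewrite vx// ux.
Qed.

Let diff u v : W u -> W v ->
  (\int[mu \x mu]_(q in Qset Omega) (energy_diff s g u v q)%:E <= 0) = (J u <= J v).
Proof.
move=> Wu Wv; have fin := total_energy_fin n_ge1 s_gt0 s_lt1 ed oO bO lO mphi mO' b_lty.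
have -> : \int[mu \x mu]_(q in Qset Omega) (energy_diff s g u v q)%:E = J u - J v.
  rewrite energy_diffE.
  exact: (total_energy_diff n_ge1 s_gt0 s_lt1 ed oO bO lO mphi mO' b_lty Wu Wv).
move: (fin u Wu.1) (fin v Wv.1); case: (J u) => [a|//|//] _; case: (J v) => [b|//|//] _.
by rewrite -EFinB !lee_fin subr_le0.
Qed.

(** By [total_energy_diff] the sign condition on the integral is a comparison of finite total
    energies. The integrability demanded of every competitor is [energy_at_diff_integrable]. *)
Lemma minimizer_withinP u :
  minimizer_within s g Omega phi u <-> W u /\ forall v, W v -> J u <= J v.
Proof.
split=> [[[_ umin] Wu]|[Wu Ju]].
  split; first exact: Wu.
  move=> v Wv; have [_] := umin v Wv.1 (ext_eq Wu Wv).
  by rewrite (diff Wu Wv).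
split; last exact: Wu.
split; first exact: Wu.1.
move=> v Wv vu; have Wv' := ext_trans Wu Wv vu; split; last first.
  by rewrite (diff Wu Wv'); exact: Ju.
rewrite energy_diffE.
exact: (energy_at_diff_integrable n_ge1 s_gt0 s_lt1 ed oO bO lO Wu.1 Wv vu).
Qed.

End minimizers.

(** * Well-posedness on a nonempty domain *)

Section well_posedness.
Context {R : realType} {n : nat} (s : R) (g : R -> R) (cs lam : R).
Hypotheses (n_ge1 : (1 <= n)%N) (s_gt0 : 0 < s) (s_lt1 : s < 1).
Hypothesis ed : energy_density (calG g) cs lam.
Notation p := (n%:R + s).
Notation p' := (n%:R - 1 + s).
Notation mu := (@volume R n).
Variables (Omega : set 'rV[R]_n) (x0 : 'rV[R]_n).
Hypotheses (oO : open Omega) (bO : bounded_set Omega) (lO : lipschitz_boundary Omega).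
Hypothesis Ox0 : Omega x0.
Variables (Theta c1 : R).
Hypotheses (Theta0 : 0 < Theta) (c10 : 0 < c1).
Let O := enlarge Omega (Theta * ediam Omega) `\` Omega.
Local Open Scope ereal_scope.
Hypothesis near_far : forall x, Omega x ->
  c1%:E + \int[mu]_(y in ~` Omega `\` O) (kernel p x y)%:E <=
  \int[mu]_(y in O) (kernel p x y)%:E.

Let cs0 : (0 < cs)%R. Proof. exact: ed_slope_gt0 ed. Qed.
Let lam0 : (0 <= lam)%R. Proof. exact: ed_lam_ge0 ed. Qed.
Let mO : measurable Omega. Proof. exact: open_measurable_rV. Qed.
Let mO' : measurable O.
Proof. by apply: measurableD => //; exact: measurable_enlarge. Qed.
Let OO : O `<=` ~` Omega. Proof. by move=> y []. Qed.

(** Points of [Omega] and of the collar are at distance at most (1 + Theta) diam, so [kernel_near]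
    bounds both inner integrals by one constant; [volume Omega] is finite. *)
Let kernel_bounds : exists2 K0 : R, (0 <= K0)%R &
  \int[mu \x mu]_(q in Omega `*` Omega) (kernel p' q.1 q.2)%:E <= K0%:E /\
  \int[mu]_(x in Omega) (\int[mu]_(y in O) (kernel p' x y)%:E) <= K0%:E.
Proof.
have d0 := ediam_gt0 n_ge1 oO bO Ox0.
have r0 : (0 < ediam Omega + Theta * ediam Omega)%R by rewrite addr_gt0// mulr_gt0.
have [C C0 near] := kernel_near n_ge1 s_gt0 s_lt1 r0.
have fO := volume_bounded_lty oO bO.
have bd (A : set 'rV[R]_n) : measurable A ->
    (forall x y : 'rV[R]_n, Omega x -> A y -> (`|x - y| <= ediam Omega + Theta * ediam Omega)%R) ->
    \int[mu]_(x in Omega) (\int[mu]_(y in A) (kernel p' x y)%:E) <= (C * fine (mu Omega))%:E.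
  move=> mA hA; rewrite EFinM fineK ?ge0_fin_numE//.
  rewrite -integral_cst//; apply: ge0_le_integral => //.
  - by move=> x _; apply: integral_ge0 => y _; rewrite lee_fin kernel_ge0.
  - apply: (measurable_integral_section mu (f := fun q => (kernel p' q.1 q.2)%:E)) => //.
    by apply/measurable_EFinP; exact: measurable_kernel.
  - by move=> x Ox; apply: near => // y Ay; exact: hA.
exists (C * fine (mu Omega))%R; first by rewrite mulr_ge0 ?fine_ge0// ltW.
split.
  rewrite (tonelli_setX1 mu mu mO mO).
  - apply: bd => // x y Ox Oy; apply: le_trans (normr_le_enorm _) _.
    apply: le_trans (enorm_le_ediam bO Ox Oy) _.
    by rewrite lerDl mulr_ge0// ltW.
  - by apply/measurable_EFinP; exact: measurable_kernel.
  - by move=> q; rewrite lee_fin kernel_ge0.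
apply: bd => // x y Ox [Oy _]; exact: enlarge_near.
Qed.

Lemma well_posed : exists C : R, (0 < C)%R /\
  forall phi : 'rV[R]_n -> R, measurable_fun setT phi ->
  mu.-integrable Omega (Tail s phi O) ->
  exists u, [/\ minimizer_within s g Omega phi u,
    (forall v, minimizer_within s g Omega phi v -> {ae mu, forall x, v x = u x}) &
    W1norm s Omega u <= C%:E * (L1norm Omega (Tail s phi O) + 1)].
Proof.
have [K0 K00 [kO kOO]] := kernel_bounds.
have fO := volume_bounded_lty oO bO.
(* [a] is the smaller of the two coercivity constants. With tail norm t, the zero extension has
   energy at most 2(2 cs t + lam K0) and coercivity loses another lam K0; the sum is at most b(t +
   1). *)
pose a := (Num.min cs (2 * (cs * c1)))%R; pose b := (4 * cs + 3 * (lam * K0))%R.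
have cc0 : (0 < 2 * (cs * c1))%R by rewrite !mulr_gt0.
have a0 : (0 < a)%R by rewrite lt_min cs0.
have b0 : (0 < b)%R by rewrite /b ltr_wpDr ?mulr_gt0 ?mulr_ge0.
exists (b / a)%R; split; first exact: divr_gt0.
move=> phi mphi iT; have T0 x : 0 <= Tail s phi O x.
  by apply: integral_ge0 => y _; rewrite lee_fin divr_ge0// powR_ge0.
have fT : \int[mu]_(x in Omega) Tail s phi O x \is a fin_num by exact: integrable_fin_num.
have L1E : L1norm Omega (Tail s phi O) = \int[mu]_(x in Omega) Tail s phi O x.
  by apply: eq_integral => x _; rewrite gee0_abs.
have bE : \int[mu]_(x in Omega) (defect s cs lam phi x O) <=
    (2 * cs * fine (\int[mu]_(x in Omega) Tail s phi O x) + lam * K0)%:E.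
  have mk : measurable_fun Omega (fun x => \int[mu]_(y in O) (kernel p' x y)%:E).
    apply: (measurable_integral_section mu (f := fun q => (kernel p' q.1 q.2)%:E)) => //.
    by apply/measurable_EFinP; exact: measurable_kernel.
  have k0 x : 0 <= \int[mu]_(y in O) (kernel p' x y)%:E.
    by apply: integral_ge0 => y _; rewrite lee_fin kernel_ge0.
  have mT : measurable_fun Omega (Tail s phi O) by exact: measurable_int iT.
  have cs20 : (0 <= 2 * cs)%R by rewrite mulr_ge0// ltW.
  rewrite /defect ge0_integralD//; first last.
  - exact: measurable_funeM.
  - by move=> x _; rewrite mule_ge0.
  - exact: measurable_funeM.
  - by move=> x _; rewrite mule_ge0// lee_fin.
  rewrite EFinD; apply: leeD.
    by rewrite ge0_integralZl_EFin// [X in _ <= X]EFinM fineK.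
  by rewrite ge0_integralZl_EFin// [X in _ <= X]EFinM lee_wpmul2l.
have b_lty := le_lt_trans bE (ltry _).
have [B [M [D [mB BO /andP[B0 Bfin] phiB distB]]]] := exists_test_set n_ge1 bO mphi.
have minP := minimizer_withinP n_ge1 s_gt0 s_lt1 ed oO bO lO mphi mO' b_lty.
have [u Wu Ju] := exists_total_energy_min n_ge1 s_gt0 s_lt1 ed oO bO lO mphi mO' OO c10
  near_far b_lty fO kO mB BO B0 Bfin phiB distB.
exists u; split; first by apply/minP.
  move=> v /minP[Wv Jv].
  exact: (total_energy_min_unique n_ge1 s_gt0 s_lt1 ed oO bO lO mphi mO' OO c10
    near_far b_lty mB BO B0 Bfin phiB distB Wu Wv Ju Jv).
have mu' : measurable_fun setT u by case: Wu => -[].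
have h2 := coercive n_ge1 s_gt0 ed oO mphi mO' OO c10 near_far kO mu'.
have h1 : total_energy s (calG g) cs lam Omega phi O u <=
    2%:E * (2 * cs * fine (\int[mu]_(x in Omega) Tail s phi O x) + lam * K0)%:E.
  apply: le_trans (Ju _ (zero_extensionW s oO mphi)) _.
  by rewrite (total_energy_zero_extension s ed phi oO); apply: lee_wpmul2l.
have {h1}h2 := le_trans h2 (leeD2r _ h1).
rewrite L1E -[X in _ * (X + _)]fineK//.
have t0 : (0 <= fine (\int[mu]_(x in Omega) Tail s phi O x))%R.
  by apply: fine_ge0; exact: integral_ge0.
set t := fine _ in h2 t0 *.
have Gu : gagliardo s Omega u = \int[mu \x mu]_(q in Omega `*` Omega) (jump s u q)%:E.
  exact: gagliardoE.
have j0 : 0 <= gagliardo s Omega u.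
  by rewrite Gu; apply: integral_ge0 => q _; rewrite lee_fin jump_ge0.
have i0 : 0 <= L1norm Omega (EFin \o u) by apply: integral_ge0 => x _; rewrite abse_ge0.
rewrite -(@lee_pmul2l _ a%:E)// ?lte_fin// /W1norm ge0_muleDr//.
have aE : (a * (b / a * (t + 1)) = b * (t + 1))%R by field; rewrite gt_eqF.
rewrite -EFinD -!EFinM aE addeC.
have acs : a%:E * gagliardo s Omega u <= cs%:E * gagliardo s Omega u.
  by apply: lee_wpmul2r => //; rewrite lee_fin /a ge_min lexx.
have acc : a%:E * L1norm Omega (EFin \o u) <=
    (2 * (cs * c1))%:E * \int[mu]_(x in Omega) (`|u x|)%:E.
  by apply: lee_wpmul2r; [exact: i0|rewrite lee_fin /a ge_min lexx orbT].
apply: le_trans (leeD acs acc) _.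
rewrite Gu; apply: le_trans h2 _; rewrite -EFinM -EFinD lee_fin /b.
have l0 : (0 <= lam * K0)%R by exact: mulr_ge0.
have := mulr_ge0 l0 t0; have := cs0; lra.
Qed.

End well_posedness.

Theorem theorem1p3 (R : realType) (n : nat) (s : R) (g : R -> R)
    (n_ge1 : (1 <= n)%N) (s_gt0 : 0 < s) (s_lt1 : s < 1)
    (g_gt0 : forall t, 0 < g t) (g_le1 : forall t, g t <= 1)
    (g_even : forall t, g (- t) = g t) (g_cont : continuous g)
    (g_int : (\int[lebesgue_measure]_t (g t * `|t|)%:E < +oo)%E) :
  exists Theta : R, 0 < Theta /\
  forall Omega : set 'rV[R]_n,
    open Omega -> bounded_set Omega -> lipschitz_boundary Omega ->
  exists C : R, 0 < C /\
  forall phi : 'rV[R]_n -> R,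
    measurable_fun (~` Omega) phi ->
    let T := Tail s phi (enlarge Omega (Theta * ediam Omega) `\` Omega) in
    (volume n).-integrable Omega T ->
  exists u : 'rV[R]_n -> R,
    [/\ minimizer_within s g Omega phi u,
        (forall v, minimizer_within s g Omega phi v -> v = u %[ae volume n]) &
        (W1norm s Omega u <= C%:E * (L1norm Omega T + 1))%E].
Proof.
have [cs [lam ed]] := calG_energy_density g_gt0 g_even g_cont g_int.
have [th th0 [a a0 near_far]] := exists_enlargement_factor (R := R) n_ge1 s_gt0.
exists th; split=> // Omega oO bO lO.
have mO := open_measurable_rV oO; have mCO := measurableC mO.
(* The empty domain has no positive diameter and is settled apart: [Qset Omega] is empty, [phi]
   itself is a minimizer, and the exterior condition determines it almost everywhere. *)
have [[x0 Ox0]|O0] := pselect (exists x, Omega x); last first.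
  have OE : Omega = set0 by apply/seteqP; split=> // x Ox; apply: O0; exists x.
  exists 1; split=> // phi mphi T _; exists phi.
  have Wphi : calW s Omega phi.
    split; first by move: mphi; rewrite OE setC0.
    by rewrite /W1norm /L1norm /gagliardo OE !integral_set0 adde0.
  have Q0 : Qset Omega = set0 by rewrite /Qset OE setC0 setXTT setCT.
  split.
  - split; last by split=> //; apply: aeW.
    split=> // v Wv _; rewrite Q0 integral_set0; split=> //.
    apply/integrableP; split; first exact: measurable_fun_set0.
    by rewrite integral_set0.
  - by move=> v [_ [_]]; rewrite OE setC0.
  - rewrite /W1norm /L1norm /gagliardo OE !integral_set0 add0e mul1e.
    by rewrite add0e.
have d0 := ediam_gt0 n_ge1 oO bO Ox0.
have c10 : 0 < a * ediam Omega `^ (- s) by rewrite mulr_gt0// powR_gt0.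
have [C [C0 wp]] := well_posed n_ge1 s_gt0 s_lt1 ed oO bO lO Ox0 th0 c10 (near_far Omega oO bO).
exists C; split=> // phi mphi T iT.
(* The datum is measurable only outside [Omega]. Its extension by zero is measurable everywhere and
   defines the same tail and the same class of competitors. *)
pose psi := phi \_ (~` Omega).
have mpsi : measurable_fun setT psi := (measurable_restrictT phi mCO).1 mphi.
have psiE x : (~` Omega) x -> psi x = phi x by move=> nOx; rewrite /psi patchE mem_set.
have TE : Tail s psi (enlarge Omega (th * ediam Omega) `\` Omega) = T.
  apply/funext => x; apply: eq_integral => y /set_mem[_ nOy].
  by rewrite psiE.
have WE : calW_ext s Omega psi = calW_ext s Omega phi.
  apply/seteqP; split=> v [Wv vphi]; split=> //; apply: filterS vphi => x vx nOx.
    by rewrite vx// psiE.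
  by rewrite vx// psiE.
have := wp psi mpsi; rewrite TE /minimizer_within WE => /(_ iT)[u [umin uu ubound]].
exists u; split=> // v vmin; apply: filterS (uu v vmin) => x vx _; exact: vx.
Qed.
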